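(* For every $g\geq 0$, $\mathbb{M}_{g,2}^{\mathrm{nd}} = \mathbb{M}_{g,\underline{2}}^{\mathrm{nd}}$.
   Context: Lattice polygon: convex hull of a nonempty finite subset of $\mathbb{Z}^2$; genus $g(P)$ = number of interior lattice points; $P^{(1)}$ = convex hull of interior lattice points. Lattice width $\mathrm{lw}$: least $s$ such that some map $x\mapsto Ax+b$ ($A\in\mathrm{GL}_2(\mathbb{Z})$, $b\in\mathbb{Z}^2$) sends the polygon into $\mathbb{R}\times[0,s]$; segments/points have lattice width $0$, the empty set $-1$. Expected gonality $\mathrm{egon}(P)=\mathrm{lw}(P^{(1)})+2$, except $\mathrm{egon}(P)=3$ for $P$ equivalent to $\mathrm{conv}\{(-2,-2),(2,0),(0,2)\}$. Smooth tropical plane curves with Newton polygon $P$: min-plus tropical polynomials with finite coefficients at all lattice points of $P$ inducing a regular unimodular triangulation of $P$; skeleton: metric graph obtained by deleting infinite rays, retracting leaves, smoothing 2-valent vertices. $\mathbb{M}_P$: set of skeletons of smooth tropical plane curves with Newton polygon $P$; $\mathbb{M}_g^{\mathrm{nd}}=\bigcup_{g(P)=g}\mathbb{M}_P$. Gonality of a metric graph: minimum degree of a divisor of rank $\geq1$. $\mathbb{M}_{g,d}^{\mathrm{nd}}=\{\Gamma\in\mathbb{M}_g^{\mathrm{nd}}:\mathrm{gon}(\Gamma)=d\}$ and $\mathbb{M}_{g,\underline{d}}^{\mathrm{nd}}=\bigcup\{\mathbb{M}_P: g(P)=g,\ \mathrm{egon}(P)=d\}$. *)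

(* Defs.v *)
From HB Require Import structures.
From mathcomp Require Import all_boot all_order all_algebra.
From mathcomp Require Import finmap.
From mathcomp Require Import all_classical all_reals all_analysis.
Set Implicit Arguments.
Unset Strict Implicit.
Unset Printing Implicit Defensive.
Import Order.TTheory GRing.Theory Num.Theory.
Import numFieldNormedType.Exports.
Local Open Scope classical_set_scope.
Local Open Scope ring_scope.

(* The least element of A, with the junk value 0 when A is empty. *)
Definition least (A : set nat) : nat :=
  xget 0%N [set n | A n /\ forall m, A m -> (n <= m)%N].

(** * Lattice polygons *)

Definition zpoint (x y : int) : 'cV[int]_2 := \col_i (if i == 0 then x else y).

Section Polygons.
Variable R : realType.
Implicit Types (P K : set 'cV[R]_2) (A : 'M[int]_2) (b p : 'cV[int]_2).

Definition toR m n (M : 'M[int]_(m, n)) : 'M[R]_(m, n) := map_mx intr M.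

Definition convex_hull K : set 'cV[R]_2 :=
  smallest (fun C : set 'cV[R]_2 => convex_set C) K.

(* Points and segments are allowed. *)
Definition lattice_polygon P : Prop :=
  exists S : seq 'cV[int]_2, S != [::] /\ P = convex_hull (@toR 2 1 @` [set` S]).

Definition lattice_points P : set 'cV[int]_2 := [set p | P (toR p)].

(* The interior is the topological one in the plane, hence empty for points
   and segments. *)
Definition interior_lattice_points P : set 'cV[int]_2 :=
  [set p | interior P (toR p)].

Definition genus P : nat := #|` fset_set (interior_lattice_points P) |%fset.

Definition interior_polygon P : set 'cV[R]_2 :=
  convex_hull (@toR 2 1 @` interior_lattice_points P).

Definition affine_map A b (x : 'cV[R]_2) : 'cV[R]_2 := toR A *m x + toR b.

(* Over [int], [A \in unitmx] says det A = 1 or det A = -1, i.e. A is in GL_2(Z). *)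
Definition fits_in_strip K (s : nat) : Prop :=
  exists A b, A \in unitmx /\
    forall x, K x -> 0 <= affine_map A b x 1 0 <= s%:R.

Definition lattice_width K : int :=
  if `[< K = set0 >] then -1 else (least (fits_in_strip K))%:Z.

Definition equivalent_polygons P Q : Prop :=
  exists A b, A \in unitmx /\ Q = affine_map A b @` P.

Definition exceptional_triangle : set 'cV[R]_2 :=
  convex_hull [set toR (zpoint (-2) (-2)); toR (zpoint 2 0); toR (zpoint 0 2)].

Definition egon P : int :=
  if `[< equivalent_polygons exceptional_triangle P >] then 3
  else lattice_width (interior_polygon P) + 2.

End Polygons.

(** * Metric graphs *)

(* Multigraph model of a metric graph.  Loops and parallel edges are allowed;
   the order of the two endpoints of an edge is only a parametrization of the
   edge e by [0, len e] and is ignored by [mgraph_iso]. *)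
Record mgraph (R : realType) := MGraph {
  vert : finType;
  edge : finType;
  ends : edge -> vert * vert;
  len : edge -> R;
  len_gt0 : forall e, 0 < len e }.

Section MetricGraphs.
Variable R : realType.
Implicit Types G H : mgraph R.

Definition mgraph_iso G H : Prop :=
  exists (fv : vert G -> vert H) (fe : edge G -> edge H),
    [/\ bijective fv, bijective fe,
        forall e, len (fe e) = len e &
        forall e, ends (fe e) = (fv (ends e).1, fv (ends e).2) \/
                  ends (fe e) = (fv (ends e).2, fv (ends e).1)].

Section AddLeaf.
Variables (G : mgraph R) (v : vert G) (l : R) (l_gt0 : 0 < l).

Definition add_leaf_ends (e : option (edge G)) :
    option (vert G) * option (vert G) :=
  if e is Some e0 then (Some (ends e0).1, Some (ends e0).2) else (Some v, None).

Definition add_leaf_len (e : option (edge G)) : R :=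
  if e is Some e0 then len e0 else l.

Lemma add_leaf_len_gt0 e : 0 < add_leaf_len e.
Proof. by case: e => [e|] //=; exact: len_gt0. Qed.

Definition add_leaf : mgraph R := MGraph add_leaf_ends add_leaf_len_gt0.
End AddLeaf.

Section Subdivide.
Variables (G : mgraph R) (e : edge G) (t : R) (t_in : 0 < t < len e).

(* [Some e] becomes the part of e before the new 2-valent vertex [None], and
   the edge [None] is the part after it. *)
Definition subdivide_ends (e1 : option (edge G)) :
    option (vert G) * option (vert G) :=
  if e1 is Some e0 then
    (Some (ends e0).1, if e0 == e then None else Some (ends e0).2)
  else (None, Some (ends e).2).

Definition subdivide_len (e1 : option (edge G)) : R :=
  if e1 is Some e0 then (if e0 == e then t else len e0) else len e - t.

Lemma subdivide_len_gt0 e1 : 0 < subdivide_len e1.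
Proof.
case: e1 => [e1|] /=; last by rewrite subr_gt0; case/andP: t_in.
by case: ifP => _; [case/andP: t_in | exact: len_gt0].
Qed.

Definition subdivide : mgraph R := MGraph subdivide_ends subdivide_len_gt0.
End Subdivide.

(* H arises from G by retracting one leaf, or by smoothing one 2-valent
   vertex (the vertex of a loop with no other edge is not smoothed). *)
Inductive simplification_step G H : Prop :=
| RetractLeaf (v : vert H) (l : R) (l_gt0 : 0 < l) of
    mgraph_iso G (add_leaf v l_gt0)
| SmoothVertex (e : edge H) (t : R) (t_in : 0 < t < len e) of
    mgraph_iso G (subdivide t_in).

Inductive simplifies : mgraph R -> mgraph R -> Prop :=
| SimplifiesIso G H of mgraph_iso G H : simplifies G H
| SimplifiesStep G H K of simplification_step G H & simplifies H K :
    simplifies G K.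

(* H is the canonical model of the skeleton of G: nothing is left to retract
   or to smooth.  A metric graph of this kind is determined up to isometry by
   its canonical model up to isomorphism. *)
Definition is_skeleton G H : Prop :=
  simplifies G H /\ forall K, ~ simplification_step H K.

(** * Divisors and gonality *)

(* Points of the metric graph: vertices, and pairs (e, t) where t is the
   distance along e from (ends e).1. *)
Definition gpoint G : Type :=
  (vert G + {et : edge G * R | 0 < et.2 < len et.1})%type.

Definition is_divisor G (D : gpoint G -> int) : Prop :=
  finite_set [set x | D x != 0].

Definition effective G (D : gpoint G -> int) : Prop := forall x, 0 <= D x.

Definition deg G (D : gpoint G -> int) : int :=
  \sum_(x \in [set: gpoint G]) D x.

Definition integer_piecewise_linear (l : R) (f : R -> R) : Prop :=
  exists (n : nat) (b : nat -> R) (m : nat -> int),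
    [/\ b 0%N = 0, b n = l,
        forall i, (i < n)%N -> b i < b i.+1 &
        forall i t, (i < n)%N -> b i <= t <= b i.+1 ->
          f t = f (b i) + (m i)%:~R * (t - b i)].

(* A rational function is given by its values on the vertices and its
   restrictions to the parametrized edges; values f e t with t outside
   [0, len e] are irrelevant. *)
Definition rational_function G (fv : vert G -> R) (f : edge G -> R -> R) : Prop :=
  forall e, [/\ f e 0 = fv (ends e).1, f e (len e) = fv (ends e).2 &
                integer_piecewise_linear (len e) (f e)].

(* Outgoing slopes of f at t in the direction of increasing, resp. decreasing,
   parameter. *)
Definition slope_right (f : R -> R) (t : R) : int :=
  xget 0 [set m : int | \forall h \near 0^'+, f (t + h) = f t + m%:~R * h].

Definition slope_left (f : R -> R) (t : R) : int :=
  xget 0 [set m : int | \forall h \near 0^'+, f (t - h) = f t + m%:~R * h].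

(* Sum of outgoing slopes; a loop contributes two directions at its vertex. *)
Definition principal_divisor G (f : edge G -> R -> R) (x : gpoint G) : int :=
  match x with
  | inl v => \sum_(e | (ends e).1 == v) slope_right (f e) 0 +
             \sum_(e | (ends e).2 == v) slope_left (f e) (len e)
  | inr et => let: (e, t) := val et in slope_right (f e) t + slope_left (f e) t
  end.

Definition linearly_equivalent G (D D' : gpoint G -> int) : Prop :=
  exists (fv : vert G -> R) (f : edge G -> R -> R),
    rational_function fv f /\ forall x, D' x = D x + principal_divisor f x.

(* The rank of D is at least r. *)
Definition rank_ge G (D : gpoint G -> int) (r : nat) : Prop :=
  forall E : gpoint G -> int,
    is_divisor E -> effective E -> deg E = r%:Z ->
    exists D', [/\ is_divisor D', effective D' &
                   linearly_equivalent (fun x => D x - E x) D'].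

Definition gonality G : nat :=
  least [set d | exists D : gpoint G -> int,
                   [/\ is_divisor D, deg D = d%:Z & rank_ge D 1]].

End MetricGraphs.

(** * Smooth tropical plane curves *)

Section TropicalCurves.
Variable R : realType.
Implicit Types (P : set 'cV[R]_2) (w : 'cV[R]_2) (T : set 'cV[int]_2).

Definition pairing (p : 'cV[int]_2) w : R := \sum_i (p i 0)%:~R * w i 0.

(* The monomials of the min-plus polynomial
   w |-> min_(p in P) (c p + <p, w>) attaining the minimum at w.  These sets,
   for varying w, are the cells of the regular subdivision of P induced by c.
   Only the values of c at the lattice points of P matter. *)
Definition minimizers P (c : 'cV[int]_2 -> R) w : set 'cV[int]_2 :=
  [set p | lattice_points P p /\
     forall q, lattice_points P q -> c p + pairing p w <= c q + pairing q w].

(* Triangle of area 1/2, given by its vertices. *)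
Definition unimodular_triangle T : Prop :=
  exists p q r, T = [set p; q; r] /\
    `|\det (row_mx (q - p) (r - p) : 'M[int]_2)| = 1.

(* c induces a regular unimodular triangulation of P: every maximal cell is a
   unimodular triangle.  In particular P is two-dimensional. *)
Definition smooth P (c : 'cV[int]_2 -> R) : Prop :=
  forall w,
    (forall w', minimizers P c w `<=` minimizers P c w' ->
                minimizers P c w' `<=` minimizers P c w) ->
    unimodular_triangle (minimizers P c w).

(* The vertices of a smooth tropical curve are dual to the triangles. *)
Definition curve_vertex P c w : Prop := unimodular_triangle (minimizers P c w).

(* w and w' are the endpoints of a bounded edge, dual to an edge pq shared by
   two triangles of the triangulation. *)
Definition bounded_edge P c w w' : Prop :=
  [/\ curve_vertex P c w, curve_vertex P c w', w <> w' &
      exists p q, p <> q /\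
        [set p; q] `<=` minimizers P c w `&` minimizers P c w'].

Definition lattice_length w w' (l : R) : Prop :=
  exists u : 'cV[int]_2,
    coprimez (u 0 0) (u 1 0) /\ w' - w = l *: toR R u.

(* G is the metric graph obtained from the tropical curve of c by deleting the
   unbounded rays. *)
Definition is_bounded_part P c (G : mgraph R) : Prop :=
  exists pos : vert G -> 'cV[R]_2,
    [/\ injective pos,
        range pos = curve_vertex P c,
        forall e, bounded_edge P c (pos (ends e).1) (pos (ends e).2) /\
                  lattice_length (pos (ends e).1) (pos (ends e).2) (len e) &
        forall v v', bounded_edge P c (pos v) (pos v') ->
          exists! e, ends e = (v, v') \/ ends e = (v', v)].

(* Sets of metric graphs are isomorphism-closed predicates on canonical models;
   [mgraph R] is too large a type for the universe of [set]. *)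
Definition M_P P (Gamma : mgraph R) : Prop :=
  exists c, smooth P c /\
    exists G, is_bounded_part P c G /\ is_skeleton G Gamma.

Definition M_nd (g : nat) (Gamma : mgraph R) : Prop :=
  exists P, [/\ lattice_polygon P, genus P = g & M_P P Gamma].

Definition M_nd_gon (g d : nat) (Gamma : mgraph R) : Prop :=
  M_nd g Gamma /\ gonality Gamma = d.

Definition M_nd_egon (g d : nat) (Gamma : mgraph R) : Prop :=
  exists P, [/\ lattice_polygon P, genus P = g, egon P = d%:Z & M_P P Gamma].

End TropicalCurves.

(* Main.v *)
(** An effective divisor of degree 2 of positive rank survives retraction of leaves and
    smoothing, so the gonality of the skeleton can be read off the bounded part of the
    tropical curve.  Let I be the set of interior lattice points of P; expected gonality 2
    means that I is nonempty and collinear.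

    A rational function with poles on a divisor of degree 2 has at most two edges crossing
    any level.  The edges dual to the segments at an interior point p form a cycle C_p, which
    every level crosses at least twice.  Hence no single chip moves along C_p; the two ends
    of an edge dual to a segment p q with p, q in I form a divisor of the pencil, and so does
    twice a vertex dual to a triangle p b b' whose other vertices are on the boundary and
    whose opposite side separates p from other points of I.  If two such divisors on C_p point
    in nonparallel directions, the function moving one to the other has slope -1 or 1 on
    each of the two arcs of C_p; comparing the total slope with the closing condition of C_p,
    and using that the boundary of P is convex, gives a contradiction.  So the directions at
    each p are parallel, and walking between triangles shows that I is collinear.

    Conversely, if I has at least two points and is collinear, then P lies in a strip of
    lattice width 2 and intersecting the curve with a pencil of parallel lines gives the
    divisors; if I has at most one point, an injection from bounded edges to vertices shows
    that the first Betti number is at most 1, and 0 when I is empty. *)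

Require Import Defs.
From mathcomp Require Import all_boot all_order all_algebra.
From mathcomp Require Import all_classical all_reals all_analysis.
From mathcomp Require Import zify ring lra.
Set Implicit Arguments.
Unset Strict Implicit.
Unset Printing Implicit Defensive.
Import Order.TTheory GRing.Theory Num.Theory.
Import numFieldNormedType.Exports.
Local Open Scope classical_set_scope.
Local Open Scope ring_scope.

(** * Chip firing on metric graphs *)

(** The bound on levels is a flux identity: the slopes across a superlevel set add up to the chips
    it loses, at most 2 here. An edge dual to a segment between interior points lies on two cycles,
    so a level separating its ends would need three crossings. The edge dual to a boundary chord is
    a bridge, and everything beyond it can be collapsed onto its end.

    The contradiction on C_p compares two functions on its edges: the flow, and the signed lattice
    distance y of the dual neighbour of p from the line in the second direction. Weighted by edge
    lengths both sum to 0, because height and position return to their start. Convexity makes the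
    flow at most y on each edge, so the two agree, which fails at the first divisor. The inequality
    rests on the three-term recursion of y along the neighbours of p, whose coefficient is at most 2
    at a boundary point.

    No planar topology is at hand, since the triangulation is known only through [minimizers]. Two
    facts replace it: equal convex combinations from two cells force common lattice points
    ([cross]), and a walk from triangle to triangle towards a fixed point ends, as a potential
    increases ([walk_ind]). *)

Section PiecewiseLinear.
Variable R : realType.
Implicit Types (f g : R -> R) (a b c t h : R) (m : int).

(** The functions of [integer_piecewise_linear], but closed under gluing by construction, so that
    sums, shifts and restrictions go by induction without sequences of breakpoints. *)
Inductive ipl f : R -> R -> Prop :=
| IplAffine a b m of a < b &
    (forall t, a <= t <= b -> f t = f a + m%:~R * (t - a)) : ipl f a b
| IplGlue a c b of ipl f a c & ipl f c b : ipl f a b.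

Lemma ipl_lt f a b : ipl f a b -> a < b.
Proof. by elim=> // a1 c b1 _ ac _ cb; exact: lt_trans ac cb. Qed.

Lemma ipl_restrict f a b c d : ipl f a b -> a <= c -> c < d -> d <= b -> ipl f c d.
Proof.
move=> H; elim: H c d => {a b} [a b m ab fE|a e b _ IH1 _ IH2] c d ac cd db.
  apply: (@IplAffine f c d m) => // t /andP[ct td].
  by rewrite (fE t) ?(fE c); [ring| lra| lra].
have [de|ed] := leP d e; first exact: IH1.
have [ec|ce] := leP e c; first exact: IH2.
by apply: (@IplGlue f c e d); [apply: IH1|apply: IH2]; rewrite // ltW.
Qed.

Lemma eq_ipl f g a b : (forall t, a <= t <= b -> f t = g t) -> ipl f a b -> ipl g a b.
Proof.
move=> fg H; elim: H fg => {a b} [a b m ab fE|a c b H1 IH1 H2 IH2] fg.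
  apply: (@IplAffine g a b m) => // t tab.
  by rewrite -fg // -fg ?lexx ?ltW // fE.
have ac := ipl_lt H1; have cb := ipl_lt H2.
apply: (@IplGlue g a c b); [apply: IH1|apply: IH2] => t tab; apply: fg; lra.
Qed.

Lemma ipl_add f g a b : ipl f a b -> ipl g a b -> ipl (fun t => f t + g t) a b.
Proof.
move=> H; elim: H g => {a b} [a b m ab fE|a c b H1 IH1 H2 IH2] g Hg; last first.
  have ac := ipl_lt H1; have cb := ipl_lt H2.
  by apply: (@IplGlue _ a c b); [apply: IH1|apply: IH2];
    apply: (ipl_restrict Hg); rewrite // ltW.
(* Once [f] is affine on the interval, the induction runs over the pieces of [g]. *)
elim: Hg ab fE => {a b} [a b n ab gE _ fE|a c b H1 IH1 H2 IH2 ab fE].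
  apply: (@IplAffine _ a b (m + n)) => // t tab.
  by rewrite fE // gE // intrD; ring.
have ac := ipl_lt H1; have cb := ipl_lt H2.
apply: (@IplGlue _ a c b); [apply: IH1 => // t ? | apply: IH2 => // t ?].
  by apply: fE; lra.
by rewrite (fE t) ?(fE c); [ring| lra| lra].
Qed.

Lemma ipl_opp f a b : ipl f a b -> ipl (fun t => - f t) a b.
Proof.
elim=> {a b} [a b m ab fE|a c b _ H1 _ H2]; last exact: IplGlue H1 H2.
by apply: (@IplAffine _ a b (- m)) => // t tab; rewrite fE // intrN; ring.
Qed.

Lemma ipl_shift f a b k :
  ipl f a b -> ipl (fun t => f (t + k)) (a - k) (b - k).
Proof.
elim=> {a b} [a b m ab fE|a c b _ H1 _ H2]; last exact: IplGlue H1 H2.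
apply: (@IplAffine _ _ _ m) => [|t tab]; first by rewrite ltrD2r.
by rewrite fE ?subrK; [ring|lra].
Qed.

Lemma ipl_flip f a b k :
  ipl f a b -> ipl (fun t => f (k - t)) (k - b) (k - a).
Proof.
elim=> {a b} [a b m ab fE|a c b _ H1 _ H2]; last exact: IplGlue H2 H1.
apply: (@IplAffine _ _ _ (- m)) => [|t tab]; first by lra.
by rewrite fE ?(fE (k - (k - b))) ?intrN; [ring|lra|lra].
Qed.

Lemma iplP (l : R) f : 0 < l -> integer_piecewise_linear l f <-> ipl f 0 l.
Proof.
move=> l_gt0; split.
  move=> [n [b [m [b0 bn blt fE]]]].
  have H k : (k < n)%N -> ipl f 0 (b k.+1).
    elim: k => [|k IH] kn.
      rewrite -b0; apply: (@IplAffine _ _ _ (m 0%N)); first exact: blt.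
      by move=> t tab; apply: fE.
    apply: (@IplGlue _ _ (b k.+1)); first by apply: IH; exact: ltnW.
    apply: (@IplAffine _ _ _ (m k.+1)); first exact: blt.
    by move=> t tab; apply: fE.
  case: n bn blt fE H => [bn|n bn _ _ H]; first by move: l_gt0; rewrite -bn b0 ltxx.
  by rewrite -bn; exact: H.
have G a c : ipl f a c -> exists (n : nat) (b : nat -> R) (m : nat -> int),
    [/\ b 0%N = a, b n = c,
        forall i, (i < n)%N -> b i < b i.+1 &
        forall i t, (i < n)%N -> b i <= t <= b i.+1 ->
          f t = f (b i) + (m i)%:~R * (t - b i)].
  elim=> {a c} [a b m ab fE|a c b _ [n1 [b1 [m1 [b10 b1n lt1 f1]]]] _ [n2 [b2 [m2 [b20 b2n lt2 f2]]]]].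
    exists 1%N, (fun i => if i is 0%N then a else b), (fun=> m).
    by split => // -[] // t _; exact: fE.
  pose d i := if (i < n1)%N then b1 i else b2 (i - n1)%N.
  have bl i : (i <= n1)%N -> d i = b1 i.
    by rewrite /d leq_eqVlt => /orP[/eqP->|->] //; rewrite ltnn subnn b1n b20.
  have br i : d (n1 + i)%N = b2 i by rewrite /d ltnNge leq_addr addKn.
  exists (n1 + n2)%N, d, (fun i => if (i < n1)%N then m1 i else m2 (i - n1)%N).
  split=> [||i|i t].
  - by rewrite bl.
  - by rewrite br.
  - have [in1 _|n1i] := ltnP i n1; first by rewrite !bl ?lt1 // ltnW.
    by rewrite -(subnKC n1i) ltn_add2l -addnS !br; exact: lt2.
  - have [in1 _|n1i] := ltnP i n1; first by rewrite !bl ?(ltnW in1) //; exact: f1.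
    by rewrite -(subnKC n1i) ltn_add2l -addnS !br addKn; exact: f2.
by move/G.
Qed.

(** An explicit radius in place of the filter in [slope_right]; by [slope_uniq] at most one slope
    qualifies, so the [xget] there returns it. *)
Definition right_slope f t m := exists2 e, 0 < e &
  forall h, 0 < h < e -> f (t + h) = f t + m%:~R * h.
Definition left_slope f t m := exists2 e, 0 < e &
  forall h, 0 < h < e -> f (t - h) = f t + m%:~R * h.

Lemma slope_uniq (F : R -> R) (y : R) m n e1 e2 : 0 < e1 -> 0 < e2 ->
  (forall h, 0 < h < e1 -> F h = y + m%:~R * h) ->
  (forall h, 0 < h < e2 -> F h = y + n%:~R * h) -> m = n.
Proof.
move=> e1p e2p H1 H2; pose h := Num.min e1 e2 / 2.
have me : 0 < Num.min e1 e2 by rewrite lt_min e1p.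
have h0 : 0 < h by rewrite /h divr_gt0.
have hm : h < Num.min e1 e2 by rewrite /h ltr_pdivrMr // mulr_natr mulr2n ltrDl.
move: hm; rewrite lt_min => /andP[h1 h2].
have := H1 h; rewrite h0 h1 => /(_ isT) E1; have := H2 h; rewrite h0 h2 => /(_ isT).
rewrite E1 => /addrI /(mulIf (lt0r_neq0 h0)) /intr_inj //.
Qed.

Lemma near_rightP (Q : R -> Prop) :
  (\forall h \near 0^'+, Q h) <-> exists2 e : R, 0 < e & forall h, 0 < h < e -> Q h.
Proof.
rewrite near_withinE; split.
  move=> /nbhs_ballP[e /= e0 H]; exists e => // h /andP[h0 he].
  by apply: H; rewrite //= /ball /= sub0r normrN gtr0_norm.
move=> [e e0 H]; apply/nbhs_ballP; exists e => //= h.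
by rewrite /ball /= sub0r normrN => he h0; apply: H; rewrite h0 -(gtr0_norm h0).
Qed.

Lemma slope_rightE f t m : right_slope f t m -> slope_right f t = m.
Proof.
move=> H; apply: xget_unique => [|n /near_rightP[e e0 H']]; first exact/near_rightP.
by case: H => e1 e10 H; exact: slope_uniq e0 e10 H' H.
Qed.

Lemma slope_leftE f t m : left_slope f t m -> slope_left f t = m.
Proof.
move=> H; apply: xget_unique => [|n /near_rightP[e e0 H']]; first exact/near_rightP.
by case: H => e1 e10 H; exact: slope_uniq e0 e10 H' H.
Qed.

Lemma ipl_right_slope f a b t : ipl f a b -> a <= t < b -> exists m, right_slope f t m.
Proof.
move=> H; elim: H t => {a b} [a b m ab fE|a c b _ IH1 _ IH2] t /andP[at_ tb].
  exists m, (b - t) => [|h /andP[h0 hb]]; first lra.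
  by rewrite (fE (t + h)) ?(fE t); [ring|lra|lra].
by have [tc|ct] := ltP t c; [apply: IH1|apply: IH2]; lra.
Qed.

Lemma ipl_left_slope f a b t : ipl f a b -> a < t <= b -> exists m, left_slope f t m.
Proof.
move=> H; elim: H t => {a b} [a b m ab fE|a c b _ IH1 _ IH2] t /andP[at_ tb].
  exists (- m), (t - a) => [|h /andP[h0 hb]]; first lra.
  by rewrite (fE (t - h)) ?(fE t) ?intrN; [ring|lra|lra].
by have [ct|tc] := ltP c t; [apply: IH2|apply: IH1]; lra.
Qed.

Lemma right_slope_add f g t m n : right_slope f t m -> right_slope g t n ->
  right_slope (fun t => f t + g t) t (m + n).
Proof.
move=> [e1 e1p H1] [e2 e2p H2]; exists (Num.min e1 e2); first by rewrite lt_min e1p.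
move=> h /andP[h0]; rewrite lt_min => /andP[h1 h2].
by rewrite H1 ?h0 // H2 ?h0 // intrD; ring.
Qed.

Lemma left_slope_add f g t m n : left_slope f t m -> left_slope g t n ->
  left_slope (fun t => f t + g t) t (m + n).
Proof.
move=> [e1 e1p H1] [e2 e2p H2]; exists (Num.min e1 e2); first by rewrite lt_min e1p.
move=> h /andP[h0]; rewrite lt_min => /andP[h1 h2].
by rewrite H1 ?h0 // H2 ?h0 // intrD; ring.
Qed.

Lemma right_slope_opp f t m : right_slope f t m -> right_slope (fun t => - f t) t (- m).
Proof. by move=> [e ep H]; exists e => // h hh; rewrite H // intrN; ring. Qed.

Lemma left_slope_opp f t m : left_slope f t m -> left_slope (fun t => - f t) t (- m).
Proof. by move=> [e ep H]; exists e => // h hh; rewrite H // intrN; ring. Qed.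

(* The half-open conventions make the left-hand side additive under gluing. *)
Lemma ipl_segments f a b : ipl f a b ->
  exists S : seq (R * R * int),
  [/\ forall t, (if a <= t < b then slope_right f t else 0) +
                (if a < t <= b then slope_left f t else 0) =
        \sum_(s <- S) (s.2 * (s.1.1 == t)%:R - s.2 * (s.1.2 == t)%:R),
      forall s, s \in S -> [/\ a <= s.1.1, s.1.1 < s.1.2, s.1.2 <= b &
         f s.1.2 - f s.1.1 = s.2%:~R * (s.1.2 - s.1.1)] &
      forall U : R -> int, \sum_(s <- S) (U s.1.1 - U s.1.2) = U a - U b].
Proof.
elim=> {a b} [a b m ab fE|a c b H1 [S1 [E1 V1 T1]] H2 [S2 [E2 V2 T2]]].
  exists [:: (a, b, m)]; split=> [t|s|U]; last by rewrite big_seq1.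
    rewrite big_seq1 /=.
    have sr t' : a <= t' < b -> slope_right f t' = m.
      move=> /andP[at_ tb]; apply: slope_rightE; exists (b - t') => [|h /andP[h0 hb]]; first lra.
      by rewrite (fE (t' + h)) ?(fE t'); [ring|lra|lra].
    have sl t' : a < t' <= b -> slope_left f t' = - m.
      move=> /andP[at_ tb]; apply: slope_leftE; exists (t' - a) => [|h /andP[h0 hb]]; first lra.
      by rewrite (fE (t' - h)) ?(fE t') ?intrN; [ring|lra|lra].
    case: (ltgtP a t) => [at_|ta|<-{t}].
    - case: (ltgtP t b) => [tb|bt|->{t at_}]; rewrite ?mulr0 ?mulr1 ?subr0 ?sub0r ?addr0 ?add0r //=.
        by rewrite sr ?sl ?(ltW at_) ?(ltW tb) ?at_ ?tb //; lia.
      by rewrite sl // ab lexx.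
    - have tb := lt_trans ta ab; rewrite (gt_eqF tb).
      by rewrite ?mulr0 ?mulr1 ?subr0 ?sub0r ?addr0 ?add0r.
    - rewrite ab (gt_eqF ab) /= mulr1 mulr0 subr0 addr0 sr ?lexx ?ab //.
  by rewrite inE => /eqP-> /=; split=> //; have -> := fE b; [ring|rewrite lexx ltW].
have ac := ipl_lt H1; have cb := ipl_lt H2.
exists (S1 ++ S2); split=> [t|s|U].
- rewrite big_cat /= -E1 -E2.
  case: (ltgtP t c) => [tc|ct|->{t}].
  + rewrite (lt_trans tc cb) (ltW (lt_trans tc cb)) !andbT.
    by rewrite !addr0 //.
  + rewrite (lt_trans ac ct) (ltW (lt_trans ac ct)) /= ?add0r ?andbT.
    by rewrite ?andbF ?add0r ?addr0.
  + by rewrite ac (ltW ac) cb (ltW cb) /= addrC addr0 add0r.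
- rewrite mem_cat => /orP[/V1[? ? ? ?]|/V2[? ? ? ?]]; split=> //; lra.
- by rewrite big_cat /= T1 T2; ring.
Qed.

End PiecewiseLinear.

(** * Divisors of rational functions as flows through cuts *)

Section Flow.
Variables (R : realType) (G : mgraph R).
Implicit Types (fv : vert G -> R) (f : edge G -> R -> R) (e : edge G)
  (x : gpoint G).

(** Identifies the ends of an edge with vertices, so that every parameter in the closed interval
    names a point; parameters outside are clamped to the nearer end. *)
Definition point_on e (t : R) : gpoint G :=
  if insub (e, t) is Some x then inr x
  else if t <= 0 then inl (ends e).1 else inl (ends e).2.

Lemma point_on0 e : point_on e 0 = inl (ends e).1.
Proof. by rewrite /point_on; case: insubP => [u|] /=; rewrite ltxx ?lexx. Qed.

Lemma point_on_len e : point_on e (len e) = inl (ends e).2.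
Proof.
rewrite /point_on; case: insubP => [u|] /=; first by rewrite ltxx andbF.
by rewrite leNgt len_gt0.
Qed.

Lemma point_on_in e t (h : 0 < t < len e) : point_on e t = inr (Sub (e, t) h).
Proof. by rewrite /point_on insubT. Qed.

Lemma point_on_inl e t v : 0 <= t <= len e ->
  (point_on e t == inl v) = ((t == 0) && ((ends e).1 == v)) ||
                            ((t == len e) && ((ends e).2 == v)).
Proof.
move=> /andP[]; rewrite le_eqVlt => /orP[/eqP<-{t} _|t0].
  by rewrite point_on0 eqxx /= (lt_eqF (len_gt0 e)) orbF.
rewrite le_eqVlt => /orP[/eqP->{t t0}|tl].
  by rewrite point_on_len eqxx /= (gt_eqF (len_gt0 e)).
by rewrite (@point_on_in e t) ?t0 // (gt_eqF t0) (lt_eqF tl).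
Qed.

Lemma point_on_inr e t et : 0 <= t <= len e ->
  (point_on e t == inr et) = ((e, t) == val et).
Proof.
move=> /andP[]; case: et => -[e' t'] /= h'.
rewrite le_eqVlt => /orP[/eqP<-{t} _|t0].
  by rewrite point_on0; apply/esym/eqP => -[_ E]; case/andP: h'; rewrite -E ltxx.
rewrite le_eqVlt => /orP[/eqP->{t t0}|tl].
  rewrite point_on_len; apply/esym/eqP => -[E1 E]; case/andP: h'.
  by rewrite -E -E1 ltxx.
by rewrite (@point_on_in e t) ?t0 //.
Qed.

Definition value fv f x : R :=
  match x with inl v => fv v | inr et => f (val et).1 (val et).2 end.

Lemma value_point_on fv f e t : rational_function fv f -> 0 <= t <= len e ->
  value fv f (point_on e t) = f e t.
Proof.
move=> H /andP[]; have [H0 Hl _] := H e.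
rewrite le_eqVlt => /orP[/eqP<-{t} _|t0]; first by rewrite point_on0.
rewrite le_eqVlt => /orP[/eqP->{t t0}|tl]; first by rewrite point_on_len.
by rewrite (@point_on_in e t) ?t0.
Qed.

Definition edge_divisor f e x : int :=
  match x with
  | inl v => (if (ends e).1 == v then slope_right (f e) 0 else 0) +
             (if (ends e).2 == v then slope_left (f e) (len e) else 0)
  | inr et => if (val et).1 == e
      then slope_right (f e) (val et).2 + slope_left (f e) (val et).2 else 0
  end.

Lemma principal_divisor_sum f x :
  principal_divisor f x = \sum_e edge_divisor f e x.
Proof.
case: x => [v|[[e t] h]] /=; first by rewrite big_split /= -!big_mkcond.
by rewrite -big_mkcond /= (big_pred1 e) // => e'; rewrite /= eq_sym.
Qed.

(* [S e] lists the linear segments [((t1, t2), slope)] of the function on e. *)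
Lemma flow fv f : rational_function fv f ->
  exists S : edge G -> seq (R * R * int),
  [/\ forall e x, edge_divisor f e x =
        \sum_(s <- S e) (s.2 * (point_on e s.1.1 == x)%:R - s.2 * (point_on e s.1.2 == x)%:R),
      forall e (s : R * R * int), s \in S e -> exists2 l : R, 0 < l &
        value fv f (point_on e s.1.2) - value fv f (point_on e s.1.1) = s.2%:~R * l &
      forall e (U : gpoint G -> int), \sum_(s <- S e) (U (point_on e s.1.1) - U (point_on e s.1.2)) =
         U (inl (ends e).1) - U (inl (ends e).2)].
Proof.
move=> H.
have H1 e : ipl (f e) 0 (len e) by have [_ _ /(iplP _ (len_gt0 e))] := H e.
have /choice[S HS] : forall e, exists S : seq (R * R * int),
  [/\ forall t, (if 0 <= t < len e then slope_right (f e) t else 0) +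
                (if 0 < t <= len e then slope_left (f e) t else 0) =
        \sum_(s <- S) (s.2 * (s.1.1 == t)%:R - s.2 * (s.1.2 == t)%:R),
      forall s, s \in S -> [/\ 0 <= s.1.1, s.1.1 < s.1.2, s.1.2 <= len e &
         f e s.1.2 - f e s.1.1 = s.2%:~R * (s.1.2 - s.1.1)] &
      forall U : R -> int, \sum_(s <- S) (U s.1.1 - U s.1.2) = U 0 - U (len e)].
  by move=> e; exact: ipl_segments.
exists S; split=> [e x|e s|e U]; have [E V T] := HS e; last first.
- by have := T (fun t => U (point_on e t)); rewrite point_on0 point_on_len.
- move=> /V[s0 s12 sl E']; exists (s.1.2 - s.1.1); first by rewrite subr_gt0.
  by rewrite !value_point_on // ?s0 ?sl ?andbT ?(le_trans s0 (ltW s12)) // (le_trans (ltW s12) sl).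
- have l0 := len_gt0 e.
  case: x => [v|et] /=.
    have -> : (if (ends e).1 == v then slope_right (f e) 0 else 0) =
       (\sum_(s <- S e) (s.2 * (s.1.1 == 0)%:R - s.2 * (s.1.2 == 0)%:R)) * ((ends e).1 == v)%:R.
      by rewrite -E lexx l0 ltxx /= addr0; case: eqP; rewrite ?mulr1 ?mulr0.
    have -> : (if (ends e).2 == v then slope_left (f e) (len e) else 0) =
       (\sum_(s <- S e) (s.2 * (s.1.1 == len e)%:R - s.2 * (s.1.2 == len e)%:R)) * ((ends e).2 == v)%:R.
      by rewrite -E lexx l0 ltxx andbF /= add0r; case: eqP; rewrite ?mulr1 ?mulr0.
    rewrite !mulr_suml -big_split /=; apply: eq_big_seq => s /V[s0 s12 sl _].
    have s1l : 0 <= s.1.1 <= len e by rewrite s0 (le_trans (ltW s12) sl).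
    have s2l : 0 <= s.1.2 <= len e by rewrite sl (le_trans s0 (ltW s12)).
    have K (t : R) : 0 <= t <= len e -> (point_on e t == inl v)%:R =
        (t == 0%R)%:R * ((ends e).1 == v)%:R + (t == len e)%:R * ((ends e).2 == v)%:R :> int.
      move=> /point_on_inl->; have [->|_] := eqVneq t 0.
        by rewrite (lt_eqF l0) /= orbF mul0r addr0 mul1r.
      by rewrite /= mul0r add0r -natrM mulnb.
    by rewrite !K //; ring.
  have [[tv0 tvl]|] := (@andP (0 < (val et).2) ((val et).2 <= len e)); last first.
    move=> nh; have -> : ((val et).1 == e) = false.
      by apply/eqP => E1; apply: nh; have := valP et; rewrite E1 => /andP[-> /ltW].
    rewrite big1_seq // => s /= /V[s0 s12 sl _].
    rewrite !point_on_inr ?s0 ?sl ?andbT ?(le_trans (ltW s12) sl) ?(le_trans s0 (ltW s12)) //.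
    have F t : ((e, t) == val et) = false.
      by apply/eqP => E1; apply: nh; have := valP et; rewrite -E1 => /= /andP[-> /ltW].
    by rewrite !F !mulr0 subr0.
  have -> : (if (val et).1 == e then slope_right (f e) (val et).2 + slope_left (f e) (val et).2 else 0)
    = (\sum_(s <- S e) (s.2 * (s.1.1 == (val et).2)%:R - s.2 * (s.1.2 == (val et).2)%:R)) * ((val et).1 == e)%:R.
    case: eqP => [E1|_]; last by rewrite mulr0.
    by rewrite mulr1 -E; have := valP et; rewrite /= E1 => /andP[h1 h2]; rewrite h1 h2 (ltW h1) (ltW h2).
  rewrite mulr_suml; apply: eq_big_seq => s /V[s0 s12 sl _].
  rewrite !point_on_inr ?s0 ?sl ?andbT ?(le_trans (ltW s12) sl) ?(le_trans s0 (ltW s12)) //.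
  have F t : ((e, t) == val et)%:R = (t == (val et).2)%:R * ((val et).1 == e)%:R :> int.
    by rewrite -natrM mulnb; case: (val et) => a b /=; rewrite xpair_eqE andbC (eq_sym a).
  by rewrite !F; ring.
Qed.

Lemma sum_count_mem (T : eqType) (X s : seq T) (U : pred T) : uniq X -> {subset s <= X} ->
  (count U s)%:Z = \sum_(x <- X | U x) (count_mem x s)%:Z.
Proof.
move=> uX; elim: s => [|a s IH] sX; first by rewrite /= big1.
rewrite /= PoszD IH => [|x xs]; last by apply: sX; rewrite inE xs orbT.
under [in RHS]eq_bigr => x _ do rewrite PoszD.
rewrite big_split /=; congr (_ + _).
rewrite big_mkcond (bigD1_seq a) /= ?sX ?inE ?eqxx //.
rewrite big1 => [|x /negbTE]; first by rewrite addr0; case: (U a).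
by rewrite eq_sym => ->; case: (U x).
Qed.

(* An effective divisor is the list of its points; [moves] is linear equivalence. *)
Definition moves (s s' : seq (gpoint G)) := exists (fv : vert G -> R) (f : edge G -> R -> R),
  rational_function fv f /\
  forall x, (count_mem x s')%:Z = (count_mem x s)%:Z + principal_divisor f x.

(** A discrete Stokes formula: a linear segment contributes its slope at its start and the opposite
    at its end, so only segments with one end in [U] survive. *)
Lemma principal_divisor_cut fv f (U : pred (gpoint G)) (X : seq (gpoint G)) (S : edge G -> seq (R * R * int)) :
  (forall e x, edge_divisor f e x =
     \sum_(s <- S e) (s.2 * (point_on e s.1.1 == x)%:R - s.2 * (point_on e s.1.2 == x)%:R)) ->
  uniq X -> (forall x, principal_divisor f x != 0 -> x \in X) ->
  rational_function fv f ->
  \sum_(x <- X | U x) principal_divisor f x =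
  \sum_e \sum_(s <- S e) s.2 * ((U (point_on e s.1.1))%:R - (U (point_on e s.1.2))%:R).
Proof.
move=> HS uX suppX _.
(* [X] need not contain every breakpoint. Enlarging it to [Y] adds points of coefficient 0 only, and
   then each segment end is found exactly once in the sum. *)
pose Y := undup (X ++ flatten [seq [seq point_on e s.1.1 | s <- S e] ++ [seq point_on e s.1.2 | s <- S e] | e <- enum (edge G)]).
have XY : {subset X <= Y} by move=> x xX; rewrite mem_undup mem_cat xX.
have memY e s : s \in S e -> (point_on e s.1.1 \in Y) /\ (point_on e s.1.2 \in Y).
  move=> se; rewrite !mem_undup !mem_cat; split; apply/orP; right; apply/flatten_mapP;
  (exists e; first by rewrite mem_enum); rewrite mem_cat; apply/orP; [left|right]; apply/mapP; exists s => //.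
have -> : \sum_(x <- X | U x) principal_divisor f x = \sum_(x <- Y | U x) principal_divisor f x.
  rewrite [RHS](bigID (fun x => x \in X)) /= [X in _ = _ + X]big1 ?addr0; last first.
    by move=> x /andP[_]; apply: contraNeq => /suppX.
  rewrite big_mkcond [RHS]big_mkcond /=.
  rewrite [RHS](bigID (fun x => x \in X)) /= [X in _ = _ + X]big1 ?addr0; last first.
    by move=> x /negbTE ->; rewrite andbF.
  rewrite -[RHS]big_filter [in RHS](perm_big X) /=; last first.
    rewrite uniq_perm ?filter_uniq ?undup_uniq // => x; rewrite mem_filter.
    by case xX: (x \in X) => //=; rewrite XY.
  by apply: eq_big_seq => x ->; rewrite andbT.
under eq_bigr => x _ do (rewrite principal_divisor_sum; under eq_bigr => e _ do rewrite HS).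
rewrite exchange_big /=; apply: eq_bigr => e _.
rewrite exchange_big /= !big_seq; apply: eq_bigr => s /memY[m1 m2].
have K p : p \in Y -> \sum_(x <- Y | U x) (p == x)%:R = (U p)%:R :> int.
  move=> pY; rewrite big_mkcond (bigD1_seq p) ?undup_uniq //= eqxx big1 ?addr0; first by case: (U p).
  by move=> x; rewrite eq_sym => /negbTE->; case: (U x).
by rewrite big_split /= sumrN -!mulr_sumr !K // mulrBr.
Qed.

Lemma principal_divisor_finite fv f : rational_function fv f ->
  exists X : seq (gpoint G), uniq X /\ forall x, principal_divisor f x != 0 -> x \in X.
Proof.
move=> H; have [S [E _ _]] := flow H.
pose Y := undup (flatten [seq [seq point_on e s.1.1 | s <- S e] ++
   [seq point_on e s.1.2 | s <- S e] | e <- enum (edge G)]).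
exists Y; split=> [|x]; first exact: undup_uniq.
apply: contraR => xY; rewrite principal_divisor_sum big1 // => e _.
rewrite E big1_seq // => s /= sS.
have N p : p \in [seq point_on e s.1.1 | s <- S e] ++ [seq point_on e s.1.2 | s <- S e] ->
  (p == x) = false.
  move=> pS; apply: contraNF xY => /eqP<-; rewrite mem_undup; apply/flatten_mapP.
  by exists e => //; rewrite mem_enum.
have N1 : (point_on e s.1.1 == x) = false.
  by apply: N; rewrite mem_cat; apply/orP; left; apply/mapP; exists s.
have N2 : (point_on e s.1.2 == x) = false.
  by apply: N; rewrite mem_cat; apply/orP; right; apply/mapP; exists s.
by rewrite N1 N2 !mulr0 subr0.
Qed.

Lemma principal_divisor_degree fv f (X : seq (gpoint G)) : rational_function fv f ->
  uniq X -> (forall x, principal_divisor f x != 0 -> x \in X) ->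
  \sum_(x <- X) principal_divisor f x = 0.
Proof.
move=> H uX sX; have [S [E _ _]] := flow H.
rewrite (principal_divisor_cut xpredT E uX sX H).
by rewrite big1 // => e _; rewrite big1 // => s _; rewrite subrr mulr0.
Qed.

Section Moves.
Variables (s s' : seq (gpoint G)) (fv : vert G -> R) (f : edge G -> R -> R).
Hypothesis H : rational_function fv f.
Hypothesis Hd : forall x, (count_mem x s')%:Z = (count_mem x s)%:Z + principal_divisor f x.

Lemma count_cut (U : pred (gpoint G)) S :
  (forall e x, edge_divisor f e x =
     \sum_(s <- S e) (s.2 * (point_on e s.1.1 == x)%:R - s.2 * (point_on e s.1.2 == x)%:R)) ->
  (count U s')%:Z - (count U s)%:Z =
  \sum_e \sum_(s <- S e) s.2 * ((U (point_on e s.1.1))%:R - (U (point_on e s.1.2))%:R).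
Proof.
move=> E; pose X := undup (s ++ s').
have uX : uniq X by exact: undup_uniq.
rewrite -(principal_divisor_cut U E uX _ H); last first.
  move=> x; apply: contraR; rewrite mem_undup mem_cat negb_or => /andP[xs xs'].
  have := Hd x; rewrite (count_memPn xs) (count_memPn xs') add0r => <- //.
rewrite (@sum_count_mem _ X s') //; last by move=> x xs; rewrite mem_undup mem_cat xs orbT.
rewrite (@sum_count_mem _ X s) //; last by move=> x xs; rewrite mem_undup mem_cat xs.
by rewrite -sumrB; apply: eq_bigr => x _; rewrite Hd addrC addKr.
Qed.

Lemma moves_size : size s' = size s.
Proof.
have [S [E _ _]] := flow H.
have := @count_cut xpredT S E; rewrite !count_predT big1 => [|e _].
  by move=> /eqP; rewrite subr_eq0 => /eqP[].
by rewrite big1 // => g _; rewrite subrr mulr0.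
Qed.

(* Crossings of the level [tau], weighted by slope, are bounded by the number
   of chips that leave the superlevel set. *)
Lemma level_cut (tau : R) : exists X : edge G -> nat,
  [/\ (\sum_e X e)%N%:Z = (count (fun x => tau < value fv f x) s)%:Z -
                        (count (fun x => tau < value fv f x) s')%:Z,
      forall e, (tau < fv (ends e).1) != (tau < fv (ends e).2) -> (0 < X e)%N &
      forall v, (count_mem (inl v) s < count_mem (inl v) s')%N -> fv v = tau ->
        exists e, [/\ ((ends e).1 == v) || ((ends e).2 == v), (0 < X e)%N &
          ((tau < fv (ends e).1) != (tau < fv (ends e).2)) \/ (1 < X e)%N]].
Proof.
have [S [E V T]] := flow H.
pose U x := tau < value fv f x.
pose cr e := fun g : R * R * int => U (point_on e g.1.1) != U (point_on e g.1.2).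
have mono e g : g \in S e ->
    [/\ (0 < g.2) = (value fv f (point_on e g.1.1) < value fv f (point_on e g.1.2)) &
        (g.2 < 0) = (value fv f (point_on e g.1.2) < value fv f (point_on e g.1.1))].
  move=> /V[l l0 D]; split.
    by rewrite -[RHS]subr_gt0 D pmulr_lgt0 // ltr0z.
  by rewrite -[RHS]subr_lt0 D pmulr_llt0 // ltrz0.
pose X e := (\sum_(g <- S e) (absz g.2 * cr e g)%N)%N.
have Xterm e g : g \in S e ->
    - (absz g.2 * cr e g)%N%:Z = g.2 * ((U (point_on e g.1.1))%:R - (U (point_on e g.1.2))%:R).
  move=> /mono[m1 m2]; rewrite /cr /U.
  have [t1|t1] := ltP tau (value fv f (point_on e g.1.1));
  have [t2|t2] := ltP tau (value fv f (point_on e g.1.2)) => /=;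
  rewrite ?muln0 ?muln1 ?subrr ?subr0 ?sub0r ?mulr1 ?mulr0 ?mulrN1 ?oppr0 //.
  - by rewrite ltz0_abs ?opprK // m2; exact: le_lt_trans t2 t1.
  - by rewrite gtz0_abs // m1; exact: le_lt_trans t1 t2.
have crX e g : g \in S e -> cr e g -> (0 < absz g.2)%N.
  move=> /mono[m1 m2]; rewrite /cr /U.
  have [t1|t1] := ltP tau (value fv f (point_on e g.1.1));
  have [t2|t2] := ltP tau (value fv f (point_on e g.1.2)) => //=.
  - have : g.2 < 0 by rewrite m2; exact: le_lt_trans t2 t1.
    by move=> h; rewrite absz_gt0 ?(lt0r_neq0 h) ?(ltr0_neq0 h).
  - have : 0 < g.2 by rewrite m1; exact: le_lt_trans t1 t2.
    by move=> h; rewrite absz_gt0 ?(lt0r_neq0 h) ?(ltr0_neq0 h).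
have XE e g : g \in S e -> cr e g -> (0 < X e)%N.
  move=> ge cg; rewrite /X (big_rem g) //= cg muln1 addn_gt0.
  by rewrite (crX _ _ ge cg).
have XU e : (tau < fv (ends e).1) != (tau < fv (ends e).2) -> (0 < X e)%N.
  move=> D; have [/hasP[g ge cg]|/hasPn N] := boolP (has (cr e) (S e)); first exact: XE ge cg.
  have := T e (fun x => (U x)%:R); rewrite big1_seq => [|g /= /N].
    by move: D; rewrite /U /=; case: (tau < _); case: (tau < _).
  by rewrite negbK => /eqP->; rewrite subrr.
exists X; split=> // [|v vlt vt].
  rewrite -[LHS]opprK -[RHS]opprB; congr (- _); rewrite (count_cut U E).
  rewrite (big_morph _ PoszD (erefl _)) -sumrN; apply: eq_bigr => e _.
  rewrite /X (big_morph _ PoszD (erefl _)) -sumrN.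
  by apply: eq_big_seq => g /Xterm.
(* A vertex that gains a chip has a positive outgoing slope, so some linear segment at [v] rises at
   once; at height [tau], the vertex itself is outside the strict superlevel set. *)
have div_gt0 : 0 < \sum_e edge_divisor f e (inl v).
  rewrite -principal_divisor_sum; have := Hd (inl v); move: (principal_divisor _ _) => d.
  by move: (count _ _) (count _ _) vlt => n n'; lia.
have [e e_gt0] : exists e, 0 < edge_divisor f e (inl v).
  apply: contrapT => /forallNP N; move: div_gt0; rewrite ltNge => /negP; apply.
  by apply: sumr_le0 => e _; rewrite leNgt; apply/negP/N.
have [g ge] : exists2 g, g \in S e & 0 < g.2 * (point_on e g.1.1 == inl v)%:R - g.2 * (point_on e g.1.2 == inl v)%:R.
  apply: contrapT => /forall2NP N; move: e_gt0; rewrite ltNge E => /negP; apply.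
  rewrite big_seq; apply: sumr_le0 => g ge; rewrite leNgt; apply/negP.
  by case: (N g).
have vv : value fv f (inl v) = tau by [].
move=> g_gt0; have cg : cr e g.
  rewrite /cr /U; have [m1 m2] := mono _ _ ge.
  case: (point_on e g.1.1 =P inl v) g_gt0 => [E1|_];
  case: (point_on e g.1.2 =P inl v) => [E2|_]; rewrite ?mulr0 ?mulr1 ?subrr ?subr0 ?sub0r ?ltxx //.
    by rewrite m1 E1 vv ltxx => ->.
  by rewrite oppr_gt0 m2 E2 vv ltxx => ->.
have X0 := XE _ _ ge cg.
exists e; split=> //.
  have P t : point_on e t = inl v -> ((ends e).1 == v) || ((ends e).2 == v).
    rewrite /point_on; case: insubP => [//|_].
    by case: ifP => _ [->]; rewrite eqxx ?orbT.
  case: (point_on e g.1.1 =P inl v) g_gt0 => [/P//|_].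
  by case: (point_on e g.1.2 =P inl v) => [/P//|_]; rewrite !mulr0 subrr ltxx.
have [D|D] := eqVneq (tau < fv (ends e).1) (tau < fv (ends e).2); [right|by left].
(* The number of crossings on an edge has the parity of the difference between its ends, so with
   both ends on one side a single crossing brings a second one. *)
have [k Hk] : exists k : int, \sum_(g <- S e) ((U (point_on e g.1.1))%:R - (U (point_on e g.1.2))%:R) =
    (count (cr e) (S e))%:Z - 2 * k :> int.
  elim: (S e) => [|a l [k IH]]; first by exists 0; rewrite big_nil.
  exists (k + (~~ U (point_on e a.1.1) && U (point_on e a.1.2))%:R).
  rewrite big_cons IH /= PoszD /cr.
  by case: (U (point_on e a.1.1)); case: (U (point_on e a.1.2)) => /=; lia.
have c_gt0 : (0 < count (cr e) (S e))%N by rewrite -has_count; apply/hasP; exists g.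
have c_gt1 : (1 < count (cr e) (S e))%N.
  move: Hk; rewrite (T e (fun x => (U x)%:R)) /U /= D subrr; move: (count _ _) c_gt0 => n; lia.
apply: leq_trans c_gt1 _; rewrite -sum1_count big_mkcond /X !big_seq; apply: leq_sum => h he.
by case: ifP => // ch; rewrite muln1 (crX _ _ he ch).
Qed.

End Moves.

End Flow.

(** * Linear equivalence of effective divisors *)

Section MovesTheory.
Variables (R : realType) (G : mgraph R).
Implicit Types (fv : vert G -> R) (f : edge G -> R -> R) (e : edge G)
  (x : gpoint G) (s r : seq (gpoint G)).

Lemma rational_ipl fv f e : rational_function fv f -> ipl (f e) 0 (len e).
Proof. by move=> H; have [_ _ /(iplP _ (len_gt0 e))] := H e. Qed.

Lemma ipl_slope_add (g h : R -> R) a b (t : R) : ipl g a b -> ipl h a b ->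
  (a <= t < b -> slope_right (fun t => g t + h t) t = slope_right g t + slope_right h t) /\
  (a < t <= b -> slope_left (fun t => g t + h t) t = slope_left g t + slope_left h t).
Proof.
move=> Hg Hh; split=> tab.
  have [m Hm] := ipl_right_slope Hg tab; have [n Hn] := ipl_right_slope Hh tab.
  by rewrite (slope_rightE (right_slope_add Hm Hn)) (slope_rightE Hm) (slope_rightE Hn).
have [m Hm] := ipl_left_slope Hg tab; have [n Hn] := ipl_left_slope Hh tab.
by rewrite (slope_leftE (left_slope_add Hm Hn)) (slope_leftE Hm) (slope_leftE Hn).
Qed.

Lemma ipl_slope_opp (g : R -> R) a b (t : R) : ipl g a b ->
  (a <= t < b -> slope_right (fun t => - g t) t = - slope_right g t) /\
  (a < t <= b -> slope_left (fun t => - g t) t = - slope_left g t).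
Proof.
move=> Hg; split=> tab.
  have [m Hm] := ipl_right_slope Hg tab.
  by rewrite (slope_rightE (right_slope_opp Hm)) (slope_rightE Hm).
have [m Hm] := ipl_left_slope Hg tab.
by rewrite (slope_leftE (left_slope_opp Hm)) (slope_leftE Hm).
Qed.

Lemma edge_divisor_add f g e x : ipl (f e) 0 (len e) -> ipl (g e) 0 (len e) ->
  edge_divisor (fun e t => f e t + g e t) e x = edge_divisor f e x + edge_divisor g e x.
Proof.
move=> Hf Hg; have A t := ipl_slope_add t Hf Hg; have l0 := len_gt0 e.
case: x => [v|[[e' t] /= h]] /=; last first.
  case: eqP => [E|]; last by rewrite addr0.
  by subst e'; have [A1 A2] := A t; rewrite A1 ?A2; [ring|lra..].
rewrite (proj1 (A 0)) ?lexx // (proj2 (A (len e))) ?l0 ?lexx //.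
by case: eqP; case: eqP => _ _; ring.
Qed.

Lemma rational_add fv f gv g : rational_function fv f -> rational_function gv g ->
  rational_function (fun v => fv v + gv v) (fun e t => f e t + g e t) /\
  forall x, principal_divisor (fun e t => f e t + g e t) x =
    principal_divisor f x + principal_divisor g x.
Proof.
move=> Hf Hg; split=> [e|x].
  have [f0 fl _] := Hf e; have [g0 gl _] := Hg e.
  split; rewrite ?f0 ?fl ?g0 ?gl //.
  by apply/iplP; [exact: len_gt0 | apply: ipl_add; exact: rational_ipl].
rewrite !principal_divisor_sum -big_split /=; apply: eq_bigr => e _.
by apply: edge_divisor_add; exact: rational_ipl.
Qed.

Lemma rational_opp fv f : rational_function fv f ->
  rational_function (fun v => - fv v) (fun e t => - f e t) /\
  forall x, principal_divisor (fun e t => - f e t) x = - principal_divisor f x.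
Proof.
move=> Hf; split=> [e|x].
  have [f0 fl _] := Hf e.
  split; rewrite ?f0 ?fl //.
  by apply/iplP; [exact: len_gt0 | apply: ipl_opp; exact: rational_ipl].
rewrite !principal_divisor_sum -sumrN /=; apply: eq_bigr => e _.
have A t := ipl_slope_opp t (rational_ipl e Hf).
have l0 := len_gt0 e.
case: x => [v|[[e' t] /= h]] /=; last first.
  case: eqP => [E|]; last by rewrite oppr0.
  by subst e'; have [A1 A2] := A t; rewrite A1 ?A2; [ring|lra..].
rewrite (proj1 (A 0)) ?lexx // (proj2 (A (len e))) ?l0 ?lexx //.
by case: eqP; case: eqP => _ _; ring.
Qed.

Lemma slope_cst (c t : R) : slope_right (fun=> c) t = 0 /\ slope_left (fun=> c) t = 0.
Proof.
by split; [apply: slope_rightE|apply: slope_leftE]; exists 1 => // h _; rewrite mul0r addr0.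
Qed.

Lemma ipl_cst (c a b : R) : a < b -> ipl (fun=> c) a b.
Proof. by move=> ab; apply: (@IplAffine _ _ _ _ 0) => // t _; rewrite mul0r addr0. Qed.

Lemma perm_moves s s' : perm_eq s s' -> moves s s'.
Proof.
move=> /permP E; exists (fun=> 0), (fun _ _ => 0); split=> [e|x].
  by split=> //; apply/iplP; [exact: len_gt0|apply: ipl_cst; exact: len_gt0].
rewrite principal_divisor_sum big1 ?addr0 ?E // => e _.
have [c1 c2] := (proj1 (slope_cst 0 0), proj2 (slope_cst 0 (len e))).
case: x => [v|et] /=; first by rewrite c1 c2 !if_same addr0.
by rewrite (proj1 (slope_cst _ _)) (proj2 (slope_cst _ _)) if_same.
Qed.

Lemma moves_refl s : moves s s. Proof. exact: perm_moves. Qed.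

Lemma moves_sym s s' : moves s s' -> moves s' s.
Proof.
move=> [fv [f [/rational_opp[H E] D]]].
exists (fun v => - fv v), (fun e t => - f e t); split=> // x.
by rewrite E D addrK.
Qed.

Lemma moves_trans s s' s'' : moves s s' -> moves s' s'' -> moves s s''.
Proof.
move=> [fv [f [H D]]] [gv [g [H' D']]]; have [A E] := rational_add H H'.
exists (fun v => fv v + gv v), (fun e t => f e t + g e t); split=> // x.
by rewrite E D' D; ring.
Qed.

Lemma moves_cat s s' r : moves s s' -> moves (s ++ r) (s' ++ r).
Proof.
move=> [fv [f [H D]]]; exists fv, f; split=> // x.
by rewrite !count_cat !PoszD D; ring.
Qed.

Lemma moves_sizeE s s' : moves s s' -> size s' = size s.
Proof. by move=> [fv [f [H D]]]; exact: moves_size H D. Qed.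

(** The function is kept on the block given by [A] and [EA] and frozen at its value in the cut
    vertex [a] elsewhere. Away from [a] the divisor is the restricted one; its coefficient at [a] is
    then forced by degree 0. *)
Lemma moves_cut_vertex (A : pred (vert G)) (EA : pred (edge G)) a s s'
  (U := fun x : gpoint G => match x with inl v => A v | inr et => EA (val et).1 end) :
  A a ->
  (forall e, EA e -> A (ends e).1 && A (ends e).2) ->
  (forall e, ~~ EA e -> (A (ends e).1 -> (ends e).1 = a) /\ (A (ends e).2 -> (ends e).2 = a)) ->
  moves s s' ->
  exists gv g, rational_function gv g /\ forall x, principal_divisor g x =
    (if U x then (count_mem x s')%:Z - (count_mem x s)%:Z else 0) -
    (if x == inl a then (count U s')%:Z - (count U s)%:Z else 0).
Proof.
move=> Aa EAin EAout [fv [f [H D]]].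
pose gv v := if A v then fv v else fv a.
pose g e := if EA e then f e else fun=> fv a.
have Hg : rational_function gv g.
  move=> e; rewrite /g /gv; case: ifPn => [/EAin/andP[-> ->]|/EAout[E1 E2]]; first exact: H.
  split; last by apply/iplP; [exact: len_gt0|apply: ipl_cst; exact: len_gt0].
    by case: ifP => // /E1->.
  by case: ifP => // /E2->.
exists gv, g; split=> //.
have off x : x != inl a -> principal_divisor g x =
    if U x then (count_mem x s')%:Z - (count_mem x s)%:Z else 0.
  move=> xa; rewrite D addrC addKr !principal_divisor_sum.
  have loc e : edge_divisor g e x = if U x then edge_divisor f e x else 0.
    rewrite /g; case: x xa => [v|[[e' t] h]] /= xa; last first.
      case: eqP => [->|]; last by rewrite if_same.
      by case: ifP => // _; have [-> ->] := slope_cst (fv a) t.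
    case: (boolP (EA e)) => [EAe|/EAout[E1 E2]].
      have /andP[A1 A2] := EAin _ EAe.
      case: (boolP (A v)) => // Av.
      by rewrite !ifN ?addr0 //; apply: contraNneq Av => <-.
    rewrite (proj1 (slope_cst _ _)) (proj2 (slope_cst _ _)) !if_same addr0.
    case: (boolP (A v)) => // Av.
    have va : v != a by apply: contraNneq xa => ->.
    rewrite !ifN ?addr0 //; apply: contraNneq va => E.
      by apply/eqP; rewrite -E; apply: E2; rewrite E.
    by apply/eqP; rewrite -E; apply: E1; rewrite E.
  under eq_bigr do rewrite loc.
  by case: (U x) => //; rewrite big1.
move=> x; have [{x}->|xa] := eqVneq x (inl a); last by rewrite off // subr0.
pose X := undup (inl a :: s ++ s').
have uX : uniq X by exact: undup_uniq.
have aX : (inl a : gpoint G) \in X by rewrite mem_undup inE eqxx.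
have supp y : principal_divisor g y != 0 -> y \in X.
  have [-> //|ya] := eqVneq y (inl a); rewrite off //; apply: contraR => yX.
  move: yX; rewrite mem_undup inE mem_cat !negb_or => /and3P[_ ys ys'].
  by rewrite (count_memPn ys) (count_memPn ys') subrr if_same.
have := principal_divisor_degree Hg uX supp; rewrite (bigD1_seq _ aX uX) /=.
rewrite [X in _ + X](eq_bigr (fun x => if U x then (count_mem x s')%:Z - (count_mem x s)%:Z else 0)); last first.
  by move=> y; exact: off.
have -> : (count U s')%:Z - (count U s)%:Z =
   \sum_(x <- X) (if U x then (count_mem x s')%:Z - (count_mem x s)%:Z else 0).
  rewrite -big_mkcond /= sumrB -!sum_count_mem // => y ys;
  by rewrite mem_undup inE mem_cat ys ?orbT.
move=> E; rewrite [in RHS](bigD1_seq _ aX uX) /= Aa.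
by move/eqP: E; rewrite addr_eq0 => /eqP->; ring.
Qed.

Lemma ipl_linear (g : R -> R) a b : ipl g a b ->
  (forall t, a < t < b -> slope_right g t + slope_left g t = 0) ->
  exists m : int, [/\ forall t, a <= t <= b -> g t = g a + m%:~R * (t - a),
     slope_right g a = m & slope_left g b = - m].
Proof.
elim=> {a b} [a b m ab gE _|a c b H1 IH1 H2 IH2 Z].
  exists m; split=> //.
    apply: slope_rightE; exists (b - a) => [|h hh]; first lra.
    by rewrite gE; [ring|lra].
  apply: slope_leftE; exists (b - a) => [|h hh]; first lra.
  by rewrite gE ?[g b]gE ?intrN; [ring|lra..].
have ac := ipl_lt H1; have cb := ipl_lt H2.
have [|m [g1 s1 l1]] := IH1; first by move=> t tt; apply: Z; lra.
have [|n [g2 s2 l2]] := IH2; first by move=> t tt; apply: Z; lra.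
have E : n = m by have := Z c; rewrite l1 s2 ac cb => /(_ isT)/eqP; rewrite subr_eq0 => /eqP.
rewrite {}E in g2 s2 l2; exists m; split=> // t tt.
have [tc|ct] := leP t c; first by rewrite g1 //; lra.
by rewrite g2 ?(g1 c); [ring|lra..].
Qed.

Lemma rational_linear fv f e : rational_function fv f ->
  (forall t (h : 0 < t < len e), principal_divisor f (inr (Sub (e, t) h)) = 0) ->
  exists m : int, [/\ fv (ends e).2 - fv (ends e).1 = m%:~R * len e,
    slope_right (f e) 0 = m & slope_left (f e) (len e) = - m].
Proof.
move=> H Z; have [t tt|m [E s l]] := ipl_linear (rational_ipl e H); first exact: (Z t tt).
exists m; split=> //; have [<- <- _] := H e.
by rewrite E ?lexx ?(ltW (len_gt0 e)) //; ring.
Qed.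

(** With all chips on vertices no slope changes inside an edge, so the function is linear there and
    one integer [sg] per edge describes it. *)
Lemma moves_vertices (a b : seq (vert G)) : moves (map inl a) (map inl b) ->
  exists (fv : vert G -> R) (sg : edge G -> int),
    (forall e, fv (ends e).2 - fv (ends e).1 = (sg e)%:~R * len e) /\
    (forall v, (count_mem v b)%:Z - (count_mem v a)%:Z =
       \sum_e sg e * (((ends e).1 == v)%:R - ((ends e).2 == v)%:R)).
Proof.
move=> [fv [f [H D]]].
have N (c : seq (vert G)) et : count_mem (inr et : gpoint G) (map inl c) = 0%N.
  by rewrite count_map; elim: c.
have Cv (c : seq (vert G)) v : count_mem (inl v : gpoint G) (map inl c) = count_mem v c.
  by rewrite count_map; apply: eq_count => w.
have /choice[sg Hs] : forall e, exists m : int, [/\ fv (ends e).2 - fv (ends e).1 = m%:~R * len e,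
    slope_right (f e) 0 = m & slope_left (f e) (len e) = - m].
  move=> e; apply: rational_linear => // t h.
  by have := D (inr (Sub (e, t) h)); rewrite !N add0r.
exists fv, sg; split=> [e|v]; first by have [] := Hs e.
have := D (inl v); rewrite !Cv => ->; rewrite addrC addKr principal_divisor_sum.
apply: eq_bigr => e _ /=; have [_ -> ->] := Hs e.
by case: eqP; case: eqP => _ _ /=; ring.
Qed.

End MovesTheory.

(** * Rank, gonality and elementary chip moves *)

Section Pencil.
Variables (R : realType) (G : mgraph R).
Implicit Types (fv : vert G -> R) (f : edge G -> R -> R) (e : edge G)
  (x : gpoint G) (s r : seq (gpoint G)).

(* An effective divisor of degree d and rank at least 1. *)
Definition pencil (d : nat) := exists s, size s = d /\
  forall x, exists s', [/\ size s' = d, x \in s' & moves s s'].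

Lemma count_divisor s : is_divisor (fun x => (count_mem x s)%:Z).
Proof.
apply: (sub_finite_set _ (finite_seq s)) => x /=.
by apply: contraNP => /negP xs; rewrite (count_memPn xs).
Qed.

Lemma deg_count s : deg (fun x => (count_mem x s)%:Z) = (size s)%:Z.
Proof.
rewrite /deg (fsbigE (undup s)) ?undup_uniq //=; last first.
  by move=> x _; apply: contraNeq; rewrite mem_undup; apply: contraR => /count_memPn->.
rewrite big_mkcond /= -(count_predT s) (@sum_count_mem _ (undup s) s) ?undup_uniq //.
  by apply: eq_bigr => x _; rewrite in_setT.
by move=> x; rewrite mem_undup.
Qed.

Lemma effective_count (D : gpoint G -> int) : is_divisor D -> effective D ->
  exists s, D = fun x => (count_mem x s)%:Z.
Proof.
move=> /finite_seqP[X XE] D0.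
pose s := flatten [seq nseq (absz (D x)) x | x <- undup X].
exists s; apply/funext => x.
have -> : count_mem x s = if x \in undup X then absz (D x) else 0%N.
  rewrite /s; elim: (undup X) (undup_uniq X) => //= a l IH /andP[al ul].
  rewrite count_cat IH // count_nseq in_cons /= [a == x]eq_sym.
  have [->|_] := eqVneq x a; last by rewrite mul0n.
  by rewrite (negbTE al) mul1n addn0.
case: ifPn => [_|xX]; first by rewrite gez0_abs.
apply/eqP; apply: contraNT xX; rewrite mem_undup => Dx.
by have : [set x | D x != 0] x by []; rewrite XE.
Qed.

Lemma pencilP d (v0 : vert G) :
  (exists D : gpoint G -> int, [/\ is_divisor D, deg D = d%:Z & rank_ge D 1]) <-> pencil d.
Proof.
split; last first.
  move=> [s [sd H]]; exists (fun x => (count_mem x s)%:Z).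
  split; [exact: count_divisor|by rewrite deg_count sd|].
  move=> E Ed /(effective_count Ed)[t E']; rewrite {}E' in Ed *.
  rewrite deg_count => -[]; case: t {Ed} => [//|x [|//]] _.
  have [s' [s'd xs' [fv [f [Hf Df]]]]] := H x.
  exists (fun y => (count_mem y (rem x s'))%:Z); split=> //.
    exact: count_divisor.
  exists fv, f; split=> // y.
  have := Df y; rewrite (permP (perm_to_rem xs')) /= addn0 PoszD => E1.
  by rewrite addrAC -E1; ring.
move=> [D [Ddiv Dd H]].
pose ind x y : int := (count_mem y [:: x])%:Z.
have Hx x : exists s', x \in s' /\ exists (fv : vert G -> R) (f : edge G -> R -> R),
    rational_function fv f /\ forall y, (count_mem y s')%:Z = D y + principal_divisor f y.
  have [|D' [D'div D'eff [fv [f [Hf Df]]]]] := H (ind x) (count_divisor _) _ (deg_count _).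
    by move=> y.
  have [t E] := effective_count D'div D'eff; exists (x :: t); split; first by rewrite inE eqxx.
  exists fv, f; split=> // y; have := Df y; rewrite E /ind /= !PoszD => ->.
  by rewrite addr0; ring.
(* [D] itself may fail to be effective; the rank condition at [v0] supplies an effective
   representative [s], with which all others are compared. *)
have [s [xs [fv [f [Hf Df]]]]] := Hx (inl v0).
have sz s' : (exists (fv : vert G -> R) (f : edge G -> R -> R),
    rational_function fv f /\ forall y, (count_mem y s')%:Z = D y + principal_divisor f y) ->
    moves s s'.
  move=> [gv [g [Hg Dg]]].
  have [Hf' Ef'] := rational_opp Hf; have [Hs Es] := rational_add Hg Hf'.
  eexists; eexists; split; first exact: Hs.
  by move=> y; rewrite Es Ef' Df Dg; ring.
have sd : size s = d.
  apply/eqP; rewrite -eqz_nat -Dd -deg_count; apply/eqP.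
  have [X [uX sX]] := principal_divisor_finite Hf.
  have [Y YE] := (finite_seqP _).1 Ddiv.
  pose Z := undup (X ++ Y ++ s).
  have uZ : uniq Z by exact: undup_uniq.
  have HZ (F : gpoint G -> int) : (forall x, F x != 0 -> x \in Z) -> deg F = \sum_(x <- Z) F x.
    move=> FZ; rewrite /deg (fsbigE Z) //=; last by move=> x _; apply: contraNeq => /FZ.
    by rewrite big_mkcond /=; apply: eq_bigr => x _; rewrite in_setT.
  have DZ x : D x != 0 -> x \in Z.
    move=> Dx; have : [set x | D x != 0] x by []; rewrite YE /= => xY.
    by rewrite mem_undup !mem_cat xY orbT.
  rewrite !HZ //; last first.
    move=> x; apply: contraR; rewrite mem_undup !mem_cat !negb_or => /and3P[_ _ xn].
    by rewrite (count_memPn xn).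
  under eq_bigr do rewrite Df.
  rewrite big_split /= (principal_divisor_degree Hf uZ) ?addr0 // => x /sX xX.
  by rewrite mem_undup mem_cat xX.
exists s; split=> // x; have [s' [xs' Hs']] := Hx x.
by have m := sz _ Hs'; exists s'; split=> //; rewrite (moves_sizeE m).
Qed.

Lemma pencil0 (v0 : vert G) : ~ pencil 0.
Proof. by move=> [s [_ /(_ (inl v0))[s' [/size0nil-> //]]]]. Qed.

Lemma gonality2P (v0 : vert G) : gonality G = 2%N <-> pencil 2 /\ ~ pencil 1.
Proof.
rewrite /gonality /least.
pose A := [set d | exists D : gpoint G -> int, [/\ is_divisor D, deg D = d%:Z & rank_ge D 1]].
have AP d : A d <-> pencil d by exact: pencilP.
split.
  case: xgetP => [n /= nE [/AP pn mn] n2|//].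
  rewrite n2 in pn mn; split=> // /AP/mn //.
move=> [p2 n1]; apply: xget_unique => /=.
  split; first exact/AP.
  move=> [|[|m]] // /AP; [by move/(pencil0 v0)|by move/n1].
move=> m [/AP pm mm]; have := mm 2%N ((AP 2%N).2 p2).
by case: m pm {mm} => [|[|[|m]]] // /(pencil0 v0).
Qed.

Section Elementary.
Variable e0 : edge G.

Lemma ipl_min_cst (m : int) (c k a b : R) : a < b ->
  ipl (fun t => Num.min (c + m%:~R * t) k) a b.
Proof.
move=> ab; have m0 := @intr_eq0 R m.
have aff a' b' : a' < b' -> (forall t, a' <= t <= b' -> c + m%:~R * t <= k) ->
    ipl (fun t => Num.min (c + m%:~R * t) k) a' b'.
  move=> ab' H; apply: (@IplAffine _ _ _ _ m) => // t tt.
  by rewrite !min_l ?H ?lexx ?(ltW ab') //; ring.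
have cst a' b' : a' < b' -> (forall t, a' <= t <= b' -> k <= c + m%:~R * t) ->
    ipl (fun t => Num.min (c + m%:~R * t) k) a' b'.
  move=> ab' H; apply: (@IplAffine _ _ _ _ 0) => // t tt.
  by rewrite !min_r ?H ?lexx ?(ltW ab') //; ring.
have [mp|mn|mz] := ltgtP 0 (m%:~R : R).
- pose t0 := (k - c) / m%:~R.
  have E : c + m%:~R * t0 = k by rewrite /t0 mulrCA divff ?lt0r_neq0 // mulr1 addrC subrK.
  have lo t : t <= t0 -> c + m%:~R * t <= k by rewrite -E lerD2l ler_pM2l.
  have hi t : t0 <= t -> k <= c + m%:~R * t by rewrite -E lerD2l ler_pM2l.
  have [bt|tb] := leP b t0; first by apply: aff => // t /andP[_ tt]; apply/lo/(le_trans tt).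
  have [ta|a_t] := leP t0 a; first by apply: cst => // t /andP[tt _]; apply/hi/(le_trans ta).
  by apply: (@IplGlue _ _ _ t0); [apply: aff|apply: cst] => // t /andP[t1 t2]; [apply: lo|apply: hi].
- pose t0 := (k - c) / m%:~R.
  have E : c + m%:~R * t0 = k by rewrite /t0 mulrCA divff ?ltr0_neq0 // mulr1 addrC subrK.
  have lo t : t0 <= t -> c + m%:~R * t <= k by rewrite -E lerD2l ler_nM2l.
  have hi t : t <= t0 -> k <= c + m%:~R * t by rewrite -E lerD2l ler_nM2l.
  have [bt|tb] := leP b t0; first by apply: cst => // t /andP[_ tt]; apply/hi/(le_trans tt).
  have [ta|a_t] := leP t0 a; first by apply: aff => // t /andP[tt _]; apply/lo/(le_trans ta).
  by apply: (@IplGlue _ _ _ t0); [apply: cst|apply: aff] => // t /andP[t1 t2]; [apply: hi|apply: lo].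
- have [ck|kc] := leP c k; [apply: aff|apply: cst] => // t _; rewrite -mz mul0r addr0 //.
  exact: ltW.
Qed.

Lemma slope_right_min (m : int) (c k t : R) :
  slope_right (fun t => Num.min (c + m%:~R * t) k) t =
  if c + m%:~R * t < k then m else if c + m%:~R * t == k then Num.min m 0 else 0.
Proof.
apply: slope_rightE.
have M0 : 0 < `|m%:~R : R| + 1 by rewrite ltr_wpDl.
have [lt_|gt_|eq_] := ltgtP (c + m%:~R * t) k.
- exists ((k - (c + m%:~R * t)) / (`|m%:~R| + 1)) => [|h /andP[h0]].
    by rewrite divr_gt0 // subr_gt0.
  rewrite ltr_pdivlMr // => h1.
  have B : m%:~R * h <= `|m%:~R| * h by rewrite ler_pM2r // ler_norm.
  have N : h * (`|m%:~R : R| + 1) = `|m%:~R| * h + h by ring.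
  by rewrite !min_l; [ring|lra..].
- exists ((c + m%:~R * t - k) / (`|m%:~R| + 1)) => [|h /andP[h0]].
    by rewrite divr_gt0 // subr_gt0.
  rewrite ltr_pdivlMr // => h1.
  have B : - (m%:~R * h) <= `|m%:~R| * h by rewrite -mulNr ler_pM2r // -normrN ler_norm.
  have N : h * (`|m%:~R : R| + 1) = `|m%:~R| * h + h by ring.
  by rewrite !min_r; [ring|lra..].
- exists 1 => // h /andP[h0 _]; have [m0|m0] := leP m 0.
    have B : m%:~R * h <= 0 by rewrite pmulr_lle0 // lerz0.
    by rewrite !min_l; [ring|lra..].
  have B : 0 < m%:~R * h by rewrite pmulr_lgt0 // ltr0z.
  by rewrite !min_r; [ring|lra..].
Qed.

Lemma slope_left_min (m : int) (c k t : R) :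
  slope_left (fun t => Num.min (c + m%:~R * t) k) t =
  if c + m%:~R * t < k then - m else if c + m%:~R * t == k then Num.min (- m) 0 else 0.
Proof.
have := slope_right_min (- m) c k (- t).
have -> : slope_right (fun t => Num.min (c + (- m)%:~R * t) k) (- t) =
          slope_left (fun t => Num.min (c + m%:~R * t) k) t.
  rewrite /slope_right /slope_left; congr (xget _ _); apply/funext => n; apply/propext.
  have E h : c + (- m)%:~R * (- t + h) = c + m%:~R * (t - h) by rewrite intrN; ring.
  have E0 : c + (- m)%:~R * - t = c + m%:~R * t by rewrite intrN; ring.
  by rewrite E0; split; apply: filterS => h; rewrite E.
by rewrite intrN mulrNN.
Qed.

(** On the edge the function is [max (t - s) 0]: it slides one chip from the first end to the point
    at distance [t]. *)
Lemma edge_divisor_left f (t : R) x : 0 < t <= len e0 ->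
  f e0 = (fun s : R => - Num.min (- t + 1%:~R * s) 0) ->
  edge_divisor f e0 x = (point_on e0 t == x)%:R - ((inl (ends e0).1 : gpoint G) == x)%:R.
Proof.
move=> /andP[t0 tl] E; have l0 := len_gt0 e0.
have I := ipl_min_cst 1 (- t) 0 l0.
have SR (s : R) : 0 <= s < len e0 -> slope_right (f e0) s = if s < t then -1 else 0.
  move=> h; rewrite E (proj1 (ipl_slope_opp s I) h) slope_right_min mul1r addrC subr_lt0 subr_eq0.
  by case: ltgtP => // _; rewrite oppr0.
have SL (s : R) : 0 < s <= len e0 -> slope_left (f e0) s = if s <= t then 1 else 0.
  move=> h; rewrite E (proj2 (ipl_slope_opp s I) h) slope_left_min mul1r addrC subr_lt0 subr_eq0.
  by case: ltgtP => // _; rewrite ?oppr0 // opprK.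
case: x => [v|[[e' s] /= h]] /=; last first.
  have ti : 0 <= t <= len e0 by lra.
  rewrite point_on_inr //= xpair_eqE [e' == _]eq_sym subr0.
  case: eqP => [E'|_]; last by [].
  subst e'; rewrite SR ?SL; [|lra..].
  by case: (ltgtP s t).
have ti : 0 <= t <= len e0 by lra.
rewrite SR ?lexx // t0 SL ?l0 ?lexx // point_on_inl // (gt_eqF t0) /=.
have -> : (len e0 <= t) = (t == len e0) by rewrite [RHS]eq_le tl.
have -> : ((inl (ends e0).1 : gpoint G) == inl v) = ((ends e0).1 == v) by [].
by case: (_ == v); case: (_ == v); case: (t == _).
Qed.

Lemma edge_divisor_right f (t : R) x : 0 < t <= len e0 ->
  f e0 = (fun s : R => - Num.min ((len e0 - t) + (-1)%:~R * s) 0) ->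
  edge_divisor f e0 x = (point_on e0 (len e0 - t) == x)%:R - ((inl (ends e0).2 : gpoint G) == x)%:R.
Proof.
move=> /andP[t0 tl] E; have l0 := len_gt0 e0.
have I := ipl_min_cst (-1) (len e0 - t) 0 l0.
have E0 (s : R) : len e0 - t + (-1)%:~R * s = (len e0 - t) - s by rewrite mulN1r.
have SR (s : R) : 0 <= s < len e0 -> slope_right (f e0) s = if len e0 - t <= s then 1 else 0.
  move=> h; rewrite E (proj1 (ipl_slope_opp s I) h) slope_right_min E0 subr_lt0 subr_eq0.
  by case: ltgtP => // _; rewrite ?oppr0 // opprK.
have SL (s : R) : 0 < s <= len e0 -> slope_left (f e0) s = if len e0 - t < s then -1 else 0.
  move=> h; rewrite E (proj2 (ipl_slope_opp s I) h) slope_left_min E0 subr_lt0 subr_eq0.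
  by case: ltgtP => // _; rewrite ?oppr0 // opprK.
have ti : 0 <= len e0 - t <= len e0 by lra.
case: x => [v|[[e' s] /= h]] /=; last first.
  rewrite point_on_inr //= xpair_eqE [e' == _]eq_sym subr0.
  case: eqP => [E'|_]; last by [].
  subst e'; rewrite SR ?SL; [|lra..].
  by case: (ltgtP s (len e0 - t)).
rewrite SR ?lexx // SL ?l0 ?lexx // point_on_inl //.
have -> : (len e0 - t < len e0) by lra.
have -> : (len e0 - t <= 0) = (len e0 - t == 0) by case: (ltgtP (len e0 - t) 0); lra.
have -> : (len e0 - t == len e0) = false by apply/eqP; lra.
have -> : ((inl (ends e0).2 : gpoint G) == inl v) = ((ends e0).2 == v) by [].
by case: (_ == v); case: (_ == v); case: (_ == 0).
Qed.

Lemma edge_divisor_cst f (c : R) e x : f e = (fun=> c) -> edge_divisor f e x = 0.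
Proof.
move=> E; case: x => [v|et] /=; rewrite E.
  by rewrite (proj1 (slope_cst _ _)) (proj2 (slope_cst _ _)) !if_same.
by rewrite (proj1 (slope_cst _ _)) (proj2 (slope_cst _ _)) if_same.
Qed.

(** The function can be the constant [t] on one side of a bridge and 0 on the side beyond, or
    constant beyond the kink, so all its slope lies on the bridge. *)
Lemma moves_bridge (A : pred (vert G)) (t : R) :
  (forall e, e != e0 -> A (ends e).1 = A (ends e).2) -> A (ends e0).1 != A (ends e0).2 ->
  0 < t <= len e0 -> moves [:: inl (ends e0).1] [:: point_on e0 t].
Proof.
move=> HA Hd /[dup] tt /andP[t0 tl]; have l0 := len_gt0 e0.
pose fv v := if A v == A (ends e0).1 then t else 0.
pose f e := if e == e0 then (fun s : R => - Num.min (- t + 1%:~R * s) 0) else fun=> fv (ends e).1.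
exists fv, f; split=> [e|x].
  rewrite /f; case: (eqVneq e e0) => [->|ne]; last first.
    split=> //; first by rewrite /fv HA.
    by apply/iplP; [exact: len_gt0|apply: ipl_cst; exact: len_gt0].
  rewrite /fv eqxx [A (ends e0).2 == _]eq_sym (negbTE Hd) mulr0 addr0 mul1r; split.
  - by rewrite min_l ?opprK //; lra.
  - by rewrite min_r ?oppr0 //; lra.
  - by apply/iplP => //; apply: ipl_opp; exact: ipl_min_cst.
rewrite principal_divisor_sum (bigD1 e0) //= big1 ?addr0; last first.
  by move=> e ne; apply: edge_divisor_cst; rewrite /f (negbTE ne).
rewrite (@edge_divisor_left f t) ?tt //; last by rewrite /f eqxx.
by rewrite addn0; case: eqP; case: eqP.
Qed.

(** The function is [t] off the edge, and on it two ramps descend from the ends; they may overlap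
    when [t] exceeds half the length, which the sum handles without a case split. *)
Lemma moves_edge_ends (t : R) : 0 < t < len e0 ->
  moves [:: inl (ends e0).1; inl (ends e0).2] [:: point_on e0 t; point_on e0 (len e0 - t)].
Proof.
move=> tt; have l0 := len_gt0 e0.
have tt' : 0 < t <= len e0 by lra.
pose fl e := if e == e0 then (fun s : R => - Num.min (- t + 1%:~R * s) 0) else fun=> t.
pose fr e := if e == e0 then (fun s : R => - Num.min ((len e0 - t) + (-1)%:~R * s) 0) else fun=> 0.
have Il e : ipl (fl e) 0 (len e).
  rewrite /fl; case: ifP => [/eqP->|_]; last by apply: ipl_cst; exact: len_gt0.
  by apply: ipl_opp; exact: ipl_min_cst.
have Ir e : ipl (fr e) 0 (len e).
  rewrite /fr; case: ifP => [/eqP->|_]; last by apply: ipl_cst; exact: len_gt0.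
  by apply: ipl_opp; exact: ipl_min_cst.
exists (fun=> t), (fun e (s : R) => fl e s + fr e s); split=> [e|x].
  split; last by apply/iplP; [exact: len_gt0|exact: ipl_add].
    rewrite /fl /fr; case: eqP => _; last by rewrite addr0.
    by rewrite min_l ?min_r; [ring|lra..].
  rewrite /fl /fr; case: eqP => [->|_]; last by rewrite addr0.
  by rewrite min_r ?min_l; [ring|lra..].
rewrite principal_divisor_sum (bigD1 e0) //= big1 ?addr0; last first.
  move=> e ne; rewrite edge_divisor_add //.
  have -> : edge_divisor fl e x = 0 by apply: (edge_divisor_cst (c := t)); rewrite /fl (negbTE ne).
  by rewrite (edge_divisor_cst (c := 0)) // /fr (negbTE ne).
rewrite edge_divisor_add // (@edge_divisor_left fl t) ?tt' //; last by rewrite /fl eqxx.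
rewrite (@edge_divisor_right fr t) ?tt' //; last by rewrite /fr eqxx.
by rewrite !addn0 !PoszD; do 4 case: (_ == x).
Qed.

End Elementary.
End Pencil.

(** * Invariance of pencils under the simplification steps *)

Section Transfer.
Variable R : realType.
Implicit Types G H : mgraph R.

Lemma pencil_transfer G H (phi : gpoint G -> gpoint H) d :
  injective phi -> (forall y, exists x, y = phi x) ->
  (forall (fv : vert G -> R) (f : edge G -> R -> R), rational_function fv f ->
     exists (gv : vert H -> R) (g : edge H -> R -> R), rational_function gv g /\
       forall x, principal_divisor g (phi x) = principal_divisor f x) ->
  pencil G d -> pencil H d.
Proof.
move=> phiI phiS T [s [sd P]]; exists (map phi s); rewrite size_map; split=> // y.
have [x ->] := phiS y; have [s' [s'd xs' [fv [f [Hf Df]]]]] := P x.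
have [gv [g [Hg Dg]]] := T _ _ Hf.
exists (map phi s'); split; [by rewrite size_map|exact: map_f|].
exists gv, g; split=> // z; have [w ->] := phiS z.
have C (r : seq (gpoint G)) : count_mem (phi w) (map phi r) = count_mem w r.
  by rewrite count_map; apply: eq_count => u /=; rewrite (inj_eq phiI).
by rewrite !C Df Dg.
Qed.

Lemma slope_right_local (f g : R -> R) (a b t u : R) : (forall h, a <= h < b -> f (t + h) = g (u + h)) ->
  a <= 0 < b -> slope_right f t = slope_right g u.
Proof.
move=> E /andP[a0 b0]; rewrite /slope_right; congr (xget _ _); apply/funext => m; apply/propext.
have E0 : f t = g u by rewrite -[t]addr0 -[u]addr0 E // a0.
rewrite /= !near_rightP E0; split=> -[e e0 H]; exists (Num.min e b); rewrite ?lt_min ?e0 ?b0 //.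
  by move=> h; rewrite lt_min => /and3P[h0 he hb]; rewrite -E ?H ?h0 //; lra.
by move=> h; rewrite lt_min => /and3P[h0 he hb]; rewrite E ?H ?h0 //; lra.
Qed.

Lemma slope_left_local (f g : R -> R) (a b t u : R) : (forall h, a < h <= b -> f (t + h) = g (u + h)) ->
  a < 0 <= b -> slope_left f t = slope_left g u.
Proof.
move=> E /andP[a0 b0]; rewrite /slope_left; congr (xget _ _); apply/funext => m; apply/propext.
have E0 : f t = g u by rewrite -[t]addr0 -[u]addr0 E // a0.
rewrite /= !near_rightP E0; split=> -[e e0 H]; exists (Num.min e (- a)); rewrite ?lt_min ?e0 ?oppr_gt0 //.
  by move=> h; rewrite lt_min => /and3P[h0 he hb]; rewrite -E ?H ?h0 //; lra.
by move=> h; rewrite lt_min => /and3P[h0 he hb]; rewrite E ?H ?h0 //; lra.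
Qed.

Lemma slope_right_flip (f : R -> R) (l t : R) :
  slope_right (fun s => f (l - s)) t = slope_left f (l - t).
Proof.
rewrite /slope_right /slope_left; congr (xget _ _); apply/funext => m; apply/propext.
by split; apply: filterS => h; rewrite opprD addrA.
Qed.

Lemma slope_left_flip (f : R -> R) (l t : R) :
  slope_left (fun s => f (l - s)) t = slope_right f (l - t).
Proof.
rewrite /slope_right /slope_left; congr (xget _ _); apply/funext => m; apply/propext.
have E h : l - (t - h) = l - t + h by ring.
by split; apply: filterS => h; rewrite E.
Qed.

Lemma sum_option (T : finType) (V : nmodType) (F : option T -> V) :
  \sum_o F o = F None + \sum_x F (Some x).
Proof.
rewrite (bigD1 None) //=; congr (_ + _).
by rewrite (reindex_omap Some id) /= => [|[x|]//]; apply: eq_bigl => x; rewrite eqxx.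
Qed.

Lemma mgraph_iso_sym G H : mgraph_iso G H -> mgraph_iso H G.
Proof.
move=> [fv [fe [[gv fK gK] [ge feK geK] L E]]]; exists gv, ge; split.
- by exists fv.
- by exists fe.
- by move=> e; rewrite -(L (ge e)) geK.
move=> e; case: (E (ge e)); rewrite geK => ->; rewrite /= !fK -surjective_pairing; [left|right] => //.
Qed.

Lemma pencil_iso G H d : mgraph_iso G H -> pencil G d -> pencil H d.
Proof.
move=> [fv [fe [[gv fK gK] [ge feK geK] L E]]].
(* An isomorphism may reverse edges. A loop counts as not reversed, which is consistent since its
   two ends coincide. *)
pose flip e := ends (fe e) != (fv (ends e).1, fv (ends e).2).
pose fl e (t : R) := if flip e then len e - t else t.
have flK e t : fl e (fl e t) = t by rewrite /fl; case: (flip e); rewrite // opprB addrC subrK.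
have fl_in e t : (0 < fl e t < len e) = (0 < t < len e).
  by rewrite /fl; case: (flip e) => //; apply/idP/idP; lra.
pose phi (x : gpoint G) : gpoint H :=
  match x with inl v => inl (fv v) | inr et => point_on (fe (val et).1) (fl (val et).1 (val et).2) end.
have phi_inr (et : {et : edge G * R | 0 < et.2 < len et.1}) : exists h,
    phi (inr et) = inr (exist _ (fe (val et).1, fl (val et).1 (val et).2) h).
  have h : 0 < (fe (val et).1, fl (val et).1 (val et).2).2 < len (fe (val et).1, fl (val et).1 (val et).2).1.
    by rewrite /= L fl_in; exact: (valP et).
  by exists h; rewrite /phi (point_on_in h).
apply: (@pencil_transfer G H phi).
- move=> [v|et] [w|et']; rewrite ?(phi_inr et).
  + by move=> [/(can_inj fK)->].
  + by have [h ->] := phi_inr et'.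
  + by have [h ->] := phi_inr et.
  + have [h ->] := phi_inr et; have [h' ->] := phi_inr et'.
    case: et et' h h' => [[e t] k] [[e' t'] k'] /= h h' [/(can_inj feK) E1]; subst e'.
    move=> /(can_inj (flK e)) E2; subst t'; congr inr; exact/val_inj.
- move=> [w|[[e t] k]]; first by exists (inl (gv w)); rewrite /= gK.
  have k' : 0 < (ge e, fl (ge e) t).2 < len (ge e, fl (ge e) t).1.
    by rewrite /= fl_in -L geK.
  exists (inr (exist _ (ge e, fl (ge e) t) k')); have [h ->] := phi_inr (exist _ (ge e, fl (ge e) t) k').
  by congr inr; apply: val_inj; rewrite /= flK geK.
move=> fv0 f Hf.
pose g e' (t : R) := f (ge e') (fl (ge e') t).
exists (fv0 \o gv), g; split=> [e'|x].
  rewrite -(geK e'); move: (ge e') => e {e'}; rewrite /g feK L.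
  have [f0 f1 _] := Hf e; have I := rational_ipl e Hf; rewrite /fl /flip.
  case: eqP => [->|ne] /=.
    by rewrite !fK f0 f1; split=> //; apply/iplP => //; exact: len_gt0.
  case: (E e) => [//|->] /=; rewrite !fK subr0 subrr f0 f1; split=> //.
  apply/iplP; first exact: len_gt0.
  by have := ipl_flip (len e) I; rewrite subrr subr0.
rewrite !principal_divisor_sum (reindex fe); last by exists ge => ? _.
apply: eq_bigr => e _; have gE : g (fe e) = fun t => f e (fl e t) by apply/funext => t; rewrite /g feK.
case: x => [v|et].
  rewrite /= gE L /fl /flip; case: (ends (fe e) =P _) => [->|ne] /=; first by rewrite !(inj_eq (can_inj fK)).
  case: (E e) => [//|->] /=; rewrite !(inj_eq (can_inj fK)).
  by rewrite slope_right_flip slope_left_flip subr0 subrr addrC.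
have [h ->] := phi_inr et; case: et h => [[e' t] k] /= h; rewrite (inj_eq (can_inj feK)).
case: eqP => // Ee; subst e'; rewrite gE /fl; case: (flip e) => //.
by rewrite slope_right_flip slope_left_flip opprB [len e + _]addrC subrK addrC.
Qed.

(** A principal divisor has degree 0, so its coefficient at one vertex follows from all the
    others. *)
Lemma moves_away G (fv : vert G -> R) f a (s s' : seq (gpoint G)) :
  rational_function fv f -> size s = size s' ->
  (forall x, x != inl a -> principal_divisor f x = (count_mem x s')%:Z - (count_mem x s)%:Z) ->
  moves s s'.
Proof.
move=> Hf sz D; exists fv, f; split=> // x; have [{x}->|xa] := eqVneq x (inl a); last first.
  by rewrite D // addrC subrK.
pose X := undup (inl a :: s ++ s').
have uX : uniq X by exact: undup_uniq.
have aX : (inl a : gpoint G) \in X by rewrite mem_undup inE eqxx.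
have supp y : principal_divisor f y != 0 -> y \in X.
  have [-> //|ya] := eqVneq y (inl a); rewrite D //; apply: contraR => yX.
  move: yX; rewrite mem_undup inE mem_cat !negb_or => /and3P[_ ys ys'].
  by rewrite (count_memPn ys) (count_memPn ys') subrr.
have := principal_divisor_degree Hf uX supp; rewrite (bigD1_seq _ aX uX) /=.
rewrite [X in _ + X](eq_bigr (fun x => (count_mem x s')%:Z - (count_mem x s)%:Z)); last first.
  by move=> y; exact: D.
have : \sum_(x <- X) ((count_mem x s')%:Z - (count_mem x s)%:Z) = 0.
  rewrite sumrB -(@sum_count_mem _ X s' xpredT) //; last by move=> y ys; rewrite mem_undup inE mem_cat ys !orbT.
  rewrite -(@sum_count_mem _ X s xpredT) //; last by move=> y ys; rewrite mem_undup inE mem_cat ys orbT.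
  by rewrite !count_predT sz subrr.
rewrite (bigD1_seq _ aX uX) /=.
by move: (\sum_(_ <- X | _) _) => S E1 E2; lia.
Qed.

Section Leaf.
Variables (H : mgraph R) (v : vert H) (l : R) (l_gt0 : 0 < l).
Let G := add_leaf v l_gt0.

Definition leaf_embed (x : gpoint H) : gpoint G :=
  match x with inl w => inl (Some w)
  | inr et => inr (exist (fun et : edge G * R => 0 < et.2 < len et.1) (Some (val et).1, (val et).2) (valP et)) end.

Definition leaf_retract (x : gpoint G) : gpoint H :=
  match x with inl (Some w) => inl w | inl None => inl v
  | inr (exist (Some e, t) h) => inr (exist (fun et : edge H * R => 0 < et.2 < len et.1) (e, t) h)
  | inr (exist (None, _) _) => inl v end.

Lemma leaf_embedK : cancel leaf_embed leaf_retract.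
Proof. by move=> [w|[[e t] h]] //=; congr inr; apply: val_inj. Qed.

Lemma leaf_retract_eq x y : x != inl v -> (leaf_retract y == x) = (y == leaf_embed x).
Proof.
move=> xv; apply/eqP/eqP => [E|->]; last exact: leaf_embedK.
case: y E => [[w|]|[[[e|] t] h]] /= E; subst x; rewrite ?eqxx // in xv *.
by congr inr; apply: val_inj.
Qed.

Lemma edge_divisor_leaf (g : edge G -> R -> R) e x :
  edge_divisor g (Some e) (leaf_embed x) = edge_divisor (fun e => g (Some e)) e x.
Proof. by case: x => [w|[[e' t] h]]. Qed.

(** Restricting a function to [H] can change its divisor only at the attaching vertex [v], where the
    retracted chips are collected; [moves_away] settles that vertex. *)
Lemma pencil_retract d : pencil G d -> pencil H d.
Proof.
move=> [s [sd P]]; exists (map leaf_retract s); rewrite size_map; split=> // x.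
have [s' [s'd xs' m]] := P (leaf_embed x).
exists (map leaf_retract s'); rewrite size_map; split=> //.
  by rewrite -[x]leaf_embedK map_f.
have [fv [f [Hf D]]] := m.
apply: (@moves_away _ (fun w => fv (Some w)) (fun e => f (Some e)) v).
- by move=> e; have [f0 f1 I] := Hf (Some e).
- by rewrite !size_map (moves_sizeE m).
move=> y yv.
have C (r : seq (gpoint G)) : count_mem y (map leaf_retract r) = count_mem (leaf_embed y) r.
  by rewrite count_map; apply: eq_count => u /=; exact: leaf_retract_eq.
have -> : principal_divisor (fun e => f (Some e)) y = principal_divisor f (leaf_embed y).
  rewrite !principal_divisor_sum sum_option; under [in RHS]eq_bigr do rewrite edge_divisor_leaf.
  rewrite -[LHS]add0r; congr (_ + _).
  case: y yv C => [w|et] //= wv _; case: eqP => [[E]|_] //; by rewrite E eqxx in wv.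
by rewrite !C D addrC addKr.
Qed.

(** Functions extend over the leaf by a constant. A point of the leaf is reached by bringing a chip
    to [v] and sliding it along the leaf, which is a bridge. *)
Lemma pencil_leaf d : pencil H d -> pencil G d.
Proof.
move=> [s [sd P]]; exists (map leaf_embed s); rewrite size_map; split=> //.
have emb (r : seq (gpoint H)) : moves s r -> moves (map leaf_embed s) (map leaf_embed r).
  move=> [fv [f [Hf D]]].
  pose gv (o : vert G) := if o is Some w then fv w else fv v.
  pose g (o : edge G) := if o is Some e then f e else fun=> fv v.
  have Hg : rational_function gv g.
    move=> [e|]; first by have := Hf e.
    by split=> //; apply/iplP; [exact: len_gt0|apply: ipl_cst; exact: len_gt0].
  exists gv, g; split=> // y.
  have gN x : edge_divisor g None x = 0 by exact: (edge_divisor_cst (c := fv v)).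
  rewrite principal_divisor_sum sum_option gN add0r.
  have [[x ->]|/forallNP ny] := pselect (exists x, y = leaf_embed x).
    have C (q : seq (gpoint H)) : count_mem (leaf_embed x) (map leaf_embed q) = count_mem x q.
      by rewrite count_map; apply: eq_count => u /=; rewrite (inj_eq (can_inj leaf_embedK)).
    rewrite !C D principal_divisor_sum; congr (_ + _).
    by apply: eq_bigr => e _; rewrite edge_divisor_leaf.
  have C (q : seq (gpoint H)) : count_mem y (map leaf_embed q) = 0%N.
    by apply/count_memPn; apply/negP => /mapP[x _ E]; exact: (ny x E).
  rewrite !C big1 // => e _; case: y ny {C} => [[w|]|[[[e'|] t] h]] ny //.
    by case: (ny (inl w)).
  case: (ny (inr (exist (fun et : edge H * R => 0 < et.2 < len et.1) (e', t) h))).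
  by congr inr; apply: val_inj.
have done_ x s' : size s' = d -> x \in s' -> moves (map leaf_embed s) s' ->
  exists s', [/\ size s' = d, x \in s' & moves (map leaf_embed s) s'] by exists s'.
have onleaf (t : R) : 0 < t <= l ->
    exists s', [/\ size s' = d, (point_on (None : edge G) t) \in s' & moves (map leaf_embed s) s'].
  move=> tt; have [s' [s'd vs' m]] := P (inl v).
  apply: (done_ _ (point_on (None : edge G) t :: rem (inl (Some v)) (map leaf_embed s'))).
  - have vs : (inl (Some v) : gpoint G) \in map leaf_embed s' by apply/mapP; exists (inl v).
    by rewrite /= size_rem // size_map s'd prednK // -s'd; case: (s') vs'.
  - by rewrite inE eqxx.
  apply: moves_trans (emb _ m) _.
  have vs : (inl (Some v) : gpoint G) \in map leaf_embed s' by apply/mapP; exists (inl v).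
  apply: moves_trans (perm_moves (perm_to_rem vs)) _.
  apply: (moves_cat (s := [:: _]) (s' := [:: _])).
  apply: (@moves_bridge _ G None (fun o => isSome o)) => //.
  by move=> [e|].
move=> [[w|]|[[[e|] t] h]].
- have [s' [s'd ws' m]] := P (inl w).
  by apply: (done_ _ (map leaf_embed s')) (emb _ m); [rewrite size_map|apply/mapP; exists (inl w)].
- by have := onleaf l; rewrite l_gt0 lexx (@point_on_len _ G None) => /(_ isT).
- pose x : gpoint H := inr (exist (fun et : edge H * R => 0 < et.2 < len et.1) (e, t) h).
  have [s' [s'd ws' m]] := P x.
  apply: (done_ _ (map leaf_embed s')) (emb _ m); [by rewrite size_map|].
  by apply/mapP; exists x => //; congr inr; apply: val_inj.
- have := onleaf t; rewrite (@point_on_in _ G None t h); apply.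
  by have /andP[-> /ltW] := h.
Qed.

End Leaf.

Section Subdivision.
Variables (H : mgraph R) (e : edge H) (t : R) (t_in : 0 < t < len e).
Let G := subdivide t_in.
Let l1 : edge G := Some e.
Let l2 : edge G := None.

Definition sub_phi (x : gpoint H) : gpoint G :=
  match x with inl w => inl (Some w)
  | inr et => if (val et).1 == e then
       (if (val et).2 <= t then point_on l1 (val et).2 else point_on l2 ((val et).2 - t))
     else point_on (Some (val et).1 : edge G) (val et).2 end.

Definition sub_psi (y : gpoint G) : gpoint H :=
  match y with inl (Some w) => inl w | inl None => point_on e t
  | inr (exist (Some e', s) _) => point_on e' s
  | inr (exist (None, s) _) => point_on e (t + s) end.

Lemma len_l1 : len l1 = t. Proof. by rewrite /= eqxx. Qed.
Lemma len_l2 : len l2 = len e - t. Proof. by []. Qed.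
Lemma len_other e' : e' != e -> len (Some e' : edge G) = len e'.
Proof. by move=> /negbTE /= ->. Qed.

Lemma point_on_mid : point_on l1 t = inl None :> gpoint G.
Proof. by have := point_on_len l1; rewrite len_l1 /= eqxx. Qed.

Variant sub_spec : gpoint H -> gpoint G -> Prop :=
| SubVertex w : sub_spec (inl w) (inl (Some w))
| SubOther e' s h h' of e' != e : sub_spec (inr (exist _ (e', s) h)) (inr (exist _ (Some e', s) h'))
| SubLow s h h' of s < t : sub_spec (inr (exist _ (e, s) h)) (inr (exist _ (l1, s) h'))
| SubMid h : sub_spec (inr (exist _ (e, t) h)) (inl None)
| SubHigh s h h' of t < s : sub_spec (inr (exist _ (e, s) h)) (inr (exist _ (l2, s - t) h')).

Lemma sub_phiP x : sub_spec x (sub_phi x).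
Proof.
case: x => [w|[[e' s] h]] /=; first exact: SubVertex.
case: eqP => [E|/eqP ne]; last first.
  have h' : 0 < (Some e', s).2 < len ((Some e' : edge G), s).1 by rewrite len_other.
  by rewrite (point_on_in h'); exact: SubOther.
subst e'; case: ltgtP => [st|ts|Est].
- have h' : 0 < (l1, s).2 < len (l1, s).1 by rewrite len_l1; case/andP: h => -> /=.
  by rewrite (point_on_in h'); exact: SubLow.
- have h' : 0 < (l2, s - t).2 < len (l2, s - t).1.
    by rewrite len_l2 /= subr_gt0 ts ltrD2r; case/andP: h.
  by rewrite (point_on_in h'); exact: SubHigh.
- subst s; rewrite point_on_mid; exact: SubMid.
Qed.

Lemma sub_phiK : cancel sub_phi sub_psi.
Proof.
move=> x; case: sub_phiP => [w|e' s h h' ne|s h h' st|h|s h h' ts] //=.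
- by rewrite (point_on_in h).
- by rewrite (point_on_in h).
- by rewrite (point_on_in h).
- by rewrite addrC subrK (point_on_in h).
Qed.

Lemma sub_psiK : cancel sub_psi sub_phi.
Proof.
have tl := t_in.
move=> [[w|]|[[[e'|] s] h]] //=.
- by rewrite (point_on_in t_in) /= eqxx lexx point_on_mid.
- have h' : 0 < s < len e'.
    have := h; rewrite /=; case: eqP => // -> /andP[s0 st]; lra.
  rewrite (point_on_in h') /=; case: eqP => [E|_]; last by rewrite (point_on_in h).
  subst e'; have st : s <= t by move: (h); rewrite /= eqxx => /andP[_ /ltW].
  by rewrite st (point_on_in h).
- have h1 : 0 < s < len e - t by [].
  have h' : 0 < t + s < len e by lra.
  rewrite (point_on_in h') /= eqxx.
  have -> : (t + s <= t) = false by apply/negbTE; rewrite -ltNge; lra.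
  by rewrite addrC addKr (point_on_in h).
Qed.

Lemma principal_divisor_sub (f : edge H -> R -> R) (g : edge G -> R -> R) x :
  (forall e', e' != e -> g (Some e') = f e') ->
  (forall s, 0 <= s <= t -> g l1 s = f e s) ->
  (forall s, 0 <= s <= len e - t -> g l2 s = f e (t + s)) ->
  principal_divisor g (sub_phi x) = principal_divisor f x.
Proof.
move=> E E1 E2; have /andP[t0 tl] := t_in.
rewrite !principal_divisor_sum sum_option (bigD1 e) //= [RHS](bigD1 e) //= addrA.
congr (_ + _); last first.
  apply: eq_bigr => e' ne; have ne' : (e == e') = false by rewrite eq_sym (negbTE ne).
  case: sub_phiP => [w|e1 s h h' n1|s h h' st|h|s h h' ts] /=;
    rewrite ?E ?(negbTE ne) ?ne' // /l1 [Some e == _]ne' //.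
case: sub_phiP => [w|e1 s h h' n1|s h h' st|h|s h h' ts] /=.
- rewrite !eqxx /= add0r addr0 addrC; congr (_ + _).
    have -> : (Some (ends e).1 == Some w) = ((ends e).1 == w) by [].
    case: ifP => // _; apply: (slope_right_local (a := 0) (b := t)); last by rewrite lexx.
    by move=> h hh; rewrite E1 //; lra.
  have -> : (Some (ends e).2 == Some w) = ((ends e).2 == w) by [].
  case: ifP => // _; apply: (slope_left_local (a := t - len e) (b := 0)); last lra.
  by move=> h hh; rewrite E2; [congr (f e _); ring|lra].
- by rewrite (negbTE n1) [_ == Some e](negbTE n1) addr0.
- have /andP[/= s0 sl] := h.
  rewrite eqxx add0r [_ == Some e]eqxx; congr (_ + _).
    apply: (slope_right_local (a := 0) (b := t - s)); last lra.
    by move=> h1 hh; rewrite E1 //; lra.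
  apply: (slope_left_local (a := - s) (b := 0)); last lra.
  by move=> h1 hh; rewrite E1 //; lra.
- rewrite !eqxx addr0 add0r; congr (_ + _).
    apply: (slope_right_local (a := 0) (b := len e - t)); last lra.
    by move=> h1 hh; rewrite E2 add0r //; lra.
  apply: (slope_left_local (a := - t) (b := 0)); last lra.
  by move=> h1 hh; rewrite E1 //; lra.
- have /andP[/= s0 sl] := h.
  rewrite eqxx addr0; congr (_ + _).
    apply: (slope_right_local (a := 0) (b := len e - s)); last lra.
    by move=> h1 hh; rewrite E2; [congr (f e _); ring|lra].
  apply: (slope_left_local (a := t - s) (b := 0)); last lra.
  by move=> h1 hh; rewrite E2; [congr (f e _); ring|lra].
Qed.

Lemma pencil_subdivide d : pencil H d -> pencil G d.
Proof.
have /andP[t0 tl] := t_in.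
apply: (pencil_transfer (can_inj sub_phiK)) => [y|fv f Hf].
  by exists (sub_psi y); rewrite sub_psiK.
pose gv (o : vert G) := if o is Some w then fv w else f e t.
pose g (o : edge G) := if o is Some e' then f e' else fun s => f e (s + t).
exists gv, g; split=> [[e'|]|x]; last first.
- by apply: principal_divisor_sub => // s _; rewrite /g addrC.
- have [f0 f1 _] := Hf e; have I := rational_ipl e Hf.
  rewrite /g /gv /= add0r subrK; split=> //; apply/iplP; first by rewrite subr_gt0.
  by have := ipl_shift t (ipl_restrict I (ltW t0) tl (lexx _)); rewrite subrr.
- have [f0 f1 If] := Hf e'; have I := rational_ipl e' Hf.
  rewrite /g /gv /=; case: eqP => [E|_]; last by split.
  subst e'; split=> //; apply/iplP => //; exact: ipl_restrict I (lexx _) t0 (ltW tl).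
Qed.

Lemma pencil_smooth d : pencil G d -> pencil H d.
Proof.
have /andP[t0 tl] := t_in.
apply: (pencil_transfer (can_inj sub_psiK)) => [x|gv g Hg].
  by exists (sub_phi x); rewrite sub_phiK.
pose f e' := if e' == e then (fun s => if s <= t then g l1 s else g l2 (s - t)) else g (Some e').
have [a0 a1 _] := Hg l1; have I1 := rational_ipl l1 Hg; rewrite len_l1 in a1 I1.
have [b0 b1 _] := Hg l2; have I2 := rational_ipl l2 Hg; rewrite len_l2 in b1 I2.
exists (fun w => gv (Some w)), f; split=> [e'|y].
  rewrite /f; case: eqP => [->|/eqP ne]; last first.
    by have := Hg (Some e'); rewrite /= (negbTE ne).
  rewrite (ltW t0) leNgt tl /= a0 b1; split=> //; apply/iplP; first exact: len_gt0.
  apply: (@IplGlue _ _ _ t).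
    by apply: eq_ipl I1 => s /andP[_ ->].
  have := ipl_shift (- t) I2; rewrite !opprK add0r subrK.
  apply: eq_ipl => s /andP[ts _]; case: leP => // st.
  have -> : s = t by apply/eqP; rewrite eq_le st ts.
  by rewrite subrr b0 a1 /= eqxx.
rewrite -{2}(sub_psiK y); symmetry; apply: principal_divisor_sub.
- by move=> e' ne; rewrite /f (negbTE ne).
- by move=> s /andP[_ st]; rewrite /f eqxx st.
- move=> s /andP[s0 _]; rewrite /f eqxx; case: leP => [st|_]; last by rewrite addrC addKr.
  have -> : s = 0 by lra.
  by rewrite addr0 a1 b0 /= eqxx.
Qed.

End Subdivision.

Lemma pencil_step G H d : simplification_step G H -> pencil G d <-> pencil H d.
Proof.
case=> [v l l0|e t tt] I.
  split=> [/(pencil_iso I)/pencil_retract //|/pencil_leaf P].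
  exact: pencil_iso (mgraph_iso_sym I) (P _ _ _).
split=> [/(pencil_iso I)/pencil_smooth //|P].
by apply: pencil_iso (mgraph_iso_sym I) _; exact: pencil_subdivide.
Qed.

Lemma pencil_simplifies G H d : simplifies G H -> pencil G d <-> pencil H d.
Proof.
elim=> {G H} [G H I|G H K /(pencil_step d) E _ IH]; last by rewrite E.
by split; apply: pencil_iso => //; exact: mgraph_iso_sym.
Qed.

Lemma simplifies_vertex G H : simplifies G H -> vert G -> inhabited (vert H).
Proof.
elim=> {G H} [G H [fv _] v|G H K S _ IH v]; first exact: (inhabits (fv v)).
by case: S => [w _ _ _|e _ _ _]; apply: IH; [exact: w|exact: (ends e).1].
Qed.

End Transfer.

(** * Skeletons of graphs with at most one independent cycle *)

Section Terminal.
Variable R : realType.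
Implicit Types G H : mgraph R.

(** Phrased by cuts and not by paths: it passes through isomorphisms and simplification steps by
    pulling back or extending a predicate. *)
Definition connected_mgraph G := forall A : pred (vert G),
  (forall e, A (ends e).1 = A (ends e).2) -> forall u v, A u = A v.

Lemma connected_iso G H : mgraph_iso G H -> connected_mgraph G -> connected_mgraph H.
Proof.
move=> [fv [fe [[gv fK gK] [ge feK geK] L E]]] CG A HA u v.
rewrite -[u]gK -[v]gK; apply: (CG (fun x => A (fv x))) => e.
by have := HA (fe e); case: (E e) => -> /= ->.
Qed.

Lemma connected_step G H : simplification_step G H -> connected_mgraph G -> connected_mgraph H.
Proof.
case=> [w l l0|e t tt] I /(connected_iso I) CG A HA u v.
  have := CG (fun o => if o is Some x then A x else A w) _ (Some u) (Some v).
  by apply; case=> [e|] //=; exact: HA.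
have := CG (fun o => if o is Some x then A x else A (ends e).1) _ (Some u) (Some v).
apply; case=> [e'|] /=; last exact: HA.
by case: eqP => [->|_].
Qed.

(** A step removes one vertex and one edge, so the difference of the two numbers survives until the
    skeleton. *)
Lemma euler_step G H : simplification_step G H ->
  (#|vert G| + #|edge H| = #|vert H| + #|edge G|)%N.
Proof.
have C G1 G2 : mgraph_iso G1 G2 -> #|vert G1| = #|vert G2| /\ #|edge G1| = #|edge G2|.
  by move=> [fv [fe [/bij_eq_card ? /bij_eq_card ? _ _]]].
case=> [w l l0|e t tt] /C[-> ->]; by rewrite !card_option addSn addnS.
Qed.

Lemma simplifies_connected G H : simplifies G H -> connected_mgraph G ->
  connected_mgraph H /\ (#|vert G| + #|edge H| = #|vert H| + #|edge G|)%N.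
Proof.
elim=> {G H} [G H I CG|G H K S _ IH CG].
  split; first exact: connected_iso I CG.
  by case: I => [fv [fe [/bij_eq_card -> /bij_eq_card -> _ _]]].
have [CK EK] := IH (connected_step S CG); split=> //.
by have := euler_step S; lia.
Qed.

Section Surgery.
Variables (G : mgraph R) (v : vert G) (w0 : {x : vert G | x != v}).
(** The second vertex [w0] is the default that makes the restriction to the remaining vertices a
    total map. *)
Let mk (x : vert G) : {x : vert G | x != v} := insubd w0 x.

Lemma mkK x : x != v -> insub x = Some (mk x).
Proof. by move=> xv; rewrite /mk /insubd insubT. Qed.

(** Presents a finite type as the elements other than [a] plus one, the [option] shape that
    [add_leaf] and [subdivide] produce. *)
Lemma insub_bij (T : finType) (a : T) : bijective (insub : T -> option {x | x != a}).
Proof.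
exists (fun o => if o is Some x then val x else a) => [x|[x|]].
- by case: insubP => [u _ <-//|]; rewrite negbK => /eqP.
- by rewrite valK.
- by rewrite insubF ?eqxx.
Qed.

Lemma insubvN : insub v = None :> option {x : vert G | x != v}.
Proof. by rewrite insubF ?eqxx. Qed.

Lemma leaf_removal (e0 : edge G) :
  ((ends e0).1 == v) != ((ends e0).2 == v) ->
  (forall e, e != e0 -> (ends e).1 != v /\ (ends e).2 != v) ->
  exists H, simplification_step G H.
Proof.
move=> D0 D.
pose w := if (ends e0).1 == v then (ends e0).2 else (ends e0).1.
pose H := @MGraph R {x : vert G | x != v} {e : edge G | e != e0}
  (fun e => (mk (ends (val e)).1, mk (ends (val e)).2)) (fun e => len (val e)) (fun e => len_gt0 (val e)).
exists H; apply: (@RetractLeaf _ _ _ (mk w : vert H) (len e0) (len_gt0 e0)).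
exists (insub : vert G -> option {x : vert G | x != v}),
  (insub : edge G -> option {e : edge G | e != e0}); split.
- exact: insub_bij.
- exact: insub_bij.
- by move=> e; case: insubP => [u _ <-//|]; rewrite negbK => /eqP->.
move=> e; case: insubP => [u _ <-|].
  by have [E1 E2] := D _ (valP u); left; rewrite /= -!mkK.
rewrite negbK => /eqP->; rewrite /= /w.
case: ((ends e0).1 =P v) D0 => [E1|/eqP E1]; case: ((ends e0).2 =P v) => [E2|/eqP E2] //= _.
  by right; rewrite -mkK // E1 insubvN.
by left; rewrite -mkK // E2 insubvN.
Qed.

Lemma smoothing (e1 e2 : edge G) : e1 != e2 ->
  ((ends e1).1 == v) != ((ends e1).2 == v) ->
  ((ends e2).1 == v) != ((ends e2).2 == v) ->
  (forall e, e != e1 -> e != e2 -> (ends e).1 != v /\ (ends e).2 != v) ->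
  exists H, simplification_step G H.
Proof.
move=> ne D1 D2 D.
pose other e := if (ends e).1 == v then (ends e).2 else (ends e).1.
pose ln (e : {e : edge G | e != e2}) := if val e == e1 then len e1 + len e2 else len (val e).
have ln0 e : 0 < ln e by rewrite /ln; case: ifP => _; rewrite ?addr_gt0 ?len_gt0.
pose H := @MGraph R {x : vert G | x != v} {e : edge G | e != e2}
  (fun e => if val e == e1 then (mk (other e1), mk (other e2))
            else (mk (ends (val e)).1, mk (ends (val e)).2)) ln ln0.
pose E1 : edge H := Sub e1 ne.
have tt : 0 < len e1 < len E1 by rewrite /= /ln /= eqxx ltrDl !len_gt0.
exists H; apply: (@SmoothVertex _ _ _ E1 _ tt).
have oth e : ((ends e).1 == v) != ((ends e).2 == v) ->
    [/\ other e != v & ends e = (other e, v) \/ ends e = (v, other e)].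
  rewrite /other; case: (ends e) => a b /=.
  by case: (a =P v) => [->|/eqP av]; case: (b =P v) => [->|/eqP bv] //= _; split=> //; [right|left].
exists (insub : vert G -> option {x : vert G | x != v}),
  (insub : edge G -> option {e : edge G | e != e2}); split.
- exact: insub_bij.
- exact: insub_bij.
- move=> e; case: insubP => [u _ <-|]; last first.
    by rewrite negbK => /eqP->; rewrite /= /ln /= eqxx addrC addKr.
  rewrite /=; case: eqP => [->//|]; rewrite /ln => /eqP; rewrite -val_eqE /= => /negbTE->.
  by [].
have [ov1 H1] := oth _ D1; have [ov2 H2] := oth _ D2.
move=> e; case: insubP => [u _ <-|].
  rewrite /= -[u == E1]val_eqE /=; case: eqP => [->|/eqP n1].
    case: H1 => -> /=; rewrite -mkK // insubvN; [by left|by right].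
  by left; have [k1 k2] := D _ n1 (valP u); rewrite /= -!mkK.
rewrite negbK => /eqP->; rewrite /= eqxx.
case: H2 => -> /=; rewrite -mkK // insubvN; [by right|by left].
Qed.

End Surgery.

(** Valences sum to twice the number of edges, hence to at most twice the number of vertices. With
    two vertices present, valence 0 contradicts connectedness and valence 1 is a leaf, so all
    valences are 2; such a vertex carries an isolated loop or can be smoothed. *)
Lemma terminal_one_vertex G : connected_mgraph G -> (#|edge G| <= #|vert G|)%N ->
  (forall H, ~ simplification_step G H) -> forall u v : vert G, u = v.
Proof.
move=> CG EV T u0 v0.
have closed (v : vert G) : (forall e, ((ends e).1 == v) = ((ends e).2 == v)) -> u0 = v0.
  move=> Hv; have E x : x = v by apply/eqP; have := CG (pred1 v) Hv x v; rewrite /= eqxx.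
  by rewrite (E u0) (E v0).
apply: contrapT => uv.
have wit v : {x : vert G | x != v}.
  have [E|ne] := eqVneq u0 v; last by exists u0.
  by exists v0; rewrite -E eq_sym; apply/eqP.
pose c (e : edge G) (v : vert G) := (((ends e).1 == v) + ((ends e).2 == v))%N.
pose val_ v := (\sum_e c e v)%N.
have sumval : (\sum_v val_ v = 2 * #|edge G|)%N.
  rewrite /val_ exchange_big /= -sum1_card big_distrr /=; apply: eq_bigr => e _.
  rewrite /c big_split /=.
  have S1 (x : vert G) : (\sum_i (x == i) = 1)%N.
    by rewrite (bigD1 x) //= eqxx big1 // => i; rewrite eq_sym => /negbTE->.
  by rewrite !S1.
have val1 v : val_ v != 1%N.
  apply/eqP => E.
  have [e0 c0] : exists e0, (0 < c e0 v)%N.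
    apply: contrapT => /forallNP N; move: E; rewrite /val_ big1 // => e _.
    by apply/eqP; rewrite -leqn0 leqNgt; apply/negP/N.
  have := E; rewrite /val_ (bigD1 e0) //= => E0.
  have {}E0 : c e0 v = 1%N /\ (\sum_(i | i != e0) c i v = 0)%N by lia.
  case: E0 => c1 /eqP; rewrite sum_nat_eq0 => /forall_inP Z.
  have Z' e : e != e0 -> (ends e).1 != v /\ (ends e).2 != v.
    by move=> /Z; rewrite addn_eq0 !eqb0 => /andP.
  have [|H /T//] := leaf_removal (wit v) _ Z'.
  by move: c1; rewrite /c; case: eqP; case: eqP.
have val2 v : (2 <= val_ v)%N.
  case E: (val_ v) => [|[|//]]; last by have := val1 v; rewrite E.
  case: uv; apply: (closed v) => e; have := E; rewrite /val_ (bigD1 e) //= /c => /eqP.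
  by rewrite !addn_eq0 !eqb0 => /andP[/andP[/negbTE-> /negbTE->]].
have valE v : val_ v = 2%N.
  have : (\sum_(x : vert G) 2 <= \sum_(x : vert G) val_ x)%N by apply: leq_sum => x _; exact: val2.
  have S2 : (\sum_(x : vert G) 2 = 2 * #|vert G|)%N by rewrite sum_nat_const mulnC.
  rewrite sumval S2 => le2.
  have S : (\sum_v val_ v = \sum_(v : vert G) 2)%N.
    by rewrite sumval S2; lia.
  apply/eqP; rewrite eqn_leq val2 andbT; move: S.
  rewrite (bigD1 v) //= [RHS](bigD1 v) //= => S.
  have : (\sum_(i : vert G | i != v) 2 <= \sum_(i : vert G | i != v) val_ i)%N by apply: leq_sum => x _; exact: val2.
  lia.
have [e1 c1] : exists e1, (0 < c e1 u0)%N.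
  apply: contrapT => /forallNP N; have := valE u0; rewrite /val_ big1 // => e _.
  by apply/eqP; rewrite -leqn0 leqNgt; apply/negP/N.
have := valE u0; rewrite /val_ (bigD1 e1) //= => E1.
case c1E: (c e1 u0) c1 => [|[|k]] // _; last first.
  have {}E1 : (\sum_(i | i != e1) c i u0 = 0)%N by lia.
  apply: uv; apply: (closed u0) => e; have [->|ne] := eqVneq e e1.
    by move: c1E; rewrite /c; case: eqP; case: eqP.
  move/eqP: E1; rewrite sum_nat_eq0 => /forall_inP/(_ e ne).
  by rewrite addn_eq0 !eqb0 => /andP[/negbTE-> /negbTE->].
have {}E1 : (\sum_(i | i != e1) c i u0 = 1)%N by lia.
have [e2 ne2 c2] : exists2 e2, e2 != e1 & (0 < c e2 u0)%N.
  apply: contrapT => /forall2NP N; move: E1; rewrite big1 // => e ne.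
  by apply/eqP; rewrite -leqn0 leqNgt; apply/negP; case: (N e).
move: E1; rewrite (bigD1 e2) //= => E1.
have [c2E Z] : c e2 u0 = 1%N /\ (\sum_(i | (i != e1) && (i != e2)) c i u0 = 0)%N by lia.
move/eqP: Z; rewrite sum_nat_eq0 => /forall_inP Z.
have Z' e : e != e1 -> e != e2 -> (ends e).1 != u0 /\ (ends e).2 != u0.
  by move=> n1 n2; have := Z e; rewrite n1 n2 => /(_ isT); rewrite addn_eq0 !eqb0 => /andP.
have ne12 : e1 != e2 by rewrite eq_sym.
have [||H /T//] := smoothing (wit u0) ne12 _ _ Z'.
  by move: c1E; rewrite /c; case: eqP; case: eqP.
by move: c2E; rewrite /c; case: eqP; case: eqP.
Qed.

(** Every edge is a loop, and two chips at the vertex move along it symmetrically. *)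
Lemma pencil_bouquet G (v : vert G) : (forall u w : vert G, u = w) -> pencil G 2.
Proof.
move=> V1; exists [:: inl v; inl v]; split=> // -[w|[[e t] h]].
  by exists [:: inl v; inl v]; split=> //; [rewrite (V1 w v) inE eqxx|exact: moves_refl].
exists [:: point_on e t; point_on e (len e - t)]; split=> //.
  by rewrite (point_on_in h) inE eqxx.
have := moves_edge_ends h; by rewrite /= (V1 (ends e).1 v) (V1 (ends e).2 v).
Qed.

Lemma pencil_point G (v : vert G) : (forall u w : vert G, u = w) -> #|edge G| = 0%N -> pencil G 1.
Proof.
move=> V1 E0; exists [:: inl v]; split=> // -[w|[[e t] h]]; last first.
  by have := fintype0 e E0.
by exists [:: inl v]; split=> //; [rewrite (V1 w v) inE eqxx|exact: moves_refl].
Qed.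

Lemma skeleton_small G H : is_skeleton G H -> vert G -> connected_mgraph G ->
  ((#|edge G| <= #|vert G|)%N -> pencil H 2) /\ ((#|edge G| < #|vert G|)%N -> pencil H 1).
Proof.
move=> [S T] v CG; have [CH E] := simplifies_connected S CG.
have [w] := simplifies_vertex S v.
split=> le; have V1 := terminal_one_vertex CH _ T.
  by apply: (pencil_bouquet w); apply: V1; lia.
have {}V1 : forall u w : vert H, u = w by apply: V1; lia.
apply: (pencil_point w V1).
have : (#|vert H| <= 1)%N by rewrite leqNgt; apply/negP => /card_gt1P[x [y [_ _]]]; rewrite (V1 x y) eqxx.
lia.
Qed.

End Terminal.

(** * Lattice polygons and regular triangulations *)

Section Coordinates.

Definition cx (T : Type) (m : 'cV[T]_2) : T := m 0 0.
Definition cy (T : Type) (m : 'cV[T]_2) : T := m 1 0.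

Lemma col2P (T : Type) (a b : 'cV[T]_2) : cx a = cx b -> cy a = cy b -> a = b.
Proof.
move=> E1 E2; apply/matrixP => i j; rewrite (ord1 j).
case: i => -[|[|//]] h.
  by have -> : Ordinal h = 0 by apply: val_inj.
by have -> : Ordinal h = 1 by apply: val_inj.
Qed.

Lemma cxD (V : nmodType) (a b : 'cV[V]_2) : cx (a + b) = cx a + cx b. Proof. by rewrite /cx mxE. Qed.
Lemma cyD (V : nmodType) (a b : 'cV[V]_2) : cy (a + b) = cy a + cy b. Proof. by rewrite /cy mxE. Qed.
Lemma cxN (V : zmodType) (a : 'cV[V]_2) : cx (- a) = - cx a. Proof. by rewrite /cx mxE. Qed.
Lemma cyN (V : zmodType) (a : 'cV[V]_2) : cy (- a) = - cy a. Proof. by rewrite /cy mxE. Qed.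
Lemma cxZ (V : pzRingType) (k : V) (a : 'cV[V]_2) : cx (k *: a) = k * cx a. Proof. by rewrite /cx mxE. Qed.
Lemma cyZ (V : pzRingType) (k : V) (a : 'cV[V]_2) : cy (k *: a) = k * cy a. Proof. by rewrite /cy mxE. Qed.
Definition cE := (cxD, cyD, cxN, cyN).
Definition cZE := (cxZ, cyZ).

Definition mkcol (T : Type) (a b : T) : 'cV[T]_2 := \col_i (if i == 0 then a else b).
Lemma cx_mk (T : Type) (a b : T) : cx (mkcol a b) = a. Proof. by rewrite /cx mxE. Qed.
Lemma cy_mk (T : Type) (a b : T) : cy (mkcol a b) = b. Proof. by rewrite /cy mxE. Qed.

Variable R : realType.

Lemma cx_toR (p : 'cV[int]_2) : cx (toR R p) = (cx p)%:~R. Proof. by rewrite /cx mxE. Qed.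
Lemma cy_toR (p : 'cV[int]_2) : cy (toR R p) = (cy p)%:~R. Proof. by rewrite /cy mxE. Qed.

Lemma pairingE (p : 'cV[int]_2) (w : 'cV[R]_2) :
  pairing p w = (cx p)%:~R * cx w + (cy p)%:~R * cy w.
Proof.
rewrite /pairing 2!big_ord_recl big_ord0 addr0 /cx /cy.
by congr (_ * _ + _%:~R * _); congr (_ _ _); apply: val_inj.
Qed.

Definition dot (a b : 'cV[R]_2) : R := cx a * cx b + cy a * cy b.

Lemma pairing_dot p w : pairing p w = dot (toR R p) w.
Proof. by rewrite pairingE /dot cx_toR cy_toR. Qed.

Lemma seq_max (T : eqType) (f : T -> R) (l : seq T) a : a \in l ->
  exists2 m, m \in l & forall x, x \in l -> f x <= f m.
Proof.
elim: l a => // b l IH a _; case: l IH => [|d l] IH.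
  by exists b; rewrite ?inE // => x; rewrite inE => /eqP->.
have [m ml Hm] := IH d (mem_head _ _).
have [bm|mb] := leP (f b) (f m).
  exists m; first by rewrite inE ml orbT.
  by move=> x; rewrite inE => /orP[/eqP->//|/Hm].
exists b; first by rewrite inE eqxx.
by move=> x; rewrite inE => /orP[/eqP->//|/Hm/le_trans]; apply; exact: ltW.
Qed.

Lemma convexP (K : set 'cV[R]_2) : convex_set K <->
  forall x y (t : R), K x -> K y -> 0 <= t <= 1 -> K (t *: x + (1 - t) *: y).
Proof.
split=> [H x y t Kx Ky /andP[t0 t1]|H x y l].
  have := H x y (Itv01 t0 t1); rewrite !inE => /(_ Kx Ky).
  by [].
by rewrite !inE => Kx Ky; apply: H => //; rewrite ge0 le1.
Qed.

Lemma hull_convex (K : set 'cV[R]_2) : convex_set (convex_hull K).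
Proof.
apply/convexP => x y t Kx Ky t01 C [Cc KC].
by apply: ((convexP C).1 Cc) => //; [apply: Kx|apply: Ky].
Qed.

Lemma sub_hull (K : set 'cV[R]_2) : K `<=` convex_hull K.
Proof. exact: sub_gen_smallest. Qed.

Lemma hull_halfspace (K : set 'cV[R]_2) u (a : R) : (forall x, K x -> a <= dot x u) ->
  forall x, convex_hull K x -> a <= dot x u.
Proof.
move=> H x; apply: (smallest_sub (X := [set x | a <= dot x u])) => //=.
apply/convexP => y z t /= ay az t01; rewrite /dot !cE !cZE.
have -> : (t * cx y + (1 - t) * cx z) * cx u + (t * cy y + (1 - t) * cy z) * cy u =
  t * dot y u + (1 - t) * dot z u by rewrite /dot; ring.
have : t * a <= t * dot y u by apply: ler_wpM2l => //; lra.
have : (1 - t) * a <= (1 - t) * dot z u by apply: ler_wpM2l => //; lra.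
lra.
Qed.

(** * Interior points of a convex hull, detected by linear functionals *)

Section HullInterior.
Variable S : seq 'cV[R]_2.
Let P := convex_hull [set` S].
Variable z : 'cV[R]_2.
Hypothesis supp : forall u, u <> 0 -> exists2 s, s \in S & dot s u < dot z u.

(** Let [X] and [Y] be coordinates along and across [v]. The points with largest [X / |Y|] on the
    two sides of the line span a segment meeting the open ray; if not, the functional of
    [- v + k *: Jv] is nowhere on [S] smaller than at [z], against [supp]. *)
Lemma hull_cone v : v <> 0 -> exists2 e : R, 0 < e & P (z + e *: v).
Proof.
move=> v0; have Pc := @hull_convex [set` S].
have n0 : 0 < dot v v.
  rewrite lt_neqAle eq_sym; apply/andP; split; last by rewrite /dot; nra.
  apply/eqP => E; apply: v0; apply: col2P; rewrite /cx /cy !mxE -/(cx v) -/(cy v);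
    move: E; rewrite /dot; nra.
pose Y s := cx v * (cy s - cy z) - cy v * (cx s - cx z).
pose X s := cx v * (cx s - cx z) + cy v * (cy s - cy z).
have coord s : s = z + (dot v v)^-1 *: (X s *: v + Y s *: mkcol (- cy v) (cx v)).
  by apply: col2P; rewrite !(cE, cZE, cx_mk, cy_mk) /X /Y /dot; field; move: n0; rewrite /dot lt0r => /andP[].
pose Jv := mkcol (- cy v) (cx v).
have dJ s : dot s Jv - dot z Jv = Y s by rewrite /dot /Jv cx_mk cy_mk /Y; ring.
have J0 (k : R) : k != 0 -> k *: Jv <> 0.
  move=> k0 E; have := congr1 (@cx R) E; have := congr1 (@cy R) E.
  rewrite !cZE /Jv cx_mk cy_mk /cx /cy !mxE => /eqP; rewrite mulf_eq0 (negbTE k0) /= => /eqP E1.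
  move=> /eqP; rewrite mulf_eq0 (negbTE k0) /= oppr_eq0 => /eqP E2.
  by move: n0; rewrite /dot /cx /cy E1 E2 mulr0 addr0 ltxx.
have [s1 s1S] := supp (J0 1 (oner_neq0 _)).
have [t1 t1S] : exists2 s, s \in S & dot s (-1 *: Jv) < dot z (-1 *: Jv).
  by apply/supp/J0; rewrite oppr_eq0 oner_neq0.
have dZ k a : dot a (k *: Jv) = k * dot a Jv by rewrite /dot !cZE; ring.
rewrite !dZ => t1Y s1Y.
have {}t1Y : 0 < Y t1 by rewrite -dJ; lra.
have {}s1Y : Y s1 < 0 by rewrite -dJ; lra.
have [[q qS [Yq Xq]]|noq] := pselect (exists2 q, q \in S & Y q = 0 /\ 0 < X q).
  exists ((dot v v)^-1 * X q); first by rewrite mulr_gt0 // invr_gt0.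
  have -> : z + ((dot v v)^-1 * X q) *: v = q.
    by rewrite [RHS]coord Yq scale0r addr0 scalerA.
  exact: sub_hull.
have [t tS Ht] := @seq_max _ (fun s => X s / Y s) [seq s <- S | 0 < Y s] t1 ltac:(by rewrite mem_filter t1Y).
have [s sS Hs] := @seq_max _ (fun s => X s / - Y s) [seq s <- S | Y s < 0] s1 ltac:(by rewrite mem_filter s1Y).
move: tS sS; rewrite !mem_filter => /andP[tY tS] /andP[sY sS].
have [ks|ks] := ltP 0 (X t / Y t + X s / - Y s).
  pose a := Y t / (Y t - Y s).
  have D0 : Y t - Y s != 0 by apply: lt0r_neq0; lra.
  have a01 : 0 <= a <= 1.
    by rewrite /a divr_ge0 ?ler_pdivrMr ?mul1r //; lra.
  exists ((dot v v)^-1 * (a * X s + (1 - a) * X t)).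
    rewrite mulr_gt0 ?invr_gt0 //.
    have -> : a * X s + (1 - a) * X t = (Y t * - Y s) / (Y t - Y s) * (X t / Y t + X s / - Y s).
      by rewrite /a; field; rewrite D0 !(ltr0_neq0 sY) (lt0r_neq0 tY).
    by rewrite mulr_gt0 // divr_gt0 ?mulr_gt0 //; lra.
  have -> : z + ((dot v v)^-1 * (a * X s + (1 - a) * X t)) *: v = a *: s + (1 - a) *: t.
    rewrite [in RHS](coord s) [in RHS](coord t).
    apply: col2P; rewrite !(cE, cZE, cx_mk, cy_mk) /a; field; rewrite D0 (lt0r_neq0 n0) //.
  by apply: ((convexP _).1 Pc); [apply: sub_hull|apply: sub_hull|].
pose k := X t / Y t.
have [u0|q qS] := supp (u := - v + k *: Jv).
  have : dot (- v + k *: Jv) v = 0 by rewrite u0 /dot /cx /cy !mxE; ring.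
  by rewrite /dot !cE !cZE /Jv cx_mk cy_mk => E'; move: n0; rewrite /dot; nra.
have -> : dot q (- v + k *: Jv) = dot z (- v + k *: Jv) + (k * Y q - X q).
  by rewrite /dot !cE !cZE /Jv cx_mk cy_mk /X /Y; ring.
suff : X q <= k * Y q by lra.
have [Yq|Yq|Yq] := ltgtP (Y q) 0.
- have := Hs q; rewrite mem_filter Yq qS => /(_ isT).
  rewrite ler_pdivrMr ?oppr_gt0 // => h; apply: le_trans h _.
  by rewrite mulrN -mulNr ler_nM2r // /k; lra.
- by have := Ht q; rewrite mem_filter Yq qS => /(_ isT); rewrite ler_pdivrMr.
- by rewrite Yq mulr0 leNgt; apply/negP => Xq; apply: noq; exists q.
Qed.

Lemma hull_interior : interior P z.
Proof.
have Pc := (convexP _).1 (@hull_convex [set` S]).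
have nz (a b : R) : (a != 0) || (b != 0) -> mkcol a b <> 0.
  move=> + E; have := congr1 (@cx R) E; have := congr1 (@cy R) E.
  by rewrite cx_mk cy_mk /cx /cy !mxE => -> ->; rewrite eqxx.
have [e1 e10 P1] := hull_cone (nz 1 0 ltac:(by rewrite oner_neq0)).
have [e2 e20 P2] := hull_cone (nz (-1) 0 ltac:(by rewrite oppr_eq0 oner_neq0)).
have [e3 e30 P3] := hull_cone (nz 0 1 ltac:(by rewrite oner_neq0 orbT)).
have [e4 e40 P4] := hull_cone (nz 0 (-1) ltac:(by rewrite oppr_eq0 oner_neq0 orbT)).
have seg x y (a b : R) : 0 < a -> 0 < b -> P (z + a *: mkcol x y) -> P (z + b *: mkcol (-x) (-y)) ->
    forall h, - b <= h <= a -> P (z + h *: mkcol x y).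
  move=> a0 b0 Pa Pb h hh.
  have ab : a + b != 0 by apply: lt0r_neq0; lra.
  have -> : z + h *: mkcol x y = ((h + b) / (a + b)) *: (z + a *: mkcol x y) +
      (1 - (h + b) / (a + b)) *: (z + b *: mkcol (-x) (-y)).
    by apply: col2P; rewrite !(cE, cZE, cx_mk, cy_mk); field.
  apply: Pc => //; rewrite divr_ge0 ?ler_pdivrMr ?mul1r //; lra.
have PX := seg 1 0 _ _ e10 e20 P1; rewrite oppr0 in PX; have {}PX := PX P2.
have PY := seg 0 1 _ _ e30 e40 P3; rewrite oppr0 in PY; have {}PY := PY P4.
pose e := Num.min (Num.min e1 e2) (Num.min e3 e4).
have e0 : 0 < e by rewrite !lt_min e10 e20 e30 e40.
have [le1 le2 le3 le4] : [/\ e <= e1, e <= e2, e <= e3 & e <= e4].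
  by rewrite /e !ge_min !lexx ?orbT.
(* Half the radius, since [x] is the midpoint of two points displaced from [z] along the axes by
   twice the coordinates of [x - z]. *)
apply/nbhs_ballP; exists (e / 2) => /=; first by rewrite divr_gt0.
move=> x [_ /= Hx].
have := Hx 0 0; have := Hx 1 0; rewrite /ball /= -/(cx _) -/(cy _) -/(cx x) -/(cy x).
rewrite !ltr_norml => /andP[y1 y2] /andP[x1 x2].
have -> : x = (1 / 2) *: (z + (2 * (cx x - cx z)) *: mkcol 1 0) + (1 - 1 / 2) *: (z + (2 * (cy x - cy z)) *: mkcol 0 1).
  by apply: col2P; rewrite !(cE, cZE, cx_mk, cy_mk); field.
by apply: Pc; [apply: PX|apply: PY|]; lra.
Qed.
End HullInterior.

Lemma interior_supp (K : set 'cV[R]_2) z : interior (convex_hull K) z ->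
  forall u, u <> 0 -> exists2 s, K s & dot s u < dot z u.
Proof.
move=> /nbhs_ballP[e /= e0 He] u u0; apply: contrapT => /forall2NP N.
have n0 : 0 < dot u u.
  rewrite lt_neqAle eq_sym; apply/andP; split; last by rewrite /dot; nra.
  apply/eqP => E; apply: u0; apply: col2P; rewrite /cx /cy !mxE -/(cx u) -/(cy u);
    move: E; rewrite /dot; nra.
have H := @hull_halfspace K u (dot z u) _.
have {}H : forall x, convex_hull K x -> dot z u <= dot x u.
  by apply: H => x Kx; case: (N x) => // /negP; rewrite -leNgt.
pose d := e / (`|cx u| + `|cy u| + 1).
have m0 : 0 < `|cx u| + `|cy u| + 1 by have := normr_ge0 (cx u); have := normr_ge0 (cy u); lra.
have d0 : 0 < d by rewrite divr_gt0.
have : convex_hull K (z - d *: u).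
  apply: He; split=> // i j; rewrite (ord1 j) /ball /= !mxE opprB addrC subrK normrM (gtr0_norm d0).
  rewrite /d mulrAC ltr_pdivrMr // ltr_pM2l //.
  have := normr_ge0 (cx u); have := normr_ge0 (cy u).
  case: i => -[|[|//]] h.
    by rewrite (_ : Ordinal h = 0) ?/cx; [lra|exact: val_inj].
  by rewrite (_ : Ordinal h = 1) ?/cy; [lra|exact: val_inj].
move/H; have -> : dot (z - d *: u) u = dot z u - d * dot u u by rewrite /dot !cE !cZE; ring.
have : 0 < d * dot u u by rewrite mulr_gt0.
lra.
Qed.

(** Being interior in terms of lattice points alone: no nonzero functional attains its minimum over
    [L] at [p]. It is tied to the topological interior by [polygon_interior]. *)
Definition inner (L : 'cV[int]_2 -> Prop) (p : 'cV[int]_2) := L p /\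
  forall u : 'cV[R]_2, u <> 0 -> exists2 s, L s & pairing s u < pairing p u.

Lemma polygon_interior (P : set 'cV[R]_2) p : lattice_polygon P ->
  interior_lattice_points P p <-> inner (lattice_points P) p.
Proof.
move=> [S [S0 PE]]; subst P; split.
  move=> H; split=> [|u u0]; first exact: interior_subset H.
  have [s /= [q qS <-] lt] := interior_supp H u0.
  by exists q; [apply: sub_hull; exists q|rewrite !pairing_dot].
move=> [Lp H]; rewrite /interior_lattice_points /=.
have SE : @toR R 2 1 @` [set` S] = [set` map (@toR R 2 1) S].
  by apply/seteqP; split=> [x [q qS <-]|x /mapP[q qS ->]] /=; [apply: map_f|exists q].
rewrite SE; apply: hull_interior => u u0; have [q Lq lt] := H u u0.
apply: contrapT => /forall2NP N.
have : dot (toR R p) u <= dot (toR R q) u.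
  apply: (hull_halfspace (K := [set` map (@toR R 2 1) S])); last by rewrite -SE.
  by move=> x /= xS; case: (N x) => // /negP; rewrite -leNgt.
by rewrite -!pairing_dot leNgt lt.
Qed.

Lemma polygon_lattice_points (P : set 'cV[R]_2) : lattice_polygon P ->
  exists Ls : seq 'cV[int]_2, (forall q, lattice_points P q <-> q \in Ls) /\ exists q, q \in Ls.
Proof.
move=> [S [S0 PE]].
(* A crude bound: the sum of all absolute coordinates of the generators dominates both coordinates
   of every point of the hull. *)
pose N := (\sum_(s <- S) (absz (cx s) + absz (cy s)))%N.
have HN s : s \in S -> (absz (cx s) + absz (cy s) <= N)%N.
  by move=> sS; rewrite /N (big_rem s) //= leq_addr.
have Hdir (a b : R) q : `|a| <= 1 -> `|b| <= 1 -> lattice_points P q ->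
    - (N%:R) <= (cx q)%:~R * a + (cy q)%:~R * b.
  move=> a1 b1 Lq; have := @hull_halfspace (@toR R 2 1 @` [set` S]) (mkcol a b) (- N%:R) _ (toR R q).
  rewrite -PE /dot cx_mk cy_mk cx_toR cy_toR => /(_ _ Lq); apply=> x [s /= /HN sN <-].
  rewrite cx_toR cy_toR.
  have Na (k : int) (c : R) : `|c| <= 1 -> - (absz k)%:R <= k%:~R * c.
    move=> c1; rewrite lerNl; apply: le_trans (ler_norm _) _; rewrite normrN normrM.
    rewrite -[X in _ <= X]mulr1 natr_absz -intr_norm; exact: ler_wpM2l.
  have := Na (cx s) a a1; have := Na (cy s) b b1.
  have : ((absz (cx s))%:R + (absz (cy s))%:R : R) <= N%:R by rewrite -natrD ler_nat.
  lra.
pose rng := [seq (i%:Z - N%:Z) | i <- iota 0 (2 * N).+1].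
have rngP (k : int) : - N%:Z <= k <= N%:Z -> k \in rng.
  move=> kN; apply/mapP; exists (absz (k + N%:Z)); last lia.
  by rewrite mem_iota; lia.
have [s Ls] : exists s, lattice_points P s.
  case: S S0 PE {N HN Hdir rng rngP} => // s S _ PE; exists s.
  by rewrite /lattice_points /= PE; apply: sub_hull; exists s; rewrite //= inE eqxx.
suff H q : lattice_points P q <->
    q \in [seq q <- [seq mkcol i j | i <- rng, j <- rng] | `[< lattice_points P q >]].
  by eexists; split; [exact: H|exists s; apply/H].
  rewrite mem_filter; split=> [Lq|/andP[/asboolP]//].
  apply/andP; split; first exact/asboolP.
  have -> : q = mkcol (cx q) (cy q) by apply: col2P; rewrite ?cx_mk ?cy_mk.
  have n1 : `|1 : R| <= 1 by rewrite normr1.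
  have n0 : `|0 : R| <= 1 by rewrite normr0.
  have nn : `|-1 : R| <= 1 by rewrite normrN1.
  apply/allpairsP; exists (cx q, cy q); split=> //=; apply: rngP.
    have := Hdir _ _ _ n1 n0 Lq; have := Hdir _ _ _ nn n0 Lq.
    rewrite !mulr0 !addr0 mulr1 mulrN1 lerN2 !pmulrn -intrN !ler_int; lia.
  have := Hdir _ _ _ n0 n1 Lq; have := Hdir _ _ _ n0 nn Lq.
  rewrite !mulr0 !add0r mulr1 mulrN1 lerN2 !pmulrn -intrN !ler_int; lia.
Qed.

End Coordinates.

(** * Cells of the regular triangulation *)

Section Cells.
Variables (R : realType) (P : set 'cV[R]_2) (c : 'cV[int]_2 -> R).
Hypotheses (HP : lattice_polygon P) (Hsm : smooth P c).
Local Notation L := (lattice_points P).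
Local Notation pt := 'cV[int]_2.
Implicit Types (p q r s t : pt) (w : 'cV[R]_2).

(** Twice the signed area. For fixed [p] and [q] it is an affine function of [r], zero on their
    line; for a triangle of area 1/2 its values on the three sides are integral barycentric
    coordinates. *)
Definition ori p q r : int := (cx q - cx p) * (cy r - cy p) - (cy q - cy p) * (cx r - cx p).

Lemma ori_rot p q r : ori q r p = ori p q r. Proof. by rewrite /ori; ring. Qed.
Lemma ori_swap p q r : ori q p r = - ori p q r. Proof. by rewrite /ori; ring. Qed.

Lemma det_row_mx (a b : pt) : \det (row_mx a b : 'M[int]_2) = cx a * cy b - cy a * cx b.
Proof.
have El i : (row_mx a b : 'M[int]_2) i 0 = a i 0.
  by rewrite -[RHS](row_mxEl a b); congr fun_of_matrix; exact: val_inj.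
have Er i : (row_mx a b : 'M[int]_2) i 1 = b i 0.
  by rewrite -[RHS](row_mxEr a b); congr fun_of_matrix; exact: val_inj.
have E1 : lift 0 0 = 1 :> 'I_2 by exact: val_inj.
have E2 : lift 1 0 = 0 :> 'I_2 by exact: val_inj.
move: El Er; move: (row_mx a b : 'M[int]_2) => A El Er.
rewrite (expand_det_row _ 0) big_ord_recl big_ord1 /cofactor !det_mx11 !mxE E1 E2 !El !Er.
by rewrite /cx /cy expr0 expr1; ring.
Qed.

Local Notation inn := (@inner R L).

Lemma polygon_convex x y (k : R) : P x -> P y -> 0 <= k <= 1 -> P (k *: x + (1 - k) *: y).
Proof. by case: HP => S [_ ->]; apply: (convexP _).1; exact: hull_convex. Qed.

Lemma lattice_conv3 (x a b d : pt) (i j k : int) : L a -> L b -> L d -> 0 <= i -> 0 <= j -> 0 <= k ->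
  0 < i + j + k ->
  i * cx a + j * cx b + k * cx d = (i + j + k) * cx x ->
  i * cy a + j * cy b + k * cy d = (i + j + k) * cy x -> L x.
Proof.
move=> La Lb Ld i0 j0 k0 n0 Ex Ey.
have ER (f g : int) : f = g -> f%:~R = g%:~R :> R by move=> ->.
have {}Ex := ER _ _ Ex; have {}Ey := ER _ _ Ey.
rewrite !(intrD, intrM) in Ex Ey.
have rn : 0 < i%:~R + j%:~R + k%:~R :> R by rewrite -!intrD ltr0z.
have ri : 0 <= i%:~R :> R by rewrite ler0z.
have rj : 0 <= j%:~R :> R by rewrite ler0z.
have rk : 0 <= k%:~R :> R by rewrite ler0z.
move: (i%:~R) (j%:~R) (k%:~R) ri rj rk rn Ex Ey => ri rj rk i0R j0R k0R n0R Ex Ey.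
have [ij0|ij0] := eqVneq (ri + rj) 0.
  have -> : x = d; last by [].
  have ri0 : ri = 0 by lra.
  have rj0 : rj = 0 by lra.
  have rk0 : rk != 0 by apply: lt0r_neq0; lra.
  rewrite ri0 rj0 !mul0r !add0r in Ex Ey.
  by apply: col2P; apply: (@intr_inj R); apply: (mulfI rk0).
have D : L x = P (((ri + rj) / (ri + rj + rk)) *: ((ri / (ri + rj)) *: toR R a + (1 - ri / (ri + rj)) *: toR R b) +
   (1 - (ri + rj) / (ri + rj + rk)) *: toR R d).
  rewrite /lattice_points /=; congr P; apply: col2P; rewrite !(cE, cZE, cx_toR, cy_toR).
    apply: (mulfI (lt0r_neq0 n0R)); rewrite -Ex; field; rewrite ij0 (lt0r_neq0 n0R) //.
  apply: (mulfI (lt0r_neq0 n0R)); rewrite -Ey; field; rewrite ij0 (lt0r_neq0 n0R) //.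
have ijp : 0 < ri + rj by rewrite lt_neqAle eq_sym ij0 addr_ge0.
rewrite D; apply: polygon_convex => //; last by rewrite divr_ge0 ?ler_pdivrMr ?mul1r //; lra.
by apply: polygon_convex => //; rewrite divr_ge0 ?ler_pdivrMr ?mul1r //; lra.
Qed.

Lemma weighted_mean_bound (i j k a b d x s : R) : i * a + j * b + k * d = (i + j + k) * x ->
  i * x <= i * a -> j * x <= j * b -> k * x <= k * d -> i * s < i * a -> i * x <= i * s -> False.
Proof. lra. Qed.

(** A functional minimal at [x] would be minimal at every point of positive weight, in particular at
    the interior point [a]. *)
Lemma inn_conv3 (x a b d : pt) (i j k : int) : inn a -> L b -> L d -> 0 < i -> 0 <= j -> 0 <= k ->
  i * cx a + j * cx b + k * cx d = (i + j + k) * cx x ->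
  i * cy a + j * cy b + k * cy d = (i + j + k) * cy x -> inn x.
Proof.
move=> [La Ha] Lb Ld i0 j0 k0 Ex Ey; split.
  by apply: (lattice_conv3 La Lb Ld (ltW i0) j0 k0 _ Ex Ey); lia.
move=> u u0; have [s Ls lt] := Ha u u0.
apply: contrapT => /forall2NP N.
have H y : L y -> pairing x u <= pairing y u.
  by move=> Ly; rewrite leNgt; apply/negP => h; case: (N y).
have ER (f g : int) : f = g -> f%:~R = g%:~R :> R by move=> ->.
have {}Ex := ER _ _ Ex; have {}Ey := ER _ _ Ey.
rewrite !(intrD, intrM) in Ex Ey.
have ri : 0 < i%:~R :> R by rewrite ltr0z.
have rj : 0 <= j%:~R :> R by rewrite ler0z.
have rk : 0 <= k%:~R :> R by rewrite ler0z.
have E : i%:~R * pairing a u + j%:~R * pairing b u + k%:~R * pairing d u =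
   (i%:~R + j%:~R + k%:~R) * pairing x u.
  rewrite !pairingE.
  transitivity ((i%:~R * (cx a)%:~R + j%:~R * (cx b)%:~R + k%:~R * (cx d)%:~R) * cx u +
    (i%:~R * (cy a)%:~R + j%:~R * (cy b)%:~R + k%:~R * (cy d)%:~R) * cy u); first by ring.
  by rewrite Ex Ey; ring.
have h1 : i%:~R * pairing x u <= i%:~R * pairing a u by rewrite ler_pM2l //; exact: H.
have h2 : j%:~R * pairing x u <= j%:~R * pairing b u by apply: ler_wpM2l => //; exact: H.
have h3 : k%:~R * pairing x u <= k%:~R * pairing d u by apply: ler_wpM2l => //; exact: H.
have h4 : i%:~R * pairing s u < i%:~R * pairing a u by rewrite ltr_pM2l.
have h5 : i%:~R * pairing x u <= i%:~R * pairing s u by rewrite ler_pM2l //; exact: H.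
exact: weighted_mean_bound E h1 h2 h3 h4 h5.
Qed.

Lemma boundary_supp b : L b -> ~ inn b ->
  exists2 u : 'cV[R]_2, u <> 0 & forall s, L s -> pairing b u <= pairing s u.
Proof.
move=> Lb nb; apply: contrapT => /forall2NP N; apply: nb; split=> // u u0.
case: (N u) => // /existsNP[s /not_implyP[Ls /negP]]; rewrite -ltNge => lt.
by exists s.
Qed.

Local Notation M := (minimizers P c).
Definition lev w q : R := c q + pairing q w.

Lemma levD w w' q : lev (w + w') q = lev w q + pairing q w'.
Proof. by rewrite /lev !pairingE !cE; ring. Qed.

Lemma min_eq w p q : M w p -> M w q -> lev w p = lev w q.
Proof. by move=> [Lp Hp] [Lq Hq]; apply/eqP; rewrite eq_le Hp // Hq. Qed.

Lemma min_lev w p q : M w p -> L q -> lev w q <= lev w p -> M w q.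
Proof. by move=> [Lp Hp] Lq le; split=> // s Ls; apply: le_trans le (Hp _ Ls). Qed.

(* The triangle dual to the vertex w of the curve, with vertices in counterclockwise order. *)
Definition cell w p q r := [/\ ori p q r = 1, M w p, M w q, M w r &
  forall t, M w t -> [\/ t = p, t = q | t = r]].

Lemma cell_rot w p q r : cell w p q r -> cell w q r p.
Proof. by move=> [op1 Mp Mq Mr H]; split; rewrite 1?ori_rot // => t /H[]; [apply: Or33|apply: Or31|apply: Or32]. Qed.

Lemma cell_neq w p q r : cell w p q r -> [/\ p <> q, q <> r & p <> r].
Proof. by move=> [op1 _ _ _ _]; split=> E; subst; move: op1; rewrite /ori; lia. Qed.

Lemma cell_perm w a b d p q t : cell w a b d -> M w p -> M w q -> M w t ->
  p <> q -> q <> t -> p <> t ->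
  (ori p q t = 1 \/ ori p q t = - 1) /\ forall x, M w x -> [\/ x = p, x = q | x = t].
Proof.
move=> [op1 _ _ _ H] /H Ep /H Eq /H Et pq qt pt_; split.
  by case: Ep pq pt_ => ->; case: Eq qt => ->; case: Et => -> // _ _ _;
    rewrite /ori in op1 *; lia.
move=> x /H.
by case: Ep pq pt_ => ->; case: Eq qt => ->; case: Et => -> // _ _ _ [] ->;
  do ?[by apply: Or31|by apply: Or32|by apply: Or33].
Qed.

Lemma cellP w : unimodular_triangle (M w) <-> exists p q r, cell w p q r.
Proof.
split=> [[p [q [r [E]]]]|[p [q [r [op1 Mp Mq Mr H]]]]].
  rewrite det_row_mx !cE => D.
  have Mp : M w p by rewrite E; left; left.
  have Mq : M w q by rewrite E; left; right.
  have Mr : M w r by rewrite E; right.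
  have [op1|op1] : ori p q r = 1 \/ ori p r q = 1.
    have -> : ori p r q = - ori p q r by rewrite /ori; ring.
    by move: D; rewrite -/(ori p q r); move: (ori p q r) => k; lia.
    by exists p, q, r; split=> // t; rewrite E => -[[->|->]|->]; [apply: Or31|apply: Or32|apply: Or33].
  by exists p, r, q; split=> // t; rewrite E => -[[->|->]|->]; [apply: Or31|apply: Or33|apply: Or32].
exists p, q, r; split; last by rewrite det_row_mx !cE -/(ori p q r) op1 normr1.
apply/seteqP; split=> [t /H[->|->|->]|t [[->|->]|->]] //; [by left; left|by left; right|by right].
Qed.

Variable Ls : seq pt.
Hypothesis HLs : forall q, L q <-> q \in Ls.

(** Enlarging a set of minimizers must stop, as there are finitely many lattice points, and [smooth]
    makes the maximal sets triangles. *)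
Lemma smooth_cell w : exists w', (exists p q r, cell w' p q r) /\ forall t, M w t -> M w' t.
Proof.
pose n w := count (fun q => `[< M w q >]) Ls.
have [k] := ubnP (size Ls - n w); elim: k w => // k IH w lek.
have [mx|nmx] := pselect (forall w', M w `<=` M w' -> M w' `<=` M w).
  by exists w; split=> //; apply/cellP/Hsm.
move/existsNP: nmx => [w' /not_implyP[sub /existsNP[t /not_implyP[Mt nMt]]]].
have lt : (n w < n w')%N.
  have tL : t \in Ls by apply/HLs; case: Mt.
  rewrite /n; elim: (Ls) tL => //= a l IHl; rewrite inE => /orP[/eqP<-|/IHl].
    have -> : `[< M w t >] = false by apply/asboolPn.
    have -> : `[< M w' t >] by apply/asboolP.
    by rewrite ltnS; apply: sub_count => q /asboolP/sub/asboolP.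
  have : (`[< M w a >] <= `[< M w' a >])%N.
    by case: asboolP => //= /sub Ma; rewrite asboolT.
  by move=> h1 h2; rewrite -addnS leq_add.
have nle : (n w' <= size Ls)%N by exact: count_size.
have [|w'' [C S]] := IH w'; first lia.
by exists w''; split=> // q /sub/S.
Qed.

(** [q - p] turned counterclockwise by a right angle: the direction of the edge dual to the side
    [p q]. Along it the level of [s] relative to [p] changes at rate [ori p q s]. *)
Definition rotv (q p : pt) : 'cV[R]_2 := mkcol (- (cy q - cy p)%:~R) (cx q - cx p)%:~R.

Lemma pairing_rotv p q s : pairing s (rotv q p) - pairing p (rotv q p) = (ori p q s)%:~R.
Proof.
by rewrite !pairingE /rotv cx_mk cy_mk /ori !(intrD, intrM, intrN); ring.
Qed.

(** Moving [w] along [rotv q p] keeps [p] and [q] level and lowers, relative to them, the points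
    right of the side. The first such point to reach their level is a vertex of the triangle
    across. *)
Lemma across w p q r s : cell w p q r -> L s -> ori p q s < 0 ->
  exists tau s', 0 < tau /\ cell (w + tau *: rotv q p) q p s'.
Proof.
move=> [op1 Mp Mq Mr H] Ls0 os.
have pZ x (k : R) : pairing x (k *: rotv q p) = k * pairing x (rotv q p).
  by rewrite !pairingE !cZE; ring.
pose gap x := (lev w x - lev w p) / - (ori p q x)%:~R.
pose l := [seq x <- Ls | ori p q x < 0].
have [t tl Ht] : exists2 t, t \in l & forall x, x \in l -> gap t <= gap x.
  have [t tl Ht] := @seq_max R _ (fun x => - gap x) l s ltac:(by rewrite mem_filter os; apply/HLs).
  by exists t => // x /Ht; rewrite lerN2.
move: tl; rewrite mem_filter => /andP[ot /HLs Lt].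
have opos x : ori p q x < 0 -> 0 < - (ori p q x)%:~R :> R by move=> h; rewrite oppr_gt0 ltrz0.
have tau0 : 0 < gap t.
  rewrite /gap divr_gt0 ?opos // subr_gt0 ltNge; apply/negP => le.
  have /H[E|E|E] : M w t by exact: min_lev Mp Lt le.
  - by move: ot; rewrite E /ori; lia.
  - by move: ot; rewrite E /ori; lia.
  - by move: ot; rewrite E op1.
set tau := gap t in tau0.
set w' := w + tau *: rotv q p.
have levE x : lev w' x - lev w' p = lev w x - lev w p + tau * (ori p q x)%:~R.
  by rewrite !levD !pZ -pairing_rotv; ring.
have op : ori p q p = 0 by rewrite /ori; ring.
have oq : ori p q q = 0 by rewrite /ori; ring.
have M'p : M w' p.
  case: Mp => Lp Hp; split=> // x Lx; rewrite -subr_ge0 -/(lev w' x) -/(lev w' p) levE.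
  have h := Hp x Lx; rewrite -/(lev w x) -/(lev w p) in h.
  have [ox|ox] := ltP (ori p q x) 0.
    have := Ht x; rewrite mem_filter ox => /(_ ((HLs x).1 Lx)).
    rewrite -/tau /gap ler_pdivlMr ?opos //; lra.
  have : 0 <= tau * (ori p q x)%:~R by rewrite mulr_ge0 ?ler0z // ltW.
  lra.
have M'q : M w' q.
  apply: (min_lev M'p); first by case: Mq.
  by rewrite -subr_le0 levE (min_eq Mp Mq) subrr oq mulr0 addr0.
have M't : M w' t.
  apply: (min_lev M'p) => //; rewrite -subr_le0 levE.
  have : tau * - (ori p q t)%:~R = lev w t - lev w p.
    by rewrite /tau /gap divfK // lt0r_neq0 // opos.
  lra.
have [w'' [[a [b [d C]]] S]] := smooth_cell w'.
have pq : p <> q by have [] := cell_neq (And5 op1 Mp Mq Mr H).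
have qt : q <> t by move=> E; rewrite -E oq in ot.
have pt_ : p <> t by move=> E; rewrite -E op in ot.
have [ot1 Sub] := cell_perm C (S _ M'p) (S _ M'q) (S _ M't) pq qt pt_.
exists tau, t; split=> //; split=> //.
- by rewrite ori_swap; case: ot1 => E; rewrite E ?opprK // in ot *.
- by move=> x /S/Sub[->|->|->]; [apply: Or32|apply: Or31|apply: Or33].
Qed.

Lemma solve_unimodular2 (a b e f x y : R) : a * f - b * e = 1 -> a * x + b * y = 0 ->
  x = (e * x + f * y) * - b /\ y = (e * x + f * y) * a.
Proof.
move=> h1 h2; split; apply/eqP; rewrite -subr_eq0; apply/eqP.
  rewrite (_ : _ - _ = x * (1 - (a * f - b * e)) + f * (a * x + b * y)); last ring.
  by rewrite h1 h2; ring.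
rewrite (_ : _ - _ = y * (1 - (a * f - b * e)) - e * (a * x + b * y)); last ring.
by rewrite h1 h2; ring.
Qed.

(** The two positions differ by a multiple of [rotv q p]. Both [r] and [r'] have height 1 over the
    side, so minimality at [w'] makes the multiple nonnegative and minimality at [w] makes it
    nonpositive. *)
Lemma side_unique w w' p q r r' : cell w p q r -> cell w' p q r' -> w = w' /\ r = r'.
Proof.
move=> C C'; have [op1 Mp Mq Mr H] := C; have [op1' Mp' Mq' Mr' H'] := C'.
pose d : 'cV[R]_2 := w' - w.
have levd s : lev w' s = lev w s + pairing s d by rewrite -levD /d addrC subrK.
have Lof w0 s : M w0 s -> L s by case.
have le0 w0 s s' : M w0 s -> L s' -> lev w0 s <= lev w0 s' by case=> _; apply.
have h1 : pairing q d = pairing p d.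
  by have := min_eq Mp' Mq'; rewrite !levd (min_eq Mp Mq) => /addrI.
have h2 : pairing p d <= pairing r d.
  by have := le0 _ _ _ Mp' (Lof _ _ Mr); rewrite !levd (min_eq Mp Mr) lerD2l.
have h3 : pairing r' d <= pairing p d.
  have := le0 _ _ _ Mp (Lof _ _ Mr'); have := min_eq Mp' Mr'; rewrite !levd; lra.
have E : d = (pairing r d - pairing p d) *: rotv q p.
  have o1 : (ori p q r)%:~R = 1 :> R by rewrite op1.
  have := @solve_unimodular2 (cx q - cx p)%:~R (cy q - cy p)%:~R (cx r - cx p)%:~R (cy r - cy p)%:~R (cx d) (cy d).
  move: h1 o1; rewrite !pairingE /ori /rotv !(intrD, intrM, intrN) => h1 o1 [||ex ey].
  - by move: o1; lra.
  - by move: h1; lra.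
  - apply: col2P; rewrite !cZE ?cx_mk ?cy_mk.
      by rewrite [LHS]ex; ring.
    by rewrite [LHS]ey; ring.
have pZ x (k : R) : pairing x (k *: rotv q p) = k * pairing x (rotv q p).
  by rewrite !pairingE !cZE; ring.
have k0 : pairing r d - pairing p d = 0.
  have : pairing r' d - pairing p d = pairing r d - pairing p d.
    by rewrite {1 2}E !pZ -mulrBr pairing_rotv op1' mulr1.
  lra.
rewrite k0 scale0r in E.
have ww : w = w' by apply/esym/eqP; rewrite -subr_eq0 -/d E.
split=> //; subst w'; have [_ qr pr] := cell_neq C; case: (H' _ Mr) => // E1.
  by case: pr.
by case: qr.
Qed.

(** The difference of the levels at [w] and [w'] is affine in the lattice point, so equal weighted
    sums of points have equal differences. Minimality on both sides then forces each [b] of positive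
    weight to be minimal at [w] too. This stands in for the fact that cells meet along common
    faces. *)
Lemma cross w w' (A B : seq (R * pt)) :
  (forall a, a \in A -> 0 <= a.1 /\ M w a.2) ->
  (forall b, b \in B -> 0 <= b.1 /\ M w' b.2) ->
  \sum_(a <- A) a.1 = \sum_(b <- B) b.1 ->
  \sum_(a <- A) a.1 * (cx a.2)%:~R = \sum_(b <- B) b.1 * (cx b.2)%:~R ->
  \sum_(a <- A) a.1 * (cy a.2)%:~R = \sum_(b <- B) b.1 * (cy b.2)%:~R ->
  forall b, b \in B -> 0 < b.1 -> M w b.2.
Proof.
move=> HA HB E0 Ex Ey b bB b0.
case: (pselect (exists a, a \in A)) => [[[k a0] aA]|noA]; last first.
  have A0 : A = [::] by case: (A) noA => // a l N; case: N; exists a; rewrite inE eqxx.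
  move: E0; rewrite A0 big_nil (big_rem b) //=.
  have : 0 <= \sum_(y <- rem b B) y.1 by rewrite big_seq sumr_ge0 // => y /mem_rem/HB[].
  lra.
have [_ Ma0] := HA _ aA; have [_ Mb] := HB _ bB.
have affine (C : seq (R * pt)) : \sum_(x <- C) x.1 * (lev w x.2 - lev w' x.2) =
    (\sum_(x <- C) x.1 * (cx x.2)%:~R) * (cx w - cx w') +
    (\sum_(x <- C) x.1 * (cy x.2)%:~R) * (cy w - cy w').
  rewrite !mulr_suml -big_split; apply: eq_bigr => x _ /=.
  by rewrite /lev !pairingE; ring.
have EA : \sum_(x <- A) x.1 * (lev w x.2 - lev w' x.2) = \sum_(x <- B) x.1 * (lev w x.2 - lev w' x.2).
  by rewrite !affine Ex Ey.
have hA : \sum_(x <- A) x.1 * (lev w x.2 - lev w' x.2) <= \sum_(x <- A) x.1 * (lev w a0 - lev w' b.2).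
  rewrite !big_seq; apply: ler_sum => x /HA[x0 Mx]; apply: ler_wpM2l => //.
  have := min_eq Mx Ma0; have [_] := Mb; move=> /(_ x.2 (proj1 Mx)); rewrite -/(lev w' _) -/(lev w' x.2); lra.
have hB : \sum_(x <- B) x.1 * (lev w x.2 - lev w' x.2) =
    \sum_(x <- B) x.1 * (lev w x.2 - lev w a0) + \sum_(x <- B) x.1 * (lev w a0 - lev w' b.2).
  rewrite -big_split /= !big_seq; apply: eq_bigr => x /HB[_ Mx].
  by rewrite (min_eq Mx Mb); ring.
have S0 : \sum_(x <- B) x.1 * (lev w x.2 - lev w a0) <= 0.
  have : \sum_(x <- A) x.1 * (lev w a0 - lev w' b.2) = \sum_(x <- B) x.1 * (lev w a0 - lev w' b.2).
    by rewrite -!mulr_suml E0.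
  lra.
have P0 x : x \in B -> 0 <= x.1 * (lev w x.2 - lev w a0).
  move=> /HB[x0 Mx]; rewrite mulr_ge0 // subr_ge0.
  by case: Ma0 => _; apply; case: Mx.
apply: (min_lev Ma0); first by case: Mb.
move: S0; rewrite (big_rem b) //=.
have : 0 <= \sum_(y <- rem b B) y.1 * (lev w y.2 - lev w a0).
  by rewrite big_seq sumr_ge0 // => y /mem_rem/P0.
have := P0 _ bB; move: (\sum_(_ <- _) _) => S h1 h2 h3.
have : b.1 * (lev w b.2 - lev w a0) <= 0 by lra.
by rewrite pmulr_rle0 // subr_le0.
Qed.

Definition ori_real p q (x0 : 'cV[R]_2) : R :=
  dot x0 (rotv q p) - pairing p (rotv q p).

End Cells.

(** Bezout coefficients show each factor to be an integral multiple of the other; positive integers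
    with product 1 are 1. *)
Lemma primitive_length (R : realType) (ux uy vx vy : int) (l t : R) :
  (exists a b : int, a * ux + b * uy = 1) -> (exists a b : int, a * vx + b * vy = 1) ->
  0 < l -> 0 < t -> l * ux%:~R = t * vx%:~R -> l * uy%:~R = t * vy%:~R -> l = t.
Proof.
move=> [a [b E]] [a' [b' E']] l0 t0 Ex Ey.
have H1 : t = l * (a' * ux + b' * uy)%:~R.
  have -> : l * (a' * ux + b' * uy)%:~R = a'%:~R * (l * ux%:~R) + b'%:~R * (l * uy%:~R).
    by rewrite intrD !intrM; ring.
  rewrite Ex Ey; have -> : a'%:~R * (t * vx%:~R) + b'%:~R * (t * vy%:~R) = t * (a' * vx + b' * vy)%:~R.
    by rewrite intrD !intrM; ring.
  by rewrite E' mulr1.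
have H2 : l = t * (a * vx + b * vy)%:~R.
  have -> : t * (a * vx + b * vy)%:~R = a%:~R * (t * vx%:~R) + b%:~R * (t * vy%:~R).
    by rewrite intrD !intrM; ring.
  rewrite -Ex -Ey; have -> : a%:~R * (l * ux%:~R) + b%:~R * (l * uy%:~R) = l * (a * ux + b * uy)%:~R.
    by rewrite intrD !intrM; ring.
  by rewrite E mulr1.
move: (a' * ux + b' * uy) (a * vx + b * vy) H1 H2 => k k' H1 H2.
have k0 : 0 < k by rewrite -(ltr0z R) -(pmulr_rgt0 _ l0) -H1.
have kk : k * k' = 1.
  apply: (@intr_inj R); rewrite intrM; apply: (mulfI (lt0r_neq0 l0)).
  by rewrite mulrA -H1 -H2 mulr1.
have k1 : k = 1.
  have : (k %| 1)%Z by apply/dvdzP; exists k'; rewrite mulrC.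
  by rewrite dvdz1 => /eqP; lia.
by rewrite H1 k1 mulr1.
Qed.

(** * The bounded part of a smooth tropical curve *)

Section Curve.
Variables (R : realType) (P : set 'cV[R]_2) (c : 'cV[int]_2 -> R).
Hypotheses (HP : lattice_polygon P) (Hsm : smooth P c).
Local Notation L := (lattice_points P).
Local Notation pt := 'cV[int]_2.
Variable Ls : seq pt.
Hypothesis HLs : forall q, L q <-> q \in Ls.
Variable G : mgraph R.
Local Notation V := (vert G).
Variable pos : V -> 'cV[R]_2.
Hypotheses (pos_inj : injective pos) (pos_range : range pos = curve_vertex P c).
Hypothesis pos_edge : forall e, bounded_edge P c (pos (ends e).1) (pos (ends e).2) /\
                  lattice_length (pos (ends e).1) (pos (ends e).2) (len e).
Hypothesis pos_unique : forall v v', bounded_edge P c (pos v) (pos v') ->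
                  exists! e, ends e = (v, v') \/ ends e = (v', v).
Implicit Types (v u : V) (e : edge G) (p q r s t : pt) (w : 'cV[R]_2).

Local Notation inn := (inner R L).
Local Notation M w := (minimizers P c w).
Local Notation cell := (cell P c).
Local Notation rotv := (@rotv R).

(** Three weighted points on each side; zero weights and repeated points cover segments and single
    points. *)
Lemma cross3 w w' (a1 a2 a3 b1 b2 b3 : pt) (k1 k2 k3 l1 l2 l3 : R) :
  M w a1 -> M w a2 -> M w a3 -> M w' b1 -> M w' b2 -> M w' b3 ->
  0 <= k1 -> 0 <= k2 -> 0 <= k3 -> 0 <= l1 -> 0 <= l2 -> 0 <= l3 ->
  k1 + k2 + k3 = l1 + l2 + l3 ->
  k1 * (cx a1)%:~R + k2 * (cx a2)%:~R + k3 * (cx a3)%:~R =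
  l1 * (cx b1)%:~R + l2 * (cx b2)%:~R + l3 * (cx b3)%:~R ->
  k1 * (cy a1)%:~R + k2 * (cy a2)%:~R + k3 * (cy a3)%:~R =
  l1 * (cy b1)%:~R + l2 * (cy b2)%:~R + l3 * (cy b3)%:~R ->
  [/\ 0 < l1 -> M w b1, 0 < l2 -> M w b2 & 0 < l3 -> M w b3].
Proof.
move=> A1 A2 A3 B1 B2 B3 k10 k20 k30 l10 l20 l30 E0 Ex Ey.
have H := @cross R P c w w' [:: (k1, a1); (k2, a2); (k3, a3)] [:: (l1, b1); (l2, b2); (l3, b3)].
have {}H : forall z, z \in [:: (l1, b1); (l2, b2); (l3, b3)] -> 0 < z.1 -> M w z.2.
  apply: H; rewrite ?big_cons ?big_nil /= ?addr0 ?addrA //.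
    by move=> z; rewrite !inE => /orP[/eqP->|/orP[]/eqP->].
  by move=> z; rewrite !inE => /orP[/eqP->|/orP[]/eqP->].
by split; [apply: (H (l1, b1))|apply: (H (l2, b2))|apply: (H (l3, b3))]; rewrite !inE eqxx ?orbT.
Qed.

(* The edge e, directed from v to v', is dual to the side p q with the triangle of v on its left. *)
Definition dart v v' e p q := [/\ exists r, cell (pos v) p q r, exists s, cell (pos v') q p s,
  ends e = (v, v') \/ ends e = (v', v) & pos v' = pos v + len e *: rotv q p].

Lemma vertex_cell v : exists p q r, cell (pos v) p q r.
Proof. by apply/cellP; rewrite -/(curve_vertex P c _) -pos_range; exists v. Qed.

Lemma cell_vertex w p q r : cell w p q r -> exists v, pos v = w.
Proof.
move=> C; have : curve_vertex P c w by apply/cellP; exists p, q, r.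
by rewrite -pos_range => -[v _ <-]; exists v.
Qed.

Lemma cell_pair w p q a b d : cell w a b d -> M w p -> M w q -> p <> q ->
  exists r, cell w p q r \/ cell w q p r.
Proof.
move=> C; have [_ Ma Mb Md H] := C; have C2 := cell_rot C; have C3 := cell_rot C2.
by move=> /H[->|->|->] /H[->|->|->] // _;
  first [by exists a; tauto|by exists b; tauto|by exists d; tauto].
Qed.

Lemma cell_inj3 w p q r q' r' : cell w p q r -> cell w p q' r' -> q = q' /\ r = r'.
Proof.
move=> C C'; have [op1 _ _ _ H] := C; have [op1' _ Mq' Mr' _] := C'.
have [n1 n2 n3] := cell_neq C'.
have [|E|E] := H _ Mq'; [by move=> E; case: n1| |].
  subst q'; split=> //; have [|E|E//] := H _ Mr'; by [move=> E; case: n3|case: n2].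
have [|F|F] := H _ Mr'; [by move=> F; case: n3| |by case: n2; rewrite E F].
by move: op1'; rewrite E F; move: op1; rewrite /ori; lia.
Qed.

Lemma rotvC p q : rotv p q = - rotv q p.
Proof. by apply: col2P; rewrite !cE /rotv !(cx_mk, cy_mk) ?cE !(intrD, intrN); ring. Qed.

(** The area condition makes [q - p] primitive, so the lattice length prescribed for [e] is the
    factor with which [across] reaches the next vertex. *)
Lemma edge_len v v' e p q r (tau : R) : cell (pos v) p q r -> 0 < tau ->
  ends e = (v, v') \/ ends e = (v', v) -> pos v' = pos v + tau *: rotv q p -> len e = tau.
Proof.
move=> [op1 _ _ _ _] tau0 Ee Ev.
have [_ [u [/coprimezP[[a b] /= E] El]]] := pos_edge e.
have Bp : exists a b : int, a * - (cy q - cy p) + b * (cx q - cx p) = 1.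
  by exists (cx r - cx p), (cy r - cy p); rewrite -[RHS]op1 /ori; ring.
have Bm : exists a b : int, a * (cy q - cy p) + b * - (cx q - cx p) = 1.
  by exists (- (cx r - cx p)), (- (cy r - cy p)); rewrite -[RHS]op1 /ori; ring.
have Bu : exists a b : int, a * cx u + b * cy u = 1 by exists a, b.
case: Ee El => -> /= El.
  have {}El : len e *: toR R u = tau *: rotv q p by rewrite -El Ev addrC addKr.
  have Ex := congr1 (@cx R) El; have Ey := congr1 (@cy R) El.
  rewrite !cZE cx_toR /rotv cx_mk -intrN in Ex; rewrite !cZE cy_toR /rotv cy_mk in Ey.
  exact: primitive_length Bu Bp (len_gt0 e) tau0 Ex Ey.
have {}El : len e *: toR R u = tau *: rotv p q.
  by rewrite -El Ev opprD addrA subrr add0r (rotvC p q) scalerN.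
have Ex := congr1 (@cx R) El; have Ey := congr1 (@cy R) El.
rewrite !cZE cx_toR /rotv cx_mk -intrN opprB in Ex; rewrite !cZE cy_toR /rotv cy_mk -opprB in Ey.
exact: primitive_length Bu Bm (len_gt0 e) tau0 Ex Ey.
Qed.

Lemma cell_opp w w' p q r s : cell w p q r -> cell w' q p s -> w <> w'.
Proof.
move=> C C' E; subst w'; have [op1 _ _ _ H] := C; have [op1' _ _ Ms _] := C'.
by case: (H _ Ms) => F; move: op1 op1'; rewrite F /ori; lia.
Qed.

Lemma dart_edge e : exists p q, dart (ends e).1 (ends e).2 e p q.
Proof.
have [[_ _ ww [p [q [pq sub]]]] _] := pos_edge e.
have [Mp Mp'] : (M (pos (ends e).1) `&` M (pos (ends e).2)) p by apply: sub; left.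
have [Mq Mq'] : (M (pos (ends e).1) `&` M (pos (ends e).2)) q by apply: sub; right.
clear sub; wlog [r C] : p q pq Mp Mp' Mq Mq' / exists r, cell (pos (ends e).1) p q r.
  move=> W; have [a [b [d C]]] := vertex_cell (ends e).1.
  have [r [Cr|Cr]] := cell_pair C Mp Mq pq; first by apply: (W p q) => //; exists r.
  by apply: (W q p) => //; [exact: nesym|exists r].
have [a [b [d C']]] := vertex_cell (ends e).2.
have [s [Cs|Cs]] := cell_pair C' Mp' Mq' pq; first by case: (side_unique C Cs) => /ww.
have [op1 _ _ Ms _] := Cs; have Lss : L s by case: Ms.
have [tau [s' [tau0 C1]]] := across Hsm HLs C Lss (ltac:(by rewrite -(opprK (ori _ _ _)) -ori_swap op1)).
have [Ew _] := side_unique Cs C1.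
exists p, q; split; [by exists r|by exists s|by left; case: (ends e)|].
by rewrite Ew (edge_len C tau0 _ Ew) //; left; case: (ends e).
Qed.

Lemma dart_sym v v' e p q : dart v v' e p q -> dart v' v e q p.
Proof.
move=> [C C' Ee E]; split=> //; first by case: Ee; tauto.
by rewrite E (rotvC p q) scalerN addrK.
Qed.

Lemma dart_exists v p q r s : cell (pos v) p q r -> L s -> ori p q s < 0 ->
  exists v' e, dart v v' e p q.
Proof.
move=> C Lss os; have [tau [s' [tau0 C']]] := across Hsm HLs C Lss os.
have [v' Ev] := cell_vertex C'; rewrite -Ev in C'.
have BE : bounded_edge P c (pos v) (pos v').
  split; [by apply/cellP; exists p, q, r|by apply/cellP; exists q, p, s'|exact: cell_opp C C'|].
  exists p, q; split; first by have [] := cell_neq C.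
  have [_ Mp Mq _ _] := C; have [_ Mq' Mp' _ _] := C'.
  by move=> t [->|->]; split.
have [e [Ee _]] := pos_unique BE.
exists v', e; split; [by exists r|by exists s'|by []|].
by rewrite (edge_len C tau0 Ee Ev).
Qed.

Lemma dart_neq v v' e p q : dart v v' e p q -> v <> v'.
Proof. by move=> [[r C] [s C'] _ _] E; apply: (cell_opp C C'); rewrite E. Qed.

Lemma dart_bounded v v' e p q : dart v v' e p q -> bounded_edge P c (pos v) (pos v').
Proof.
move=> [[r C] [s C'] _ _].
split; [by apply/cellP; exists p, q, r|by apply/cellP; exists q, p, s|exact: cell_opp C C'|].
exists p, q; split; first by have [] := cell_neq C.
have [_ Mp Mq _ _] := C; have [_ Mq' Mp' _ _] := C'.
by move=> t [->|->]; split.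
Qed.

Lemma dart_same v v' e u u' e' p q : dart v v' e p q -> dart u u' e' p q ->
  [/\ v = u, v' = u' & e = e'].
Proof.
move=> D D'; have [[r C] [s C'] Ee _] := D; have [[r2 C2] [s2 C2'] Ee' _] := D'.
have [/pos_inj E1 _] := side_unique C C2; have [/pos_inj E2 _] := side_unique C' C2'.
split=> //; subst u u'; have [e0 [_ U]] := pos_unique (dart_bounded D).
by rewrite -(U e Ee) -(U e' Ee').
Qed.

(** Adjacent triangles share only the two ends of their common side, so the pair of vertices
    determines the dual side. *)
Lemma dart_fan v v' e e' p q p' q' : dart v v' e p q -> dart v v' e' p' q' -> p = p' /\ q = q'.
Proof.
move=> [[r C] [s C'] _ _] [[r2 C2] [s2 C2'] _ _].
have [n1 n2 n3] := cell_neq C2.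
have rs : r <> s.
  move=> E; subst s; have [op1 _ _ _ _] := C; have [op1' _ _ _ _] := C'.
  by move: op1 op1'; rewrite /ori; lia.
have [op1 _ _ _ H] := C; have [op1' _ _ _ H'] := C'.
have [_ Mp Mq _ _] := C2; have [_ Mq' Mp' _ _] := C2'.
have F t : M (pos v) t -> M (pos v') t -> t = p \/ t = q.
  by move=> /H[]; [left|right|move=> -> /H'[]; [right|left|]].
have [E1|E1] := F _ Mp Mp'; have [E2|E2] := F _ Mq Mq'; subst p' q' => //.
by case: (cell_opp C C2).
Qed.

Lemma dart_ends v v' e p q : dart v v' e p q ->
  ((ends e).1 = v /\ (ends e).2 = v') \/ ((ends e).1 = v' /\ (ends e).2 = v).
Proof. by move=> [_ _ [->|->] _]; [left|right]. Qed.

Lemma dart_dual v v' u u' e p q p' q' : dart v v' e p q -> dart u u' e p' q' ->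
  [/\ u = v, u' = v', p' = p & q' = q] \/ [/\ u = v', u' = v, p' = q & q' = p].
Proof.
move=> D D'; have [[E1 E2]|[E1 E2]] := dart_ends D; have [[F1 F2]|[F1 F2]] := dart_ends D';
  rewrite E1 in F1; rewrite E2 in F2; subst u u'; [left|right|right|left].
- by have [-> ->] := dart_fan D D'.
- by have [-> ->] := dart_fan (dart_sym D) D'.
- by have [-> ->] := dart_fan (dart_sym D) D'.
- by have [-> ->] := dart_fan D D'.
Qed.

(* The value at [pos v] of the tropical polynomial divided by the monomial of exponent x0. *)
Definition pot (x0 : 'cV[R]_2) v : R :=
  let p := xget 0 (M (pos v)) in lev c (pos v) p - dot x0 (pos v).

Lemma potE (x0 : 'cV[R]_2) v p : M (pos v) p -> pot x0 v = lev c (pos v) p - dot x0 (pos v).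
Proof.
move=> Mp; rewrite /pot; have Mx : M (pos v) (xget 0 (M (pos v))) by apply: xgetPex; exists p.
by rewrite (min_eq Mx Mp).
Qed.

(** Along the edge the potential grows by the edge length times the depth of [x0] beyond the crossed
    side. *)
Lemma pot_dart (x0 : 'cV[R]_2) v v' e p q : dart v v' e p q -> ori_real p q x0 < 0 -> pot x0 v < pot x0 v'.
Proof.
move=> [[r [_ Mp _ _ _]] [s [_ _ Mp' _ _]] _ Ev] op0.
rewrite (potE x0 Mp) (potE x0 Mp') Ev levD.
have -> : pairing p (len e *: rotv q p) = len e * pairing p (rotv q p) by rewrite !pairingE !cZE; ring.
have -> : dot x0 (pos v + len e *: rotv q p) = dot x0 (pos v) + len e * dot x0 (rotv q p).
  by rewrite /dot !cE !cZE; ring.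
have : len e * (dot x0 (rotv q p) - pairing p (rotv q p)) < 0 by rewrite pmulr_rlt0 ?len_gt0.
lra.
Qed.

(** Induction along a walk that keeps crossing sides with [x0] beyond them: the potential increases
    strictly on a finite set of vertices. *)
Lemma walk_ind (x0 : 'cV[R]_2) (Q : V -> Prop) :
  (forall v, (forall v' e p q, dart v v' e p q -> ori_real p q x0 < 0 -> Q v') -> Q v) ->
  forall v, Q v.
Proof.
move=> H v; have [k] := ubnP #|[pred u | pot x0 v < pot x0 u]|.
elim: k v => // k IH v lek; apply: H => v' e p q D op0; apply: IH.
rewrite -ltnS; apply: leq_trans lek; rewrite ltnS; apply: proper_card; apply/properP; split.
  by apply/fintype.subsetP => u; rewrite !inE; apply: lt_trans; apply: pot_dart D op0.
by exists v'; rewrite !inE ?ltxx // (pot_dart D op0).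
Qed.

Lemma ori_real_toR p q s : ori_real p q (toR R s) = (ori p q s)%:~R.
Proof. by rewrite /ori_real -pairing_dot pairing_rotv. Qed.

Lemma some_vertex : exists v : V, True.
Proof.
have [w' [[p [q [r C]]] _]] := smooth_cell Hsm HLs 0.
by have [v _] := cell_vertex C; exists v.
Qed.

Lemma ori_sum p q r s : ori p q s + ori q r s + ori r p s = ori p q r.
Proof. by rewrite /ori; ring. Qed.

Lemma ori_bary p q r s :
  ori q r s * cx p + ori r p s * cx q + ori p q s * cx r = ori p q r * cx s /\
  ori q r s * cy p + ori r p s * cy q + ori p q s * cy r = ori p q r * cy s.
Proof. by rewrite /ori; split; ring. Qed.

Lemma lattice_in_cell p q r s : ori p q r = 1 -> 0 <= ori p q s -> 0 <= ori q r s -> 0 <= ori r p s ->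
  [\/ s = p, s = q | s = r].
Proof.
move=> op1 h1 h2 h3; have S := ori_sum p q r s; rewrite op1 in S.
have [/esym Ex /esym Ey] := ori_bary p q r s; rewrite op1 !mul1r in Ex Ey.
move: (ori p q s) (ori q r s) (ori r p s) h1 h2 h3 S Ex Ey => i j k h1 h2 h3 S Ex Ey.
have [E|[E|E]] : (i = 0 /\ j = 1 /\ k = 0) \/ (i = 0 /\ j = 0 /\ k = 1) \/ (i = 1 /\ j = 0 /\ k = 0) by lia.
- by case: E => E1 [E2 E3]; apply: Or31; apply: col2P; rewrite ?Ex ?Ey E1 E2 E3; ring.
- by case: E => E1 [E2 E3]; apply: Or32; apply: col2P; rewrite ?Ex ?Ey E1 E2 E3; ring.
- by case: E => E1 [E2 E3]; apply: Or33; apply: col2P; rewrite ?Ex ?Ey E1 E2 E3; ring.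
Qed.

(** A walk towards [s] ends in a triangle containing [s], and a triangle of area 1/2 contains no
    lattice points besides its vertices. *)
Lemma lattice_vertex s : L s -> exists v, M (pos v) s.
Proof.
move=> Lss; apply: contrapT => N; have [v0 _] := some_vertex.
suff : forall v, False by apply.
apply: (@walk_ind (toR R s)) => v IH.
have [p [q [r C]]] := vertex_cell v; have C2 := cell_rot C; have C3 := cell_rot C2.
have H a b d : cell (pos v) a b d -> 0 <= ori a b s.
  move=> Ca; rewrite leNgt; apply/negP => h; have [v' [e D]] := dart_exists Ca Lss h.
  by apply: (IH _ _ _ _ D); rewrite ori_real_toR ltrz0.
have [op1 Mp Mq Mr _] := C; apply: N; exists v.
by case: (lattice_in_cell op1 (H _ _ _ C) (H _ _ _ C2) (H _ _ _ C3)) => ->.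
Qed.

Definition bary p q r : 'cV[R]_2 := (1 / 3) *: (toR R p + toR R q + toR R r).

(** From any vertex, walk towards the barycentre of the triangle of [v0]. The final triangle
    contains that interior point, and [cross3] identifies it with the triangle of [v0]. *)
Lemma curve_connected : connected_mgraph G.
Proof.
move=> A HA u0 v0; have [a [b [d C0]]] := vertex_cell v0.
have [op0 Ma Mb Md H0] := C0.
move: u0; apply: (@walk_ind (bary a b d)) => v IH.
have AD v' e p q : dart v v' e p q -> A v = A v'.
  by move=> /dart_ends[[E1 E2]|[E1 E2]]; have := HA e; rewrite E1 E2.
have [p [q [r C]]] := vertex_cell v; have C2 := cell_rot C; have C3 := cell_rot C2.
have oE f g : ori_real f g (bary a b d) =
    (1 / 3) * ((ori f g a)%:~R + (ori f g b)%:~R + (ori f g d)%:~R).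
  by rewrite -!ori_real_toR /ori_real /bary /dot !cZE !cE; field.
case: (pselect (exists p q r, cell (pos v) p q r /\ ori_real p q (bary a b d) < 0)).
  move=> [p' [q' [r' [C' o']]]].
  have [s Lss os] : exists2 s, L s & ori p' q' s < 0.
    apply: contrapT => /forall2NP N; move: o'; rewrite oE.
    have h t : M (pos v0) t -> 0 <= (ori p' q' t)%:~R :> R.
      by move=> [Lt _]; rewrite ler0z leNgt; case: (N t) => // /negP.
    have := h _ Ma; have := h _ Mb; have := h _ Md; lra.
  have [v' [e D]] := dart_exists C' Lss os.
  by rewrite (AD _ _ _ _ D) (IH _ _ _ _ D o').
move=> N; have H p' q' r' : cell (pos v) p' q' r' -> 0 <= ori_real p' q' (bary a b d).
  by move=> C'; rewrite leNgt; apply/negP => h; apply: N; exists p', q', r'.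
have [op1 Mp Mq Mr _] := C.
pose lp := ori_real q r (bary a b d); pose lq := ori_real r p (bary a b d); pose lr := ori_real p q (bary a b d).
have o1R : (ori p q r)%:~R = 1 :> R by rewrite op1.
have lE : lp + lq + lr = 1.
  rewrite /lp /lq /lr !oE.
  have Ea := ori_sum p q r a; have Eb := ori_sum p q r b; have Ed := ori_sum p q r d.
  have h (i j k : int) : i + j + k = 1 -> (i%:~R + j%:~R + k%:~R : R) = 1 by rewrite -!intrD => ->.
  rewrite op1 in Ea Eb Ed; have := h _ _ _ Ea; have := h _ _ _ Eb; have := h _ _ _ Ed.
  lra.
have hx t : (ori q r t)%:~R * (cx p)%:~R + (ori r p t)%:~R * (cx q)%:~R + (ori p q t)%:~R * (cx r)%:~R = (cx t)%:~R :> R.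
  by have [E _] := ori_bary p q r t; rewrite op1 mul1r in E; rewrite -!intrM -!intrD E.
have hy t : (ori q r t)%:~R * (cy p)%:~R + (ori r p t)%:~R * (cy q)%:~R + (ori p q t)%:~R * (cy r)%:~R = (cy t)%:~R :> R.
  by have [_ E] := ori_bary p q r t; rewrite op1 mul1r in E; rewrite -!intrM -!intrD E.
have t0 : 0 < 1 / 3 :> R by lra.
have [|||||||||||||||Ma' Mb' Md'] := @cross3 (pos v) (pos v0) p q r a b d lp lq lr (1 / 3) (1 / 3) (1 / 3);
  rewrite ?(ltW t0) //; [exact: H C2|exact: H C3|exact: H C| | | |].
- by rewrite lE; field.
- rewrite /lp /lq /lr !oE.
  have := hx a; have := hx b; have := hx d; lra.
- rewrite /lp /lq /lr !oE.
  have := hy a; have := hy b; have := hy d; lra.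
have {}Ma' := Ma' t0; have {}Mb' := Mb' t0; have {}Md' := Md' t0.
have [n1 n2 n3] := cell_neq C0.
have [_ Sub] := cell_perm C Ma' Mb' Md' n1 n2 n3.
have C0' : cell (pos v) a b d by split.
by have [/pos_inj -> _] := side_unique C0' C0.
Qed.

(* Around a lattice point p of a triangle, [nbr] and [nbr'] are the other two vertices
   in counterclockwise order, and [next] crosses the side from p to [nbr']. *)
Definition nbr p v : pt := xget p [set b | exists d, cell (pos v) p b d].
Definition nbr' p v : pt := xget p [set d | cell (pos v) p (nbr p v) d].

Lemma nbrP p v : M (pos v) p -> cell (pos v) p (nbr p v) (nbr' p v).
Proof.
move=> Mp; rewrite /nbr'; apply: (xgetPex _ (P := [set d | cell (pos v) p (nbr p v) d])).
apply: (xgetPex _ (P := [set b | exists d, cell (pos v) p b d])).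
have [a [b [d C]]] := vertex_cell v; have [_ _ _ _ H] := C.
by have [->|->|->] := H _ Mp; [exists b, d|exists d, a; exact: cell_rot|exists a, b; exact/cell_rot/cell_rot].
Qed.

Lemma nbrE p v b d : cell (pos v) p b d -> nbr p v = b /\ nbr' p v = d.
Proof. by move=> C; have [_ Mp _ _ _] := C; apply: cell_inj3 (nbrP Mp) C. Qed.

Lemma inner_side p d : inn p -> p <> d -> exists2 s, L s & ori d p s < 0.
Proof.
move=> [_ Hp] pd; have [|s Lss lt] := Hp (rotv p d).
  move=> E; apply: pd; have := congr1 (@cx R) E; have := congr1 (@cy R) E.
  rewrite /rotv cx_mk cy_mk /cx /cy !mxE -!intrN => /eqP; rewrite intr_eq0 => /eqP e1.
  move=> /eqP; rewrite intr_eq0 => /eqP e2.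
  by apply: col2P; rewrite /cx /cy; lia.
exists s => //; rewrite -(ltrz0 R) -pairing_rotv.
have : pairing p (rotv p d) - pairing d (rotv p d) = 0.
  by rewrite pairing_rotv /ori (_ : _ - _ = 0 :> int) //; ring.
lra.
Qed.

Lemma next_ex p v : inn p -> M (pos v) p -> exists v' e, dart v v' e (nbr' p v) p.
Proof.
move=> Ip Mp; have C := cell_rot (cell_rot (nbrP Mp)).
have [n1 _ _] := cell_neq C; have [s Lss os] := inner_side Ip (nesym n1).
exact: dart_exists C Lss os.
Qed.

Definition next p v : V := xget v [set v' | M (pos v) p /\ exists e, dart v v' e (nbr' p v) p].

(** Off the triangles at [p] the default makes [next] the identity, so it is a permutation of all
    vertices and sums can be reindexed along it. *)
Lemma next_out p v : ~ M (pos v) p -> next p v = v.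
Proof. by move=> N; rewrite /next; case: xgetP => // x _ [/N]. Qed.

Lemma nextP p v : inn p -> M (pos v) p -> exists e, dart v (next p v) e (nbr' p v) p.
Proof.
move=> Ip Mp; have [v' [e D]] := next_ex Ip Mp.
suff [] : [set v' | M (pos v) p /\ exists e, dart v v' e (nbr' p v) p] (next p v) by [].
by apply: xgetPex; exists v'; split=> //; exists e.
Qed.

Lemma next_cell p v : inn p -> M (pos v) p ->
  M (pos (next p v)) p /\ nbr p (next p v) = nbr' p v.
Proof.
move=> Ip Mp; have [e [_ [s C] _ _]] := nextP Ip Mp.
by have [_ M' _ _ _] := C; have [-> _] := nbrE C.
Qed.

Local Opaque next nbr nbr'.

Lemma next_inj p : inn p -> injective (next p).
Proof.
move=> Ip v u E.
have [Mv|Nv] := pselect (M (pos v) p); have [Mu|Nu] := pselect (M (pos u) p).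
- have [_ Ev] := next_cell Ip Mv; have [_ Eu] := next_cell Ip Mu.
  have Cv := cell_rot (cell_rot (nbrP Mv)); have Cu := cell_rot (cell_rot (nbrP Mu)).
  by rewrite -Eu -E Ev in Cu; have [/pos_inj] := side_unique Cv Cu.
- by case: (Nu); rewrite -(next_out Nu) -E; have [] := next_cell Ip Mv.
- by case: (Nv); rewrite -(next_out Nv) E; have [] := next_cell Ip Mu.
- by rewrite -(next_out Nv) E next_out.
Qed.

Lemma dart_next v v' e p q : dart v v' e q p -> inn p ->
  [/\ M (pos v) p, nbr' p v = q & next p v = v'].
Proof.
move=> D Ip; have [[r C] _ _ _] := D; have [_ _ Mp _ _] := C.
have [_ Eq] := nbrE (cell_rot C); split=> //.
by have [e' D'] := nextP Ip Mp; rewrite Eq in D'; have [_ ->] := dart_same D D'.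
Qed.

Lemma fan_edges p : inn p -> exists E : V -> edge G,
  forall v, M (pos v) p -> dart v (next p v) (E v) (nbr' p v) p.
Proof.
move=> Ip; have [v0 M0] := lattice_vertex (proj1 Ip); have [e0 _] := nextP Ip M0.
have /choice[E HE] : forall v, exists e, M (pos v) p -> dart v (next p v) e (nbr' p v) p.
  move=> v; have [Mv|Nv] := pselect (M (pos v) p); last by exists e0.
  by have [e D] := nextP Ip Mv; exists e.
by exists E.
Qed.

(** Along a permutation the changes of the indicator of [W] add up to 0, so no change occurs
    alone. *)
Lemma fan_parity p (W : pred V) v : inn p -> W v != W (next p v) ->
  exists u, [/\ M (pos u) p, u <> v & W u != W (next p u)].
Proof.
move=> Ip sv; apply: contrapT => N.
have H u : u != v -> (W (next p u) : nat)%:Z - (W u : nat)%:Z = 0.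
  move=> uv; case: (pselect (M (pos u) p)) => Mu; last by rewrite next_out ?subrr.
  case: (eqVneq (W u) (W (next p u))) => [->|ne]; first by rewrite subrr.
  by case: N; exists u; split=> //; apply/eqP.
have : \sum_u ((W (next p u) : nat)%:Z - (W u : nat)%:Z) = 0.
  by rewrite big_split /= sumrN [X in _ - X](reindex_inj (next_inj Ip)) /= subrr.
rewrite (bigD1 v) //= big1 ?addr0; last by move=> u /H.
by move: sv; case: (W v); case: (W (next p v)).
Qed.

(** * Cuts and the cycles around interior points *)

Definition separated (W : pred V) e := W (ends e).1 != W (ends e).2.

Lemma dart_separated v v' e p q W : dart v v' e p q -> separated W e = (W v != W v').
Proof. by rewrite /separated => /dart_ends[[-> ->]|[-> ->]]; rewrite 1?eq_sym // eq_sym. Qed.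

Lemma separated_twin v v' e p q W : dart v v' e p q -> inn p -> separated W e ->
  exists e' u u' q', [/\ dart u u' e' p q', e' != e & separated W e'].
Proof.
move=> /dart_sym D Ip; rewrite (dart_separated W D) => sv.
have [Mv Eq Ev] := dart_next D Ip; rewrite -Ev in sv.
have [u [Mu uv su]] := fan_parity Ip sv; have [e' D'] := nextP Ip Mu.
exists e', (next p u), u, (nbr' p u); split; first exact: dart_sym.
  apply/eqP => E; subst e'; have [[/uv //]|[E1 E2 E3 E4]] := dart_dual D D'.
  by move: D' (nbrP Mu); rewrite E3 => -[[r C'] _ _ _] C; have [_ _] := cell_neq C.
by rewrite (dart_separated W D').
Qed.

Lemma sum2_le (X : edge G -> nat) e1 e2 : e1 != e2 -> (X e1 + X e2 <= \sum_e X e)%N.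
Proof. by move=> n; rewrite (bigD1 e1) //= (bigD1 e2) ?(eq_sym e2) //= addnA leq_addr. Qed.

Lemma sum3_le (X : edge G -> nat) e1 e2 e3 : e1 != e2 -> e1 != e3 -> e2 != e3 ->
  (X e1 + X e2 + X e3 <= \sum_e X e)%N.
Proof.
move=> n12 n13 n23; rewrite (bigD1 e1) //= (bigD1 e2) ?(eq_sym e2) //= (bigD1 e3) /=.
  by rewrite !addnA leq_addr.
by rewrite (eq_sym e3 e1) n13 (eq_sym e3) n23.
Qed.

Lemma cut2 W (X : edge G -> nat) v v' e p q : (forall e, separated W e -> (0 < X e)%N) ->
  dart v v' e p q -> inn p -> separated W e -> (2 <= \sum_e X e)%N.
Proof.
move=> HX D Ip sep; have [e' [u [u' [q' [D' ne sep']]]]] := separated_twin D Ip sep.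
by have := HX e sep; have := HX e' sep'; have := sum2_le X ne; lia.
Qed.

(** The edge lies on the cycles of both [p] and [q]. Each cycle is crossed once more, and the two
    cycles share no other edge. *)
Lemma cut3 W (X : edge G -> nat) v v' e p q : (forall e, separated W e -> (0 < X e)%N) ->
  dart v v' e p q -> inn p -> inn q -> separated W e -> (3 <= \sum_e X e)%N.
Proof.
move=> HX D Ip Iq sep; have [e' [u [u' [q' [D' ne sep']]]]] := separated_twin D Ip sep.
have [e2 [w [w' [p' [D2 ne2 sep2]]]]] := separated_twin (dart_sym D) Iq sep.
have ne3 : e' != e2.
  apply/eqP => E; subst e2; have [[r C] _ _ _] := D; have [n1 _ _] := cell_neq C.
  have [[E1 E2 E3 E4]|[E1 E2 E3 E4]] := dart_dual D' D2; first by case: n1.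
  by subst; have [? ? E] := dart_same D D'; rewrite E eqxx in ne.
have := HX e sep; have := HX e' sep'; have := HX e2 sep2.
by have := sum3_le X ne3 ne ne2; lia.
Qed.

Lemma level_eq v v' e p q (fv : V -> R) : dart v v' e p q ->
  (forall tau : R, ~~ separated (fun x => tau < fv x) e) -> fv v = fv v'.
Proof.
move=> D N; apply/eqP; rewrite eq_le; apply/andP; split; rewrite leNgt; apply/negP => lt.
  by have := N (fv v'); rewrite (dart_separated _ D) ltxx lt.
by have := N (fv v); rewrite (dart_separated _ D) ltxx lt.
Qed.

(** With one chip the slopes across a level total at most 1, while a level separating [v] from [v']
    costs 2 on the cycle. So the two are level, and then the chip gained at [v'] needs a crossing
    although no chip lies above. *)
Lemma no_single_move v v' e p q : dart v v' e p q -> inn p -> ~ moves [:: inl v] [:: inl v'].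
Proof.
move=> D Ip [fv [f [H Hd]]].
have E : fv v = fv v'.
  apply: (level_eq D) => tau; apply/negP => sep; have [X [EX HX _]] := level_cut H Hd tau.
  have := cut2 HX D Ip sep; move: EX => /=; lia.
have [X [EX HX HX']] := level_cut H Hd (fv v').
have [|e' [_ X0 _]] := HX' v' _ erefl.
  by rewrite /= eqxx addn0; case: eqP => // -[/(dart_neq D)].
have : (0 < \sum_e X e)%N by rewrite (bigD1 e') //= addn_gt0 X0.
by move: EX; rewrite /= E ltxx; lia.
Qed.

Lemma no_pencil1 p : inn p -> ~ pencil G 1.
Proof.
move=> Ip [s [s1 Hs]]; have [v Mv] := lattice_vertex (proj1 Ip).
have [e D] := nextP Ip Mv.
have K x : moves s [:: x].
  have [s' [E xs' m]] := Hs x; case: s' E xs' m => [|y []] //= _; by rewrite inE => /eqP ->.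
apply: (no_single_move (dart_sym D) Ip).
exact: moves_trans (moves_sym (K _)) (K _).
Qed.

(** * Chords between boundary points *)

Lemma pairing_affine (i j k n : int) (a b d x : pt) (u : 'cV[R]_2) :
  i * cx a + j * cx b + k * cx d = n * cx x -> i * cy a + j * cy b + k * cy d = n * cy x ->
  i%:~R * pairing a u + j%:~R * pairing b u + k%:~R * pairing d u = n%:~R * pairing x u.
Proof.
move=> Ex Ey.
have ER (f g : int) : f = g -> f%:~R = g%:~R :> R by move=> ->.
have {}Ex := ER _ _ Ex; have {}Ey := ER _ _ Ey.
rewrite !(intrD, intrM) in Ex Ey; rewrite !pairingE.
transitivity ((i%:~R * (cx a)%:~R + j%:~R * (cx b)%:~R + k%:~R * (cx d)%:~R) * cx u +
    (i%:~R * (cy a)%:~R + j%:~R * (cy b)%:~R + k%:~R * (cy d)%:~R) * cy u); first by ring.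
by rewrite Ex Ey; ring.
Qed.

Lemma boundary_inner_supp b : L b -> ~ inn b -> exists2 u : 'cV[R]_2,
  (forall s, L s -> 0 <= pairing s u - pairing b u) &
  forall r, inn r -> 0 < pairing r u - pairing b u.
Proof.
move=> Lb nb; have [u u0 Hu] := boundary_supp Lb nb; exists u => [s Lss|r [Lr Hr]].
  by rewrite subr_ge0; exact: Hu.
by have [s Lss lt] := Hr u u0; have := Hu s Lss; lra.
Qed.

Lemma int_pos_factor (k : int) (x : R) : 0 <= x -> 0 < k%:~R * x -> 0 < k.
Proof.
move=> x0 h; rewrite ltNge; apply/negP; rewrite -(lerz0 R) => k0.
by have := mulr_le0_ge0 k0 x0; rewrite leNgt h.
Qed.

Lemma three_weights (y i j : int) (p b b' r : R) : y + i + j = 1 -> y < 0 ->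
  y%:~R * p + i%:~R * b + j%:~R * b' = r ->
  0 < p - b -> 0 <= b' - b -> 0 <= r - b -> 0 < j.
Proof.
move=> S y0 E hp hb hr; apply: (int_pos_factor hb).
have {}S : y%:~R + i%:~R + j%:~R = 1 :> R by rewrite -!intrD S.
have {}y0 : y%:~R < 0 :> R by rewrite ltrz0.
have : y%:~R * (p - b) < 0 by rewrite nmulr_rlt0.
have -> : j%:~R * (b' - b) = r - b - y%:~R * (p - b).
  rewrite -E; apply/eqP; rewrite -subr_eq0; apply/eqP.
  transitivity (b * (1 - (y%:~R + i%:~R + j%:~R))); first by ring.
  by rewrite S subrr mulr0.
lra.
Qed.

(** Supporting lines at [b] and [b'] confine the lattice points beyond the chord to the open cone at
    [p] spanned by [b] and [b']. *)
Lemma beyond_chord w p b b' r : cell w p b b' -> ~ inn b -> ~ inn b' -> inn p ->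
  L r -> ori b b' r < 0 -> 0 < ori p b r /\ 0 < ori b' p r.
Proof.
move=> C nb nb' Ip Lr y0; have [op1 Mp Mb Mb' _] := C.
have [Ex Ey] := ori_bary p b b' r; have S := ori_sum p b b' r; rewrite op1 in Ex Ey S.
split.
  have [u Hu Hu'] := boundary_inner_supp (proj1 Mb) nb.
  have A := pairing_affine u Ex Ey; rewrite mul1r in A.
  apply: (three_weights _ y0 A (Hu' _ Ip) (Hu _ (proj1 Mb')) (Hu _ Lr)); lia.
have [u Hu Hu'] := boundary_inner_supp (proj1 Mb') nb'.
have A := pairing_affine u Ex Ey; rewrite mul1r addrAC in A.
by apply: (three_weights _ y0 A (Hu' _ Ip) (Hu _ (proj1 Mb)) (Hu _ Lr)); lia.
Qed.

(** The apex has height -1 over the chord, so its barycentric coordinates at [b] and [b'] are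
    positive integers with sum 2, hence both 1. *)
Lemma chord_apex w w' p b b' s : cell w p b b' -> cell w' b' b s ->
  ~ inn b -> ~ inn b' -> inn p -> s = b + b' - p.
Proof.
move=> C C' nb nb' Ip; have [op1 _ _ _ _] := C; have [op1' _ _ Ms _] := C'.
have y1 : ori b b' s = -1 by rewrite -(opprK (ori b b' s)) -ori_swap op1'.
have [|i0 j0] := beyond_chord C nb nb' Ip (proj1 Ms); first by rewrite y1.
have S := ori_sum p b b' s; rewrite op1 y1 in S.
have [i1 j1] : ori p b s = 1 /\ ori b' p s = 1 by lia.
have [Ex Ey] := ori_bary p b b' s; rewrite op1 y1 i1 j1 in Ex Ey.
by apply: col2P; rewrite !cE -[LHS]mul1r -?Ex -?Ey; ring.
Qed.

Lemma chord_inner w p b b' r : cell w p b b' -> ~ inn b -> ~ inn b' -> inn p ->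
  inn r -> ori b b' r < 0 -> inn (b + b' - p).
Proof.
move=> C nb nb' Ip Ir y0; have [op1 Mp Mb Mb' _] := C.
have [i0 j0] := beyond_chord C nb nb' Ip (proj1 Ir) y0.
have S := ori_sum p b b' r; rewrite op1 in S.
have [Ex Ey] := ori_bary p b b' r; rewrite op1 in Ex Ey.
(* The two weights are exchanged on purpose: added to the coordinates of [r], they give [b] and [b']
   the same coefficient [ori p b r + ori b' p r - 1], opposite to that of [p]. *)
apply: (@inn_conv3 _ _ HP _ r b b' 1 (ori p b r - 1) (ori b' p r - 1) Ir (proj1 Mb) (proj1 Mb')) => //; try lia.
  have Eo : ori b b' r = 1 - ori p b r - ori b' p r by lia.
  by rewrite -Ex !cE Eo; ring.
have Eo : ori b b' r = 1 - ori p b r - ori b' p r by lia.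
by rewrite -Ey !cE Eo; ring.
Qed.

Lemma kernel2 (a b e f x y : R) : a * x + b * y = 0 -> e * x + f * y = 0 -> a * f - b * e != 0 ->
  x = 0 /\ y = 0.
Proof.
move=> h1 h2 d; split; apply: (mulfI d); rewrite mulr0.
  transitivity (f * (a * x + b * y) - b * (e * x + f * y)); first by ring.
  by rewrite h1 h2; ring.
transitivity (a * (e * x + f * y) - e * (a * x + b * y)); first by ring.
by rewrite h1 h2; ring.
Qed.

(** If a supporting functional at [b] were constant along the chord, the points [t1] and [t2] on
    both sides would make it constant everywhere. *)
Lemma chord_supp b b' t1 t2 : L b -> ~ inn b -> L b' -> L t1 -> L t2 ->
  ori b b' t1 < 0 -> 0 < ori b b' t2 -> exists2 u : 'cV[R]_2,
  (forall s, L s -> 0 <= pairing s u - pairing b u) & 0 < pairing b' u - pairing b u.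
Proof.
move=> Lb nb Lb' Lt1 Lt2 h1 h2; have [u u0 Hu] := boundary_supp Lb nb.
have Hu' s : L s -> 0 <= pairing s u - pairing b u by move=> /Hu; lra.
exists u => //; rewrite lt_neqAle (Hu' _ Lb') andbT eq_sym; apply/eqP => E; apply: u0.
have I : (ori b b' t2)%:~R * (pairing t1 u - pairing b u) + (- ori b b' t1)%:~R * (pairing t2 u - pairing b u)
   = (ori b t1 t2)%:~R * (pairing b' u - pairing b u).
  by rewrite !pairingE /ori !(intrD, intrM, intrN); ring.
rewrite E mulr0 in I.
have p2 : 0 < (ori b b' t2)%:~R :> R by rewrite ltr0z.
have p1 : 0 < (- ori b b' t1)%:~R :> R by rewrite ltr0z oppr_gt0.
have E2 : pairing t2 u - pairing b u = 0.
  have a1 := mulr_ge0 (ltW p2) (Hu' _ Lt1); have a2 := mulr_ge0 (ltW p1) (Hu' _ Lt2).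
  have : (- ori b b' t1)%:~R * (pairing t2 u - pairing b u) = 0 by lra.
  by move/eqP; rewrite mulf_eq0 (negbTE (lt0r_neq0 p1)) => /eqP.
have [|||e1 e2] := @kernel2 (cx b' - cx b)%:~R (cy b' - cy b)%:~R (cx t2 - cx b)%:~R (cy t2 - cy b)%:~R (cx u) (cy u).
- by rewrite -[RHS]E !pairingE !(intrD, intrN); ring.
- by rewrite -[RHS]E2 !pairingE !(intrD, intrN); ring.
- by rewrite -!intrM -intrN -intrD intr_eq0; apply: lt0r_neq0.
by apply: col2P; rewrite ?e1 ?e2 /cx /cy mxE.
Qed.

(** The segment from [t1] to [t2] meets the line of the chord on the ray from [b] through [b'],
    because a supporting functional at [b] is positive at [b']. *)
Lemma chord_between b b' t1 t2 : L b -> ~ inn b -> L b' -> L t1 -> L t2 ->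
  ori b b' t1 < 0 -> 0 < ori b b' t2 -> 0 <= ori b t1 t2.
Proof.
move=> Lb nb Lb' Lt1 Lt2 h1 h2; have [u Hu pos_u] := chord_supp Lb nb Lb' Lt1 Lt2 h1 h2.
have I : (ori b b' t2)%:~R * (pairing t1 u - pairing b u) + (- ori b b' t1)%:~R * (pairing t2 u - pairing b u)
   = (ori b t1 t2)%:~R * (pairing b' u - pairing b u).
  by rewrite !pairingE /ori !(intrD, intrM, intrN); ring.
rewrite -(ler0z R) -(pmulr_lge0 _ pos_u) -I.
by rewrite addr_ge0 // mulr_ge0 ?Hu // ler0z; lia.
Qed.

(** A triangle with vertices on both sides would meet the chord between [b] and [b']. By [cross3]
    its vertex [t1] would then belong to the triangle [p b b'], which has no vertex beyond the
    chord. *)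
Lemma chord_side v v0 p b b' : cell (pos v) p b b' -> ~ inn b -> ~ inn b' ->
  (forall t, M (pos v0) t -> 0 <= ori b b' t) \/ (forall t, M (pos v0) t -> ori b b' t <= 0).
Proof.
move=> C nb nb'; have [op1 Mp Mb Mb' H] := C.
case: (pselect (exists2 t1, M (pos v0) t1 & ori b b' t1 < 0)) => [[t1 Mt1 o1n]|N]; last first.
  by left=> t Mt; rewrite leNgt; apply/negP => h; apply: N; exists t.
right=> t2 Mt2; rewrite leNgt; apply/negP => o2p.
have [Lt1 Lt2] : L t1 /\ L t2 by split; [case: Mt1|case: Mt2].
have [Lb Lb'] : L b /\ L b' by split; [case: Mb|case: Mb'].
have k1 := chord_between Lb nb Lb' Lt1 Lt2 o1n o2p.
have k2 : 0 <= ori b' t2 t1 by apply: (@chord_between b' b t2 t1) => //; rewrite ori_swap; lia.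
have S : ori b' t2 t1 + ori b t1 t2 = ori b b' t2 - ori b b' t1 by rewrite /ori; ring.
have [|||||||||] := @cross3 (pos v) (pos v0) b b' b' t1 t2 t2
  (ori b' t2 t1)%:~R (ori b t1 t2)%:~R 0 (ori b b' t2)%:~R (- ori b b' t1)%:~R 0 Mb Mb' Mb' Mt1 Mt2 Mt2; rewrite ?ler0z //; try lia.
- by rewrite !addr0 -!intrD S.
- by rewrite !mul0r !addr0 -!intrM -!intrD /ori; congr (_%:~R); ring.
- by rewrite !mul0r !addr0 -!intrM -!intrD /ori; congr (_%:~R); ring.
move=> /(_ _)/H; rewrite ltr0z => /(_ o2p) E _ _.
by move: o1n; case: E => ->; [rewrite ori_rot op1| |]; rewrite /ori; lia.
Qed.

Definition chord_left b b' v : bool := `[< forall t, M (pos v) t -> 0 <= ori b b' t >].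

Lemma chord_on v p b b' s t1 t2 : cell (pos v) p b b' -> ~ inn b -> ~ inn b' -> L s -> ori b b' s = 0 ->
  L t1 -> L t2 -> ori b b' t1 < 0 -> 0 < ori b b' t2 -> s = b \/ s = b'.
Proof.
move=> C nb nb' Lss os Lt1 Lt2 h1 h2; have [op1 Mp Mb Mb' H] := C.
have [Lb Lb'] : L b /\ L b' by split; [case: Mb|case: Mb'].
have [Ex Ey] := ori_bary p b b' s; have S := ori_sum p b b' s; rewrite op1 os in Ex Ey S.
have k0 : 0 <= ori p b s.
  have [u Hu pos_u] := chord_supp Lb nb Lb' Lt1 Lt2 h1 h2.
  have A := pairing_affine u Ex Ey; have {}S : (ori p b s)%:~R + (ori b' p s)%:~R = 1 :> R by rewrite -intrD -[ori p b s]addr0 S.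
  rewrite -(ler0z R) -(pmulr_lge0 _ pos_u); have := Hu _ Lss; rewrite mul1r mul0r add0r in A.
  have -> : (ori p b s)%:~R * (pairing b' u - pairing b u) =
     (ori b' p s)%:~R * pairing b u + (ori p b s)%:~R * pairing b' u - ((ori p b s)%:~R + (ori b' p s)%:~R) * pairing b u by ring.
  by rewrite S A mul1r.
have k1 : 0 <= ori b' p s.
  have [u Hu pos_u] : exists2 u : 'cV[R]_2, (forall s, L s -> 0 <= pairing s u - pairing b' u) & 0 < pairing b u - pairing b' u.
    by apply: (@chord_supp b' b t2 t1) => //; rewrite ori_swap; lia.
  have A := pairing_affine u Ex Ey; have {}S : (ori p b s)%:~R + (ori b' p s)%:~R = 1 :> R by rewrite -intrD -[ori p b s]addr0 S.
  rewrite -(ler0z R) -(pmulr_lge0 _ pos_u); have := Hu _ Lss; rewrite mul1r mul0r add0r in A.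
  have -> : (ori b' p s)%:~R * (pairing b u - pairing b' u) =
     (ori b' p s)%:~R * pairing b u + (ori p b s)%:~R * pairing b' u - ((ori p b s)%:~R + (ori b' p s)%:~R) * pairing b' u by ring.
  by rewrite S A mul1r.
have [[e1 e2]|[e1 e2]] : (ori p b s = 0 /\ ori b' p s = 1) \/ (ori p b s = 1 /\ ori b' p s = 0) by lia.
  by left; rewrite e1 e2 in Ex Ey; apply: col2P; lia.
by right; rewrite e1 e2 in Ex Ey; apply: col2P; lia.
Qed.

Lemma parallel_ori b b' r s t : b <> b' -> ori b b' r = ori b b' s -> ori b b' r = ori b b' t -> ori r s t = 0.
Proof.
move=> bb hs ht.
have Ix : (cx b' - cx b) * ori r s t = 0.
  have -> : (cx b' - cx b) * ori r s t = (cx s - cx r) * (ori b b' t - ori b b' r) - (cx t - cx r) * (ori b b' s - ori b b' r).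
    by rewrite /ori; ring.
  by rewrite -hs -ht; ring.
have Iy : (cy b' - cy b) * ori r s t = 0.
  have -> : (cy b' - cy b) * ori r s t = (cy s - cy r) * (ori b b' t - ori b b' r) - (cy t - cy r) * (ori b b' s - ori b b' r).
    by rewrite /ori; ring.
  by rewrite -hs -ht; ring.
apply: contrapT => n; apply: bb; apply: col2P.
  by move/eqP: Ix; rewrite mulf_eq0 => /orP[/eqP|/eqP//]; lia.
by move/eqP: Iy; rewrite mulf_eq0 => /orP[/eqP|/eqP//]; lia.
Qed.

Lemma collinear_ori b b' r s t : b <> b' -> ori b b' r = 0 -> ori b b' s = 0 -> ori b b' t = 0 -> ori r s t = 0.
Proof. by move=> bb hr hs ht; apply: (parallel_ori bb); rewrite hr. Qed.

(** An edge whose triangles lie on different sides is dual to a segment on the line of the chord.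
    The only lattice points there are [b] and [b'], so the edge is [e]. *)
Lemma chord_bridge v v' e p b b' : cell (pos v) p b b' -> ~ inn b -> ~ inn b' -> dart v v' e b b' ->
  chord_left b b' v /\ ~~ chord_left b b' v' /\
  forall e0, e0 != e -> chord_left b b' (ends e0).1 = chord_left b b' (ends e0).2.
Proof.
move=> C nb nb' D; have [op1 Mp Mb Mb' H] := C; have [_ [s C'] _ _] := D.
have [op1' _ _ Ms' _] := C'; have [bb _ _] := cell_neq (cell_rot C).
split; [|split].
- apply/asboolP => t /H[]->; last first; by [rewrite ori_rot op1|rewrite /ori; lia].
- by apply/asboolPn => /(_ _ Ms'); rewrite ori_swap in op1'; lia.
move=> e0; apply: contraNeq => sep.
have [x [y [a [d [D0 lx ly]]]]] : exists x y a d, [/\ dart x y e0 a d, chord_left b b' x & ~~ chord_left b b' y].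
  have [a [d D0]] := dart_edge e0.
  move: sep; case lx: (chord_left b b' (ends e0).1); case ly: (chord_left b b' (ends e0).2) => // _.
    by exists (ends e0).1, (ends e0).2, a, d; split; rewrite ?lx ?ly.
  by exists (ends e0).2, (ends e0).1, d, a; split; rewrite ?lx ?ly //; exact: dart_sym.
have [[r C1] [r' C1'] _ _] := D0.
move/asboolP in lx.
have {}ly : forall t, M (pos y) t -> ori b b' t <= 0.
  by case: (chord_side y C nb nb') => // /asboolP; rewrite -/(chord_left b b' y) (negbTE ly).
have [oC1 M1 M2 M3 _] := C1; have [oC1' M1' M2' M3' _] := C1'.
have oa : ori b b' a = 0 by have := lx _ M1; have := ly _ M2'; lia.
have od : ori b b' d = 0 by have := lx _ M2; have := ly _ M1'; lia.
have r0 : 0 < ori b b' r.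
  rewrite lt_neqAle lx // andbT; apply/eqP => r0.
  by have := collinear_ori bb oa od (esym r0); rewrite oC1.
have r0' : ori b b' r' < 0.
  rewrite lt_neqAle ly // andbT; apply/eqP => r0'.
  by have := collinear_ori bb od oa r0'; rewrite oC1'.
have [Lr Lr'] : L r /\ L r' by split; [case: M3|case: M3'].
have Ea := chord_on C nb nb' (proj1 M1) oa Lr' Lr r0' r0.
have Ed := chord_on C nb nb' (proj1 M2) od Lr' Lr r0' r0.
have [n1 _ _] := cell_neq C1; apply/eqP.
case: Ea => Ea; case: Ed => Ed; rewrite Ea Ed in D0 n1 => //.
  by have [_ _] := dart_same D0 D.
by have [_ _] := dart_same (dart_sym D0) D.
Qed.

Lemma moves_cancel (s s' r : seq (gpoint G)) : moves (s ++ r) (s' ++ r) -> moves s s'.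
Proof.
move=> [fv [f [H Hd]]]; exists fv, f; split=> // x.
by have := Hd x; rewrite !count_cat; lia.
Qed.

Lemma moves_swap (x y : gpoint G) : moves [:: x; y] [:: y; x].
Proof. by apply: perm_moves; apply/permP => a /=; lia. Qed.

(** * Retraction onto one side of a bridge *)

Section Retract.
Variables (A : pred V) (e0 : edge G) (a : V).
Hypotheses (HA : forall e, e != e0 -> A (ends e).1 = A (ends e).2)
  (H0 : (ends e0).1 = a \/ (ends e0).2 = a) (Aa : A a) (H0' : A (ends e0).1 != A (ends e0).2).

Definition on_side (x : gpoint G) := match x with inl v => A v
  | inr et => A (ends (val et).1).1 && A (ends (val et).1).2 end.

Definition retract x := if on_side x then x else inl a.

(** The bridge and all that lies beyond it are collapsed onto its end [a]; by [moves_cut_vertex]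
    linear equivalence survives. *)
Lemma moves_retract (s s' : seq (gpoint G)) : moves s s' -> moves (map retract s) (map retract s').
Proof.
move=> m; have sz := moves_sizeE m.
pose EA e := A (ends e).1 && A (ends e).2.
have h1 e : EA e -> A (ends e).1 && A (ends e).2 by [].
have h2 e : ~~ EA e -> (A (ends e).1 -> (ends e).1 = a) /\ (A (ends e).2 -> (ends e).2 = a).
  rewrite /EA; have [E|/HA E] := eqVneq e e0; last by rewrite E andbb => /negbTE ->.
  by subst e; case: H0 H0' Aa => <-; case: (A (ends e0).1); case: (A (ends e0).2).
have [gv [g [Hg Eg]]] := moves_cut_vertex Aa h1 h2 m.
exists gv, g; split=> // x; rewrite Eg -!/(on_side _).
have C (t : seq (gpoint G)) : count_mem x (map retract t) =
   ((if on_side x then count_mem x t else 0) + (if x == inl a then size t - count on_side t else 0))%N.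
  elim: t => [|y t IH] /=; first by case: ifP; case: ifP.
  rewrite IH {1}/retract; case: ifPn => Uy.
    case: (eqVneq y x) => [E|ne].
      by rewrite -E Uy /=; have := count_size on_side t; case: ifP => _; lia.
    by have := count_size on_side t; case: ifP => _; case: ifP => _; lia.
  have Ne : on_side x -> (y == x) = false.
    by case: (eqVneq y x) => // E Ux; rewrite -E (negbTE Uy) in Ux.
  rewrite (eq_sym (inl a)).
  have := count_size on_side t; case: (boolP (on_side x)) => Ux; rewrite ?(Ne Ux); case: (x == inl a) => /=; lia.
rewrite !C; have c1 := count_size on_side s; have c2 := count_size on_side s'.
have UE (t : seq (gpoint G)) : count (fun x => match x with inl v => A v | inr et => EA (val et).1 end) t = count on_side t by [].
rewrite !UE; by case: ifP => _; case: ifP => _; lia.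
Qed.

(** If [y] is collected at [a], cancelling [a] leaves a single chip moving from [a] to [x], which is
    excluded. Otherwise [y] is fixed by the retraction, and the retracted equivalence links
    [[:: inl x; y]] to the double point. *)
Lemma side_double (s1 : seq (gpoint G)) x (y : gpoint G) : A x -> ~ moves [:: inl a] [:: inl x] ->
  map retract s1 = [:: inl a; inl a] -> moves s1 [:: inl x; y] -> moves s1 [:: inl a; inl a].
Proof.
move=> Ax nm E1 m; have := moves_retract m; rewrite E1 /= /retract /= Ax.
case: ifP => Uy m'; first exact: moves_trans m (moves_sym m').
by case: nm; exact: (@moves_cancel [:: inl a] [:: inl x] [:: inl a]).
Qed.

End Retract.

(** * Divisors of degree 2 forced into the pencil *)

Section Class.
Variable s : seq (gpoint G).
Hypothesis HK : forall x, exists s' : seq (gpoint G), [/\ size s' = 2%N, x \in s' & moves s s'].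

Lemma class_through x : exists y, moves s [:: x; y].
Proof.
have [s' [sz xs m]] := HK x; case: s' sz xs m => [|a [|b []]] //= _.
rewrite !inE => /orP[/eqP->|/eqP->] m; first by exists b.
by exists a; apply: moves_trans m (moves_swap _ _).
Qed.

(** Compare the members through the two ends. By [cut3] the ends are level; if the member through
    [v1] lacks [v2], the chip gained there forces a crossing edge at [v2], which lies on a cycle and
    costs 2, while at most one chip is above. *)
Lemma class_inner_edge v1 v2 e p q : dart v1 v2 e p q -> inn p -> inn q ->
  moves s [:: inl v1; inl v2].
Proof.
move=> D Ip Iq; have [y m1] := class_through (inl v1); have [z m2] := class_through (inl v2).
case: (eqVneq y (inl v2)) => [E|ne]; first by rewrite E in m1.
have m := moves_trans (moves_sym m1) m2.
have [fv [f [H Hd]]] := m.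
have E : fv v1 = fv v2.
  apply: (level_eq D) => tau; apply/negP => sep; have [X [EX HX _]] := level_cut H Hd tau.
  have := cut3 HX D Ip Iq sep; move: EX => /=; case: (_ < _); case: (_ < _) => /=; lia.
have [X [EX HX HX']] := level_cut H Hd (fv v2).
have [|e' [inc X0 sepX]] := HX' v2 _ erefl.
  rewrite /= eqxx addn0 (negbTE ne); case: eqP => // -[/(dart_neq D)] //.
have le1 : (\sum_e X e <= 1)%N.
  by move: EX; rewrite /= E ltxx; case: (_ < value _ _ _); lia.
have sep : separated (fun x => fv v2 < fv x) e'.
  case: sepX => // X1; suff : (X e' <= 1)%N by lia.
  by apply: leq_trans le1; rewrite (bigD1 e') //= leq_addr.
have [a [b [u D']]] : exists a b u, dart v2 u e' a b.
  have [a [b D']] := dart_edge e'; case/orP: inc => /eqP E'; rewrite E' in D'.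
    by exists a, b, (ends e').2.
  by exists b, a, (ends e').1; exact: dart_sym.
have [_ [r C] _ _] := D; have [[r' C'] _ _ _] := D'.
have [_ _ _ _ Hv] := C; have [_ Ma Mb _ _] := C'; have [ab _ _] := cell_neq C'.
(* Two vertices of the triangle at [v2] are interior, so every side of it has an interior end. *)
suff [t [w [w' [t' [It Dt]]]]] : exists t (w w' : V) t', inn t /\ dart w w' e' t t'.
  by have := cut2 HX Dt It sep; lia.
have [Ea|Ea|Ea] := Hv _ Ma; subst a; first by exists q, v2, u, b.
  by exists p, v2, u, b.
have [Eb|Eb|Eb] := Hv _ Mb; [subst b|subst b|by case: ab].
  by exists q, u, v2, r; split=> //; exact: dart_sym.
by exists p, u, v2, r; split=> //; exact: dart_sym.
Qed.

(** Let [y] be the partner of [v]. Retraction to a side of the bridge without [y] turns the pair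
    into a double end of the bridge, and [side_double] applies since no single chip moves on the
    cycle there. The two double ends are equivalent along the bridge. *)
Lemma class_chord v p b b' : cell (pos v) p b b' -> inn p -> ~ inn b -> ~ inn b' ->
  inn (b + b' - p) -> moves s [:: inl v; inl v].
Proof.
move=> C Ip nb nb' Iq; have [op1 Mp Mb Mb' _] := C.
have [v' [e D]] : exists v' e, dart v v' e b b'.
  apply: (dart_exists (cell_rot C) (proj1 Iq)).
  have -> : ori b b' (b + b' - p) = - ori p b b' by rewrite /ori !cE; ring.
  by rewrite op1.
have [lv [lv' HA]] := chord_bridge C nb nb' D.
have [_ [q C'] _ _] := D; have Eq := chord_apex C C' nb nb' Ip; rewrite -Eq in Iq.
have sep : chord_left b b' (ends e).1 != chord_left b b' (ends e).2.
  by have [[-> ->]|[-> ->]] := dart_ends D; move: lv lv'; do 2!case: (chord_left _ _ _).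
have inc : ((ends e).1 = v /\ (ends e).2 = v') \/ ((ends e).1 = v' /\ (ends e).2 = v) by exact: dart_ends D.
have Hside z z' f t t' : dart z z' f t t' -> ~ (t = b \/ t = b') \/ ~ (t' = b \/ t' = b') ->
    chord_left b b' z = chord_left b b' z'.
  move=> Df nt; have fe : f != e.
    apply/eqP => E; subst f; have [[_ _ E1 E2]|[_ _ E1 E2]] := dart_dual Df D; subst; tauto.
  by have := HA _ fe; have [[-> ->]|[-> ->]] := dart_ends Df.
have [n1 n2 n3] := cell_neq C; have [n1' n2' n3'] := cell_neq C'.
have Mq : M (pos v') q by case: C'.
have [fe De] := nextP Ip Mp; have [fe' De'] := nextP Iq Mq.
have Aw : chord_left b b' (next p v).
  by rewrite -(Hside _ _ _ _ _ De) //; right=> -[] E; [apply: n1|apply: n3].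
have Aw' : ~~ chord_left b b' (next q v').
  by rewrite -(Hside _ _ _ _ _ De') //; right=> -[] E; [apply: n2'|apply: n3'].
have bridge : moves [:: inl v] [:: inl v'].
  have l0 : 0 < len e <= len e by rewrite len_gt0 lexx.
  have m := moves_bridge HA sep l0; rewrite point_on_len in m.
  by case: inc m => -[-> ->] // /moves_sym.
have [y m1] := class_through (inl v).
have [Uy|nUy] := boolP (on_side (chord_left b b') y).
  have [t m2] := class_through (inl (next q v')).
  have : moves [:: inl v; y] [:: inl v'; inl v'].
    apply: (@side_double (predC (chord_left b b')) e v' _ _ _ _ _ _ t Aw') => //=.
    - by move=> f /HA /= ->.
    - by case: inc; tauto.
    - by move: sep; do 2!case: (chord_left _ _ _).
    - by move=> /moves_sym; exact: no_single_move (dart_sym De') Iq.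
    - rewrite /retract /= lv /=; case: ifP => // Uy'; move: Uy Uy'; clear.
      by case: y => [u|et] /=; [move=> ->|move=> /andP[-> _]].
    - exact: moves_trans (moves_sym m1) m2.
  move=> m3; apply: moves_trans m1 (moves_trans m3 _); apply: moves_sym.
  apply: moves_trans (moves_cat [:: inl v] bridge) _.
  exact: moves_trans (moves_swap _ _) (moves_cat [:: inl v'] bridge).
have [t m2] := class_through (inl (next p v)).
apply: moves_trans (m1) _.
apply: (@side_double (chord_left b b') e v _ _ _ _ _ _ t Aw) => //.
- by case: inc; tauto.
- by move=> /moves_sym; exact: no_single_move (dart_sym De) Ip.
- by rewrite /retract /= lv (negbTE nUy).
- exact: moves_trans (moves_sym m1) m2.
Qed.

End Class.

(* q lies in the half-open cone at p between the two other vertices of the triangle. *)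
Definition faces p v q := 0 < ori p (nbr p v) q /\ ori p (nbr' p v) q <= 0.

(** If [q] were in the cones of two triangles at [p], a point close to [p] towards [q] would lie in
    both triangles; [cross3] then makes them share vertices. *)
Lemma faces_unique p v u q : M (pos v) p -> M (pos u) p -> faces p v q -> faces p u q -> v = u.
Proof.
move=> Mv Mu [b1 a1] [b2 a2]; have C := nbrP Mv; have C' := nbrP Mu.
move: (nbr p v) (nbr' p v) (nbr p u) (nbr' p u) C C' b1 a1 b2 a2 => b b' d d' C C' b1 a1 b2 a2.
have [op1 Mp Mb Mb' H] := C; have [op1' Mp' Md Md' _] := C'.
have [Ex Ey] := ori_bary p b b' q; have S := ori_sum p b b' q.
have [Ex' Ey'] := ori_bary p d d' q; have S' := ori_sum p d d' q.
rewrite op1 in Ex Ey S; rewrite op1' in Ex' Ey' S'.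
have a1' : 0 <= ori b' p q by rewrite ori_swap; lia.
have a2' : 0 <= ori d' p q by rewrite ori_swap; lia.
have [|||||||||pM dM dM'] := @cross3 (pos v) (pos u) p b b' p d d'
   (ori d' p q + ori p d q)%:~R (ori b' p q)%:~R (ori p b q)%:~R
   (ori b' p q + ori p b q)%:~R (ori d' p q)%:~R (ori p d q)%:~R Mp Mb Mb' Mp' Md Md';
  rewrite ?ler0z //; try lia.
- by rewrite -!intrD; congr (_%:~R); lia.
- rewrite -!intrM -!intrD; congr (_%:~R); move: Ex Ex'.
  have -> : ori b b' q = 1 - ori p b q - ori b' p q by lia.
  have -> : ori d d' q = 1 - ori p d q - ori d' p q by lia.
  lia.
- rewrite -!intrM -!intrD; congr (_%:~R); move: Ey Ey'.
  have -> : ori b b' q = 1 - ori p b q - ori b' p q by lia.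
  have -> : ori d d' q = 1 - ori p d q - ori d' p q by lia.
  lia.
have {dM'} Md'v : M (pos v) d' by apply: dM'; rewrite ltr0z.
have [n1 n2 n3] := cell_neq C'; have [m1 m2 m3] := cell_neq C.
have [a0|a0] := leP (ori d' p q) 0.
  have {}a0 : ori d' p q = 0 by lia.
  have [E|E|E] := H _ Md'v; first by case: n3.
    have : ori p b q = 0 by rewrite -E -(opprK (ori p d' q)) -ori_swap a0 oppr0.
    by lia.
  rewrite E in C'; have [/pos_inj] := side_unique (cell_rot (cell_rot C)) (cell_rot (cell_rot C')).
  by [].
have Mdv : M (pos v) d by apply: dM; rewrite ltr0z.
have [_ Sub] := cell_perm C Mp Mdv Md'v n1 n2 n3.
have Cv : cell (pos v) p d d' by split.
by have [/pos_inj] := side_unique Cv C'.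
Qed.

Lemma faces_nbr' p v : M (pos v) p -> faces p v (nbr' p v).
Proof.
move=> Mv; have [op1 _ _ _ _] := nbrP Mv; split; first by rewrite op1.
by rewrite (_ : ori _ _ _ = 0) // /ori; ring.
Qed.

(** * The cycle around one interior lattice point *)

Section Fan.
Variables (p : pt) (E : V -> edge G).
Hypotheses (Ip : inn p)
  (HE : forall v, M (pos v) p -> dart v (next p v) (E v) (nbr' p v) p).
Local Notation nx := (next p).
Definition in_fan v : bool := `[< M (pos v) p >].

Lemma in_fan_next v : in_fan (nx v) = in_fan v.
Proof.
apply/asboolP/asboolP => [|/(next_cell Ip)[]//].
by move=> h; apply: contrapT => N; apply: (N); rewrite -(next_out N).
Qed.

Lemma fan_edge_inj u v : in_fan u -> in_fan v -> E u = E v -> u = v.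
Proof.
move=> /asboolP Mu /asboolP Mv EE; have D := HE Mu; have D' := HE Mv; rewrite EE in D.
have [[//]|[E1 E2 E3 E4]] := dart_dual D D'.
by have [_ _ n] := cell_neq (nbrP Mu); case: (n E4).
Qed.

Lemma fan_sum (T : pred V) (F : V -> R) : (forall v, T (nx v) = T v) ->
  \sum_(v | T v) (F (nx v) - F v) = 0.
Proof.
move=> HT; rewrite big_split /= sumrN [X in _ - X](reindex_inj (next_inj Ip)) /=.
by rewrite [X in _ - X](eq_bigl T) ?subrr.
Qed.

(** The edge vectors of a closed path add up to 0; here they are paired with [p] minus [q].
    Invariant subsets [T] are allowed because the triangles at [p] are not yet known to form one
    orbit. *)
Lemma fan_balance (T : pred V) q : (forall v, T (nx v) = T v) -> (forall v, T v -> in_fan v) ->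
  \sum_(v | T v) len (E v) * (ori p (nbr' p v) q)%:~R = 0 :> R.
Proof.
move=> HT Tf; rewrite -[RHS](fan_sum (fun v => pairing p (pos v) - pairing q (pos v)) HT).
apply: eq_bigr => v /Tf/asboolP/HE[_ _ _ ->].
have L1 x : pairing x (pos v + len (E v) *: rotv p (nbr' p v)) =
    pairing x (pos v) + len (E v) * pairing x (rotv p (nbr' p v)).
  by rewrite !pairingE !cE !cZE; ring.
rewrite !L1.
have -> : pairing p (pos v) + len (E v) * pairing p (rotv p (nbr' p v)) -
   (pairing q (pos v) + len (E v) * pairing q (rotv p (nbr' p v))) - (pairing p (pos v) - pairing q (pos v)) =
   len (E v) * ((pairing p (rotv p (nbr' p v)) - pairing (nbr' p v) (rotv p (nbr' p v))) -
     (pairing q (rotv p (nbr' p v)) - pairing (nbr' p v) (rotv p (nbr' p v)))) by ring.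
rewrite !pairing_rotv -intrN -intrD; congr (_ * _%:~R); rewrite /ori; ring.
Qed.

(** Without a triangle of [T] facing [q], positivity of [ori p (nbr' p u) q] persists under [next].
    Either the positive part is an invariant set contradicting [fan_balance], or all values vanish,
    which the independence of consecutive neighbours forbids. *)
Lemma fan_no_arrival v q (T : pred V) : T v -> (forall v, T (nx v) = T v) -> (forall v, T v -> in_fan v) ->
  q <> p -> exists u, T u /\ faces p u q.
Proof.
move=> Tv HT Tf qp; apply: contrapT => N.
have step u : T u -> 0 < ori p (nbr' p u) q -> 0 < ori p (nbr' p (nx u)) q.
  move=> Tu y0; rewrite ltNge; apply/negP => y1; apply: N; exists (nx u); split; first by rewrite HT.
  by split=> //; have [_ ->] := next_cell Ip (asboolW (Tf _ Tu)).
pose y u : R := (ori p (nbr' p u) q)%:~R.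
have B := fan_balance q HT Tf.
have [[w Tw yw]|N2] := pselect (exists2 w, T w & 0 < ori p (nbr' p w) q).
  pose Q := [pred u | T u && (0 < ori p (nbr' p u) q)].
  have QB : \sum_(u | Q u) len (E u) * (ori p (nbr' p u) q)%:~R = 0 :> R.
    apply: fan_balance => [u|u /andP[/Tf]//] /=; rewrite HT.
    case Tu: (T u) => //=; apply/idP/idP; last exact: step.
    have inj := next_inj Ip.
    have sub : [seq nx x | x in Q] \subset Q.
      by apply/fintype.subsetP => _ /fintype.imageP[x /andP[Tx yx] ->]; rewrite inE HT Tx step.
    have eqc : [seq nx x | x in Q] =i Q by apply/subset_cardP => //; rewrite fintype.card_image.
    move=> yn; have : nx u \in Q by rewrite inE HT Tu yn.
    by rewrite -eqc => /fintype.imageP[x /andP[_ yx] /inj ->].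
  have : 0 < \sum_(u | Q u) len (E u) * (ori p (nbr' p u) q)%:~R :> R.
    rewrite (bigD1 w) /=; last by rewrite Tw yw.
    rewrite ltr_wpDr ?mulr_gt0 ?len_gt0 ?ltr0z //.
    by apply: sumr_ge0 => u /andP[/andP[_ yu] _]; rewrite ltW // mulr_gt0 ?len_gt0 ?ltr0z.
  by rewrite QB ltxx.
have y0 u : T u -> ori p (nbr' p u) q = 0.
  move=> Tu; have le (w : V) : T w -> len (E w) * (ori p (nbr' p w) q)%:~R <= 0 :> R.
    move=> Tw; rewrite pmulr_rle0 ?len_gt0 // lerz0 leNgt; apply/negP => h.
    by apply: N2; exists w.
  have : len (E u) * (ori p (nbr' p u) q)%:~R = 0 :> R.
    apply/eqP; rewrite eq_le le //=; move: B; rewrite (bigD1 u) //=.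
    have : \sum_(i | T i && (i != u)) len (E i) * (ori p (nbr' p i) q)%:~R <= 0 :> R.
      by apply: sumr_le0 => w /andP[Tw _]; exact: le.
    lra.
  by move/eqP; rewrite mulf_eq0 (negbTE (lt0r_neq0 (len_gt0 _))) intr_eq0 => /eqP.
have Mv := asboolW (Tf _ Tv); have [_ En] := next_cell Ip Mv.
have := y0 _ Tv; have : ori p (nbr' p (nx v)) q = 0 by apply: y0; rewrite HT.
have Mn : M (pos (nx v)) p by have [] := next_cell Ip Mv.
have [+ _ _ _ _] := nbrP Mn; rewrite En.
move: (nbr' p v) (nbr' p (nx v)) => b b' op1 e2 e1.
have pq : p <> q by exact: nesym.
have z (r : pt) : ori p r q = 0 -> ori p q r = 0 by rewrite /ori; lia.
have h : ori p q p = 0 by rewrite /ori; ring.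
by have := collinear_ori pq h (z _ e1) (z _ e2); rewrite op1.
Qed.

(** The orbit of [u] contains a triangle facing [nbr' p v], and by [faces_unique] this is [v]. So
    C_p is a single cycle. *)
Lemma fan_transitive u v : in_fan u -> in_fan v -> fconnect nx u v.
Proof.
move=> fu fv; have Mv := asboolW fv.
have [||||w [cw Fw]] := @fan_no_arrival u (nbr' p v) (fun w : V => fconnect nx u w).
- exact: connect0.
- by move=> w; rewrite [RHS](same_fconnect1_r (next_inj Ip)).
- move=> w /iter_findex <-; elim: (findex _ _ _) => //= n IH; by rewrite in_fan_next.
- by have [_ _ n] := cell_neq (nbrP Mv); exact: nesym.
suff -> : v = w by [].
apply: faces_unique (faces_nbr' Mv) Fw => //.
move: cw => /iter_findex <-; apply: asboolW; rewrite -/(in_fan _).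
elim: (findex _ _ _) => //= n IH; by rewrite in_fan_next.
Qed.

(** * The flow on the cycle between two special divisors *)

Section LinearFlow.
Variables (l1 l2 : seq V) (fv : V -> R) (sg : edge G -> int).
Hypothesis Hlen : forall e, fv (ends e).2 - fv (ends e).1 = (sg e)%:~R * len e.
Hypothesis Hdiv : forall v, (count_mem v l2)%:Z - (count_mem v l1)%:Z =
       \sum_e sg e * (((ends e).1 == v)%:R - ((ends e).2 == v)%:R).
Hypotheses (size1 : size l1 = 2%N) (size2 : size l2 = 2%N).

(** A sharper [level_cut]: with one slope per edge, the weight of a separated edge is exactly the
    absolute value of that slope. *)
Lemma linear_cut (tau : R) : let W := (fun x => tau < fv x) in
  exists X : edge G -> nat,
  [/\ (\sum_e X e)%N%:Z = (count W l1)%:Z - (count W l2)%:Z,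
      forall e, separated W e -> X e = `|sg e|%N & forall e, separated W e -> (0 < X e)%N].
Proof.
move=> W; exists (fun e => if separated W e then `|sg e|%N else 0%N).
have sgE e : (0 < sg e) = (fv (ends e).1 < fv (ends e).2).
  by rewrite -(ltr0z R) -(pmulr_lgt0 _ (len_gt0 e)) -Hlen subr_gt0.
have sgE' e : (sg e < 0) = (fv (ends e).2 < fv (ends e).1).
  by rewrite -(ltrz0 R) -(pmulr_llt0 _ (len_gt0 e)) -Hlen subr_lt0.
have term e : (if separated W e then `|sg e|%N else 0%N)%:Z = - (sg e * ((W (ends e).1)%:R - (W (ends e).2)%:R)).
  rewrite /separated; case W1: (W (ends e).1); case W2: (W (ends e).2) => //=.
  - by rewrite subrr mulr0.
  - have : sg e < 0 by rewrite sgE'; apply: le_lt_trans _ W1; rewrite leNgt; apply/negbT/W2.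
    by rewrite subr0 mulr1; lia.
  - have : 0 < sg e by rewrite sgE; apply: le_lt_trans _ W2; rewrite leNgt; apply/negbT/W1.
    by rewrite sub0r mulrN1; lia.
  - by rewrite subrr mulr0.
have mass l : (count W l)%:Z = \sum_(v | W v) (count_mem v l)%:Z.
  by apply: sum_count_mem => [|v _]; rewrite ?index_enum_uniq ?mem_index_enum.
have one a : \sum_(v | W v) ((a == v)%:R : int) = (W a)%:R.
  rewrite big_mkcond (bigD1 a) //= eqxx big1 ?addr0; first by case: (W a).
  by move=> v /negbTE av; rewrite eq_sym av; case: ifP.
split=> [|e ->//|e sep]; last first.
  rewrite sep absz_gt0; apply/eqP => s0; move: sep; rewrite /separated /W; have := Hlen e.
  by rewrite s0 mul0r => /eqP; rewrite subr_eq0 => /eqP ->; rewrite eqxx.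
rewrite (big_morph Posz PoszD (erefl (Posz 0))); under eq_bigr do rewrite term.
rewrite sumrN -opprB; congr (- _); rewrite !mass -sumrB.
under [RHS]eq_bigr do rewrite Hdiv.
rewrite exchange_big /=; apply: eq_bigr => e _.
by rewrite -mulr_sumr sumrB !one.
Qed.

Lemma inner_level v v' e p0 q0 : dart v v' e p0 q0 -> inn p0 -> inn q0 -> fv v = fv v'.
Proof.
move=> D Ip0 Iq0; apply: (level_eq D) => tau; apply/negP => sep.
have [X [EX _ HX]] := linear_cut tau; have := cut3 HX D Ip0 Iq0 sep.
have := count_size (fun x => tau < fv x) l1; rewrite size1; lia.
Qed.

(* A vertex at which two points of the pencil are known to coincide or to be
   joined by an edge dual to a segment between interior lattice points. *)
Definition special v q l := [/\ in_fan v, inn q &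
  (q = nbr' p v /\ l = [:: v; nx v]) \/
  [/\ ~ inn (nbr p v), ~ inn (nbr' p v), q = nbr p v + nbr' p v - p & l = [:: v; v]]].

Lemma special_faces v q l : special v q l -> faces p v q.
Proof.
move=> [/asboolP Mv Iq [[-> _]|[_ _ -> _]]]; first exact: faces_nbr'.
have [+ _ _ _ _] := nbrP Mv; rewrite /faces; move: (nbr p v) (nbr' p v) => b b' op1; split.
  have -> : ori p b (b + b' - p) = ori p b b' by rewrite /ori !cE; ring.
  by rewrite op1.
have -> : ori p b' (b + b' - p) = - ori p b b' by rewrite /ori !cE; ring.
by rewrite op1.
Qed.

Lemma special_level v q l x : special v q l -> x \in l -> fv x = fv v.
Proof.
move=> [/asboolP Mv Iq [[Eq ->]|[_ _ _ ->]]]; rewrite !inE; last by case/orP => /eqP->.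
case/orP => /eqP-> //; rewrite Eq in Iq.
by rewrite (inner_level (HE Mv)).
Qed.

(** The downward slope along the cycle from [u] to the next vertex, independent of the stored
    orientation of the edge. *)
Definition fan_flow u : int := if (ends (E u)).1 == u then - sg (E u) else sg (E u).

Lemma fan_ends u : in_fan u -> [/\ (ends (E u)).1 = u, (ends (E u)).2 = nx u & fan_flow u = - sg (E u)] \/
  [/\ (ends (E u)).1 = nx u, (ends (E u)).2 = u & fan_flow u = sg (E u)].
Proof.
move=> /asboolP/HE D; rewrite /fan_flow; have n := dart_neq D.
have [[-> ->]|[-> ->]] := dart_ends D; first by left; rewrite eqxx.
by right; case: eqP n => // ->.
Qed.

Lemma fan_flowE u : in_fan u -> fv (nx u) - fv u = - ((fan_flow u)%:~R * len (E u)).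
Proof.
move=> /fan_ends[[E1 E2 ->]|[E1 E2 ->]]; have := Hlen (E u); rewrite E1 E2 => h.
  by rewrite h intrN mulNr opprK.
by rewrite -h opprB.
Qed.

Lemma fan_flow_sum : \sum_(u | in_fan u) len (E u) * (fan_flow u)%:~R = 0 :> R.
Proof.
have := fan_sum fv (T := in_fan) in_fan_next.
under eq_bigr => u fu do rewrite (fan_flowE fu) mulrC.
by rewrite sumrN => /eqP; rewrite oppr_eq0 => /eqP.
Qed.

Variables (v1 v2 : V) (q1 q2 : pt).
Hypotheses (S1 : special v1 q1 l1) (S2 : special v2 q2 l2).

Lemma two_parts (x y n : nat) : n = 2%N -> (x + y <= n)%N -> (0 < x)%N -> (0 < y)%N -> x = 1%N /\ y = 1%N.
Proof. lia. Qed.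

(** Each special divisor sits on one level, so a level across [e] separates [v1] from [v2] and has
    total slope 2. The cycle already crosses it twice, which exhausts this total. *)
Lemma flow_in_fan e : sg e != 0 -> `|sg e|%N = 1%N /\ exists u, in_fan u /\ e = E u.
Proof.
move=> s0; pose tau := Num.min (fv (ends e).1) (fv (ends e).2); pose W := fun x => tau < fv x.
have sep : separated W e.
  rewrite /separated /W /tau; have [lt|lt|eq_] := ltgtP (fv (ends e).1) (fv (ends e).2); rewrite ?ltxx ?lt //.
  by move: (Hlen e); rewrite eq_ subrr => /esym/eqP; rewrite mulf_eq0 intr_eq0 (negbTE s0) (negbTE (lt0r_neq0 (len_gt0 e))).
have [X [EX XE HX]] := linear_cut tau; rewrite -/W in EX XE HX.
have cst v q l : special v q l -> size l = 2%N -> count W l = (2 * W v)%N.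
  move=> S sz; have C : forall x, x \in l -> W x = W v by move=> x /(special_level S) E0; rewrite /W E0.
  rewrite (eq_in_count (a2 := fun=> W v)) //; case: (W v); rewrite ?count_predT ?count_pred0 ?sz //.
rewrite (cst _ _ _ S1 size1) (cst _ _ _ S2 size2) in EX.
have X1 : (1 <= \sum_e X e)%N by rewrite (bigD1 e) //= addn_gt0 HX.
have [X2 W12] : (\sum_e X e = 2)%N /\ W v1 != W v2 by case: (W v1) EX; case: (W v2) => //=; lia.
have [f1 _ _] := S1; have [f2 _ _] := S2.
have [u [fu su]] : exists u, in_fan u /\ W u != W (nx u).
  apply: contrapT => N; move/eqP: W12; apply.
  have H u : in_fan u -> W (nx u) = W u.
    by move=> fu; apply/eqP; rewrite eq_sym; apply/negPn/negP => h; apply: N; exists u.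
  have := fan_transitive f1 f2 => /iter_findex <-.
  suff /(_ (findex nx v1 v2))[_ ->] : forall n, in_fan (iter n nx v1) /\ W (iter n nx v1) = W v1 by [].
  by elim=> //= n [IH1 IH2]; rewrite in_fan_next H.
have [u' [Mu' uu' su']] := fan_parity Ip su.
have fu' : in_fan u' by apply/asboolP.
have sE x : in_fan x -> W x != W (nx x) -> separated W (E x).
  by move=> /asboolP/HE D; rewrite (dart_separated W D).
have Eu := sE _ fu su; have Eu' := sE _ fu' su'.
have ne : E u != E u' by apply/eqP => /(fan_edge_inj fu fu') /esym.
have := HX _ Eu; have := HX _ Eu'; have := HX _ sep; rewrite -(XE _ sep).
move=> h1 h2 h3; have [e1 e2] := two_parts X2 (sum2_le X ne) h3 h2.
case: (eqVneq e (E u)) => [Ee|n1]; first by split; [rewrite Ee|exists u].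
case: (eqVneq e (E u')) => [Ee|n2]; first by split; [rewrite Ee|exists u'].
by have := sum3_le X n1 n2 ne; rewrite X2 e1 e2 addn1; case: (X e) h1 => [|[]].
Qed.

Lemma flow_bound u : - 1 <= fan_flow u <= 1.
Proof.
have : - 1 <= sg (E u) <= 1.
  have [->//|/flow_in_fan[h _]] := eqVneq (sg (E u)) 0; lia.
by rewrite /fan_flow; case: ifP; lia.
Qed.

Lemma flow_inner u : in_fan u -> inn (nbr' p u) -> fan_flow u = 0.
Proof.
move=> fu Iu; have := fan_flowE fu; rewrite (inner_level (HE (asboolW fu)) Iu Ip) subrr.
by move=> /esym/eqP; rewrite oppr_eq0 mulf_eq0 (negbTE (lt0r_neq0 (len_gt0 _))) orbF intr_eq0 => /eqP.
Qed.

Lemma flow_conservation u : in_fan u ->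
  fan_flow (nx u) - fan_flow u = (count_mem (nx u) l1)%:Z - (count_mem (nx u) l2)%:Z.
Proof.
move=> fu; have fn : in_fan (nx u) by rewrite in_fan_next.
have nn : nx u <> u by have := dart_neq (HE (asboolW fu)); exact: nesym.
have nnn : nx (nx u) <> nx u by have := dart_neq (HE (asboolW fn)); exact: nesym.
have Fu := fan_ends fu; have Fn := fan_ends fn.
have inj (w : V) : nx w = nx u -> w = u by exact: (next_inj Ip).
move: (nx (nx u)) nnn Fn => m mn Fn; move: (nx u) fn nn Fu Fn mn inj => n fn nn Fu Fn mn inj.
have ne : E n != E u by apply/eqP => /(fan_edge_inj fn fu).
have T1 : sg (E n) * (((ends (E n)).1 == n)%:R - ((ends (E n)).2 == n)%:R) = - fan_flow n.
  have [[-> -> ->]|[-> -> ->]] := Fn; rewrite (introF eqP mn) eqxx.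
    by rewrite subr0 mulr1 opprK.
  by rewrite sub0r mulrN1.
have T2 : sg (E u) * (((ends (E u)).1 == n)%:R - ((ends (E u)).2 == n)%:R) = fan_flow u.
  have [[-> -> ->]|[-> -> ->]] := Fu; rewrite (introF eqP (nesym nn)) eqxx.
    by rewrite sub0r mulrN1.
  by rewrite subr0 mulr1.
have := Hdiv n; rewrite (bigD1 (E n)) // (bigD1 (E u)) ?(eq_sym (E u)) //= T1 T2 big1; first lia.
(* Edges off the cycle have slope 0, and the remaining edges of the cycle do not touch [n]. *)
move=> e /andP[n1 n2]; case: (eqVneq (sg e) 0) => [->|/flow_in_fan[_ [w [fw Ew]]]]; first by rewrite mul0r.
have w1 : w <> n by move=> h; rewrite Ew h eqxx in n1.
have w2 : nx w <> n by move=> /inj h; rewrite Ew h eqxx in n2.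
rewrite Ew; move: (nx w) (fan_ends fw) w2 => w' Fw w2.
by have [[-> -> _]|[-> -> _]] := Fw; rewrite (introF eqP w1) (introF eqP w2) subrr mulr0.
Qed.

Local Notation y u := (ori p (nbr' p u) q2).
Local Notation y' u := (ori p (nbr p u) q2).

(** The equations say [x + f - 2 p = k (b - p)]. A supporting functional at the boundary point [b]
    gives [2 - k >= 0], strictly if [x] is interior. *)
Lemma turn_bound x f b k : L b -> ~ inn b -> L x -> L f ->
  1 * cx x + 1 * cx f + (k - 2) * cx p = k * cx b -> 1 * cy x + 1 * cy f + (k - 2) * cy p = k * cy b ->
  k <= 2 /\ (inn x -> k <= 1).
Proof.
move=> Lb nb Lx Lf Ex Ey; have [u Hu Hu'] := boundary_inner_supp Lb nb.
have A := pairing_affine u Ex Ey; have hp := Hu' _ Ip; have hf := Hu _ Lf.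
have A' : (2 - k)%:~R * (pairing p u - pairing b u) = (pairing x u - pairing b u) + (pairing f u - pairing b u).
  rewrite -[in RHS](mul1r (pairing x u)) -[in RHS](mul1r (pairing f u)); move: A; rewrite !intrD !intrN; lra.
split=> [|Ix].
  have : 0 <= 2 - k by rewrite -(ler0z R) -(pmulr_lge0 _ hp) A' addr_ge0 ?Hu.
  lia.
have : 0 < 2 - k by rewrite -(ltr0z R) -(pmulr_lgt0 _ hp) A' ltr_wpDr ?Hu'.
lia.
Qed.

(** The relation between three consecutive rays of the smooth complete fan at [p]; [- m] is the
    self-intersection number of the toric divisor of the middle ray. *)
Lemma turn_rec u : in_fan u -> let m := ori p (nbr p u) (nbr' p (nx u)) in
  [/\ y' (nx u) = y u, y (nx u) = m * y u - y' u,
   1 * cx (nbr p u) + 1 * cx (nbr' p (nx u)) + (m - 2) * cx p = m * cx (nbr' p u) &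
   1 * cy (nbr p u) + 1 * cy (nbr' p (nx u)) + (m - 2) * cy p = m * cy (nbr' p u)].
Proof.
move=> fu; have Mu := asboolW fu; have [Mn En] := next_cell Ip Mu.
have [+ _ _ _ _] := nbrP Mu; have [+ _ _ _ _] := nbrP Mn; rewrite En.
move: (nbr p u) (nbr' p u) (nbr' p (nx u)) => d b f e2 e1 /=; split=> //.
- transitivity (ori p d b * ori p f q2); first by rewrite e1 mul1r.
  transitivity (ori p d f * ori p b q2 - ori p b f * ori p d q2); last by rewrite e2 mul1r.
  by rewrite /ori; ring.
- have I : ori p b f * (cx d - cx p) + ori p d b * (cx f - cx p) = ori p d f * (cx b - cx p) by rewrite /ori; ring.
  by rewrite e1 e2 in I; move: (ori p d f) I => k; lia.
- have I : ori p b f * (cy d - cy p) + ori p d b * (cy f - cy p) = ori p d f * (cy b - cy p) by rewrite /ori; ring.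
  by rewrite e1 e2 in I; move: (ori p d f) I => k; lia.
Qed.

(* Past the triangle facing q2 the flow is -1, and the lattice distance to the line
   through p and q2 cannot drop below -1 because the boundary is convex. *)
Definition past u := fan_flow u = -1 /\
  (0 < y u \/ (-1 <= y u <= 0 /\ y' u <= y u) \/
   (y u = -1 /\ (nbr p u = q2 \/ q2 = nbr p u + nbr' p u - p))).

Lemma past_next u : in_fan u -> past u -> fan_flow (nx u) = -1 -> nx u <> v2 -> past (nx u).
Proof.
move=> fu [fl yu] fn nv2; split=> //; have Mu := asboolW fu; have [Mn En] := next_cell Ip Mu.
have nb : ~ inn (nbr' p u) by move=> /(flow_inner fu); rewrite fl.
have [Ey' Ey Ex1 Ex2] := turn_rec fu; set m := ori p (nbr p u) _ in Ey Ex1 Ex2.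
have [_ Md Mb _] : [/\ True, M (pos u) (nbr p u), M (pos u) (nbr' p u) & True] by have [_ _ ? ? _] := nbrP Mu; split.
have Mf : M (pos (nx u)) (nbr' p (nx u)) by have [_ _ _ ? _] := nbrP Mn.
have [m2 m1] := turn_bound (proj1 Mb) nb (proj1 Md) (proj1 Mf) Ex1 Ex2.
have [yn|yn] := ltP 0 (y (nx u)); [by left|right; left].
case: yu => [yp|[[yp yy]|[yp first_]]].
(* A positive distance followed by a nonpositive one means that the next triangle faces [q2], so it
   is [v2]. *)
- case: nv2; have [fv2 _ _] := S2; apply: (faces_unique Mn (asboolW fv2) _ (special_faces S2)).
  by split=> //; rewrite Ey'.
(* In the range from -1 to 0, the recursion with [m <= 2] keeps a non-decreasing sequence
   non-decreasing. *)
- rewrite Ey' Ey in yn *; have [e|e] : y u = 0 \/ y u = -1 by lia.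
    by rewrite e in yy *; lia.
  by rewrite e in yy *; lia.
have [_ Iq _] := S2.
suff : -1 <= y (nx u) by rewrite Ey' yp; lia.
rewrite Ey yp; case: first_ => first_.
  have y0 : y' u = 0 by rewrite first_ /ori; ring.
  by have := m1 ltac:(by rewrite first_); rewrite y0; lia.
have y1 : y' u = 1.
  have [+ _ _ _ _] := nbrP Mu; rewrite first_; move: (nbr p u) (nbr' p u) => d b <-.
  by rewrite /ori !cE; ring.
(* Replacing the preceding neighbour by [q2] adds [nbr' p u - p], which raises the coefficient to
   [m + 1]. Interiority of [q2] then gives [m <= 0]. *)
have [||_ /(_ Iq) m0] := @turn_bound q2 (nbr' p (nx u)) (nbr' p u) (m + 1) (proj1 Mb) nb (proj1 Iq) (proj1 Mf).
- have -> : cx q2 = cx (nbr p u) + cx (nbr' p u) - cx p by rewrite first_ !cE.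
  move: m {Ey m1 m2} Ex1 Ex2 => m Ex1 Ex2; lia.
- have -> : cy q2 = cy (nbr p u) + cy (nbr' p u) - cy p by rewrite first_ !cE.
  move: m {Ey m1 m2} Ex1 Ex2 => m Ex1 Ex2; lia.
by rewrite y1; lia.
Qed.

Hypothesis turn_pos : 0 < ori p q1 q2.

Lemma prev_ex v : in_fan v -> exists2 t, in_fan t & nx t = v.
Proof.
move=> fv'; have E1 := f_finv (next_inj Ip) v.
by exists (finv nx v) => //; rewrite -in_fan_next E1.
Qed.

Lemma special_neq : v1 <> v2.
Proof.
move=> E12; have qq : q1 <> q2 by move=> Eq; move: turn_pos; rewrite Eq /ori; lia.
apply: qq; have [_ I1 H1] := S1; have [_ I2 H2] := S2; rewrite -E12 in H2.
case: H1 H2 => [[e1 _]|[_ nb e1 _]] [[e2 _]|[_ nb2 e2 _]]; rewrite ?e1 ?e2 //.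
- by case: nb2; rewrite -e1.
- by case: nb; rewrite -e2.
Qed.

Lemma special_count v q l v' q' l' : special v q l -> special v' q' l' -> v <> v' ->
  ~ inn (nbr p v) -> count_mem v l' = 0%N.
Proof.
move=> Sv [fv' Iq' H] vv nb; have n1 : (v' == v) = false by apply/eqP => h; apply: vv.
have n2 : q' = nbr' p v' -> (nx v' == v) = false.
  move=> e; apply/eqP => h; apply: nb; have [_ En] := next_cell Ip (asboolW fv').
  by rewrite -h En -e.
by case: H => [[/n2 n3 ->]|[_ _ _ ->]] /=; rewrite n1 ?n3.
Qed.

Lemma start_pos : 0 < y v1.
Proof.
have [f1 _ [[e _]|[_ _ e _]]] := S1; first by rewrite -e.
rewrite ltNge; apply/negP => y0; apply: special_neq; have [f2 _ _] := S2.
apply: (faces_unique (asboolW f1) (asboolW f2) _ (special_faces S2)); split=> //.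
have : y' v1 + y v1 = ori p q1 q2 by rewrite [in RHS]e /ori !cE; ring.
by lia.
Qed.

(** For a chord both chips of [l2] sit at [v2], so the flow jumps from 1 to -1 there. For an inner
    edge it is 0 on that edge and drops to -1 one step later, unless [v1] comes next. *)
Lemma past_start : [\/ past v2 | y v2 = 0 /\ fan_flow v2 = 0 /\ (nx v2 <> v1 -> past (nx v2))].
Proof.
have [f2 I2 [[e el]|[nb nb' e el]]] := S2; have M2 := asboolW f2; have [op1 _ _ _ _] := nbrP M2.
  have fl : fan_flow v2 = 0 by apply: flow_inner => //; rewrite -e.
  right; split; first by rewrite -e /ori; ring.
  split=> // nv; have := flow_conservation f2; rewrite fl subr0 el /=.
  have n0 := dart_neq (HE M2); have -> : (v2 == nx v2) = false by apply/eqP.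
  have c1 : count_mem (nx v2) l1 = 0%N.
    have [f1 _ H1] := S1; have n1 : (v1 == nx v2) = false by apply/eqP => h; apply: nv.
    have n2 : (nx v1 == nx v2) = false by apply/eqP => /(next_inj Ip); exact: special_neq.
    by case: H1 => [[_ ->]|[_ _ _ ->]] /=; rewrite n1 ?n2.
  rewrite c1 eqxx => fl'; have [Mn En] := next_cell Ip M2; have [op2 _ _ _ _] := nbrP Mn.
  split; first by rewrite fl'.
  right; right; rewrite En -e; split; last by left.
  by move: op2; rewrite En -e => <-; move: (nbr' p (nx v2)) => d; rewrite /ori; ring.
left; have [t ft Et] := prev_ex f2.
have := flow_conservation ft; rewrite Et (special_count S2 S1 (nesym special_neq) nb) el /= eqxx => fl.
split; first by have := flow_bound v2; have := flow_bound t; lia.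
right; right; split; last by right.
rewrite -op1 [X in ori _ _ X]e; move: (nbr p v2) (nbr' p v2) => b b'.
by rewrite /ori !cE; ring.
Qed.

Lemma iter_in_fan n u : in_fan u -> in_fan (iter n nx u).
Proof. by move=> fu; elim: n => //= n IH; rewrite in_fan_next. Qed.

(** Number the cycle from [v2]. From [v1] on, the distance stays positive, as a sign change would be
    a triangle facing [q2], and the flow is at most 1. Between the start at [v2] and [v1] no further
    chips are met, so the flow stays -1 and [past] bounds the distance below. *)
Lemma flow_le u : in_fan u -> fan_flow u <= y u.
Proof.
move=> fu; have [f1 _ _] := S1; have [f2 _ _] := S2.
pose k := findex nx v2 v1; pose U i := iter i nx v2.
have c1 := fan_transitive f2 f1; have kN : (k < order nx v2)%N by exact: findex_max.
have Uk : U k = v1 by exact: iter_findex.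
have idx i : (i < order nx v2)%N -> findex nx v2 (U i) = i by exact: findex_iter.
have U0 i : (0 < i)%N -> (i < order nx v2)%N -> U i <> v2.
  by move=> i0 /idx; move=> Ei E2; rewrite E2 findex0 in Ei; rewrite -Ei in i0.
have fU i : in_fan (U i) by exact: iter_in_fan.
have after i : (k + i < order nx v2)%N -> 0 < y (U (k + i)%N).
  elim: i => [|i IH]; first by rewrite addn0 Uk start_pos.
  rewrite addnS => lt; have {}IH := IH (ltnW lt); rewrite ltNge; apply/negP => y0.
  apply: (U0 (k + i).+1) => //; apply: (faces_unique (asboolW (fU _)) (asboolW f2) _ (special_faces S2)).
  by split=> //=; have [-> _ _ _] := turn_rec (fU (k + i)%N).
have [j Ej] : exists2 i, (i < order nx v2)%N & U i = u.
  have c2 := fan_transitive f2 fu; exists (findex nx v2 u); first exact: findex_max.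
  exact: iter_findex.
move=> Eu; rewrite -Eu; have [kj|jk] := leqP k j.
  have := flow_bound (U j); have := after (j - k)%N; rewrite subnKC // => /(_ Ej); lia.
have past_le (w : V) : past w -> fan_flow w <= y w by move=> [-> h]; lia.
have past_step i : (i.+1 < k)%N -> past (U i) -> past (U i.+1).
  move=> ik pi; have lt : (i.+1 < order nx v2)%N by exact: ltn_trans ik kN.
  have nv2 : U i.+1 <> v2 by exact: U0.
  apply: past_next => //; have := flow_conservation (fU i); rewrite -/(U i.+1) (proj1 pi).
  have nv1 : U i.+1 <> v1.
    by move=> E1; have := idx _ lt; rewrite E1 -/k => E2; rewrite E2 ltnn in ik.
  have ni1 : U i <> v1.
    by move=> E1; have := idx _ (ltnW lt); rewrite E1 -/k => E2; rewrite E2 ltnNge leqnSn in ik.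
  have c0 : count_mem (U i.+1) l1 = 0%N.
    have [_ _ H1] := S1; have n1 : (v1 == U i.+1) = false by apply/eqP => h; apply: nv1.
    have n2 : (nx v1 == U i.+1) = false by apply/eqP => /(next_inj Ip) h; apply: ni1.
    by case: H1 => [[_ ->]|[_ _ _ ->]] /=; rewrite n1 ?n2.
  have c2 : count_mem (U i.+1) l2 = 0%N.
    have [_ _ H2] := S2; have n1 : (v2 == U i.+1) = false by apply/eqP => h; apply: nv2.
    have n2 : q2 = nbr' p v2 -> (nx v2 == U i.+1) = false.
      move=> e2; apply/eqP => /(next_inj Ip) Ei; have := proj1 pi; rewrite -[U i]Ei.
      by rewrite flow_inner // -e2; case: S2.
    by case: H2 => [[/n2 n3 ->]|[_ _ _ ->]] /=; rewrite n1 ?n3.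
  by rewrite c0 c2 => /eqP; rewrite subr_eq addr0 => /eqP ->; rewrite add0r.
have from i0 i : past (U i0) -> (i0 <= i)%N -> (i < k)%N -> past (U i).
  by move=> p0; elim: i => [|i IH]; [rewrite leqn0 => /eqP <-|rewrite leq_eqVlt => /orP[/eqP <-//|] le lt; apply: past_step => //; apply: IH => //; exact: ltnW].
case: past_start => [p0|[y0 [fl0 p1]]]; first by apply/past_le/(from 0%N).
case: j Ej Eu jk => [|j] Ej Eu jk; first by rewrite /= y0 fl0.
apply/past_le/(from 1%N) => //; apply: p1 => E1.
have lt1 : (1 < order nx v2)%N by apply: leq_trans Ej.
by have := idx _ lt1; rewrite /= E1 -/k => E2; rewrite E2 in jk.
Qed.

(** Both sides have length-weighted sum 0 around the cycle, so the termwise inequality is an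
    equality. *)
Lemma flow_eq u : in_fan u -> fan_flow u = y u.
Proof.
move=> fu; have B := fan_balance (T := in_fan) q2 in_fan_next (fun _ h => h); have F := fan_flow_sum.
have Z : \sum_(w | in_fan w) len (E w) * (y w - fan_flow w)%:~R = 0 :> R.
  under eq_bigr do rewrite intrD intrN mulrBr.
  by rewrite sumrB B F subrr.
have ge (w : V) : in_fan w -> 0 <= len (E w) * (y w - fan_flow w)%:~R :> R.
  by move=> fw; rewrite pmulr_rge0 ?len_gt0 // ler0z subr_ge0 flow_le.
have := psumr_eq0P ge Z fu.
by move/eqP; rewrite mulf_eq0 (negbTE (lt0r_neq0 (len_gt0 _))) intr_eq0 subr_eq0 => /eqP ->.
Qed.

(** The equality fails at [v1]: an inner edge has flow 0 but positive distance, and at a chord the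
    flow jumps from -1 to 1, so the distances before and after would add up to 0 instead of
    [ori p q1 q2]. *)
Lemma special_turn_false : False.
Proof.
have [f1 I1 [[e _]|[nb nb' e el]]] := S1; have [op1 _ _ _ _] := nbrP (asboolW f1).
  by have := flow_eq f1; rewrite -e flow_inner // -?e // => h; move: turn_pos; rewrite -h ltxx.
have [t ft Et] := prev_ex f1; have := flow_conservation ft.
rewrite Et (special_count S1 S2 special_neq nb) el /= eqxx.
have := flow_bound v1; have := flow_bound t; have := flow_eq f1; have := flow_eq ft.
have [+ _ _ _] := turn_rec ft; rewrite Et => yt.
have : y' v1 + y v1 = ori p q1 q2 by rewrite [in RHS]e /ori !cE; ring.
by rewrite yt; have := turn_pos; lia.
Qed.

End LinearFlow.

End Fan.

(** * Collinearity of the interior lattice points *)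

Section Nonparallel.
Variable s : seq (gpoint G).
Hypothesis HK : forall x, exists s' : seq (gpoint G), [/\ size s' = 2%N, x \in s' & moves s s'].

Lemma special_class p v q l : inn p -> special p v q l -> moves s (map inl l).
Proof.
move=> Ip [/asboolP Mv Iq [[e ->]|[nb nb' e ->]]] /=.
  by have [E HE] := fan_edges Ip; rewrite e in Iq; exact: (class_inner_edge HK (HE v Mv) Iq Ip).
by rewrite e in Iq; exact: (class_chord HK (nbrP Mv)).
Qed.

Lemma special_size p v q l : special p v q l -> size l = 2%N.
Proof. by move=> [_ _ [[_ ->]|[_ _ _ ->]]]. Qed.

Lemma special_parallel p v1 q1 l1 v2 q2 l2 : inn p -> special p v1 q1 l1 -> special p v2 q2 l2 ->
  ori p q1 q2 = 0.
Proof.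
move=> Ip; suff W v3 q3 l3 v4 q4 l4 : special p v3 q3 l3 -> special p v4 q4 l4 -> ori p q3 q4 <= 0.
  move=> S1 S2; apply/eqP; rewrite eq_le (W _ _ _ _ _ _ S1 S2) -oppr_le0 -[- _]/(- ori p q1 q2).
  by rewrite (_ : - ori p q1 q2 = ori p q2 q1) ?(W _ _ _ _ _ _ S2 S1) // /ori; ring.
move=> S1 S2; rewrite leNgt; apply/negP => pos_.
have m := moves_trans (moves_sym (special_class Ip S1)) (special_class Ip S2).
have [fv [sg [Hl Hd]]] := moves_vertices m; have [E HE] := fan_edges Ip.
exact: (special_turn_false Ip HE Hl Hd (special_size S1) (special_size S2) S1 S2).
Qed.

(** The same edge or bridge seen from its other end, so that being joined by a special divisor is
    symmetric. *)
Lemma special_back p v q l : inn p -> special p v q l -> exists v' l', special q v' p l'.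
Proof.
move=> Ip [/asboolP Mv Iq [[e _]|[nb nb' e _]]].
  have [f D] := nextP Ip Mv; rewrite -e in D.
  have [M' En Ev] := dart_next (dart_sym D) Iq.
  exists (next p v), [:: next p v; next q (next p v)]; split=> //; first exact/asboolP.
  by left; rewrite En.
have C := nbrP Mv; have [v' [f D]] : exists v' f, dart v v' f (nbr p v) (nbr' p v).
  apply: (dart_exists (cell_rot C) (proj1 Iq)); rewrite e.
  have -> : ori (nbr p v) (nbr' p v) (nbr p v + nbr' p v - p) = - ori p (nbr p v) (nbr' p v).
    by rewrite /ori !cE; ring.
  by have [-> _ _ _ _] := C.
have [_ [t C'] _ _] := D; have Et := chord_apex C C' nb nb' Ip; rewrite -e in Et; subst t.
have [E1 E2] := nbrE (cell_rot (cell_rot C')); have [_ _ _ Mq _] := C'.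
exists v', [:: v'; v']; split=> //; first exact/asboolP.
right; rewrite E1 E2; split=> //; rewrite e.
by apply: col2P; rewrite !cE; ring.
Qed.

(** Walk towards a point [r] off the line, starting at a triangle with a vertex in [S]. Each crossed
    side has an end in [S] or is a boundary chord whose apex [b + b' - p] enters [S], so the walk
    never loses [S]; but it ends at [r], which is not in [S]. *)
Lemma inner_collinear p0 : inn p0 -> exists2 q, q <> p0 & forall r, inn r -> ori p0 q r = 0.
Proof.
move=> I0; have [q [q0 Hq]] : exists q, q <> p0 /\ forall v q' l, special p0 v q' l -> ori p0 q q' = 0.
  case: (pselect (exists v q l, special p0 v q l)) => [[v [q [l Sp]]]|N]; last first.
    (* With no special direction at [p0], any second point may define the line. *)
    exists (p0 + mkcol 1 0); split.
      by move=> e; have : cx p0 + cx (mkcol 1 0 : pt) = cx p0 by [rewrite -cxD e]; rewrite cx_mk; lia.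
    by move=> v q' l Sp; case: N; exists v, q', l.
  exists q; split; last by move=> v' q' l'; exact: special_parallel Sp.
  by move=> e; have [+ _] := special_faces Sp; rewrite e /ori; lia.
(* [S] also demands that the special directions stay on the line. This propagates: at a new point
   one direction leads back along the line, and all others are parallel to it. *)
pose S p := [/\ inn p, ori p0 q p = 0 & forall v q' l, special p v q' l -> ori p0 q q' = 0].
have pq : p0 <> q by exact: nesym.
have l0 : ori p0 q p0 = 0 by rewrite /ori; ring.
have lq : ori p0 q q = 0 by rewrite /ori; ring.
have S0 : S p0 by split.
have SS p v q' l : S p -> special p v q' l -> S q'.
  move=> [Ip lp Hp] Sp; have lq' := Hp _ _ _ Sp; have [_ Iq' _] := Sp; split=> // v2 q2 l2 Sp2.
  have [v3 [l3 Sp3]] := special_back Ip Sp.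
  have h := special_parallel Iq' Sp3 Sp2.
  have ne : q' <> p by move=> e; have [+ _] := special_faces Sp; rewrite e /ori; lia.
  exact: (collinear_ori ne (collinear_ori pq lq' lp l0) (collinear_ori pq lq' lp lq) h).
exists q => // r Ir; apply: contrapT => nr.
have [v0 M0] := lattice_vertex (proj1 I0).
suff Q : forall v, ~ exists2 p, M (pos v) p & S p by apply: (Q v0); exists p0.
apply: (@walk_ind (toR R r)) => v IH [p Mp Sp]; have [Ip lp Hp] := Sp.
have C := nbrP Mp; have C2 := cell_rot C; have C3 := cell_rot C2.
have cross_side a b t : cell (pos v) a b t -> ori a b r < 0 -> forall t', M (pos v) t' -> S t' -> t' = a \/ t' = b -> False.
  move=> Ca oa t' Mt' St' tab; have [v' [e D]] := dart_exists Ca (proj1 Ir) oa.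
  apply: (IH _ _ _ _ D); first by rewrite ori_real_toR ltrz0.
  by exists t' => //; have [_ [x [_ Mb Ma _ _]] _ _] := D; case: tab => ->.
have os1 : 0 <= ori p (nbr p v) r.
  by rewrite leNgt; apply/negP => h; apply: (cross_side _ _ _ C h p) => //; left.
have os3 : 0 <= ori (nbr' p v) p r.
  by rewrite leNgt; apply/negP => h; apply: (cross_side _ _ _ C3 h p) => //; right.
have Sb' : inn (nbr' p v) -> S (nbr' p v).
  move=> Ib; apply: (SS p v _ [:: v; next p v] Sp); split; [exact/asboolP|by []|by left].
have Sb : inn (nbr p v) -> S (nbr p v).
  move=> Ib; have Et := f_finv (next_inj Ip) v; set t := finv (next p) v in Et.
  have ft : in_fan p t by rewrite -(in_fan_next Ip) Et; exact/asboolP.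
  have [_ En] := next_cell Ip (asboolW ft); rewrite Et in En.
  by apply: (SS p t _ [:: t; next p t] Sp); split=> //; left.
have [_ _ Mb Mb' _] := C.
have notS t : S t -> r <> t by move=> [_ lt _] e; rewrite e in nr.
have [op1 _ _ _ _] := C.
(* With a second vertex in [S] every side of the triangle has an end in [S], so none can be crossed
   and [r] would be one of the vertices. *)
have far : inn (nbr p v) \/ inn (nbr' p v) -> False.
  move=> H; have os2 : 0 <= ori (nbr p v) (nbr' p v) r.
    rewrite leNgt; apply/negP => h; case: H => [/Sb h'|/Sb' h'].
      by apply: (cross_side _ _ _ C2 h _ Mb h'); left.
    by apply: (cross_side _ _ _ C2 h _ Mb' h'); right.
  have [e|e|e] := lattice_in_cell op1 os1 os2 os3; rewrite e in Ir.
  - exact: (notS p).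
  - exact: (notS _ (Sb Ir)).
  - exact: (notS _ (Sb' Ir)).
have nb : ~ inn (nbr p v) by move=> h; apply: far; left.
have nb' : ~ inn (nbr' p v) by move=> h; apply: far; right.
have os2 : ori (nbr p v) (nbr' p v) r < 0.
  rewrite ltNge; apply/negP => h; have [e|e|e] := lattice_in_cell op1 os1 h os3; rewrite e in Ir => //.
  exact: (notS p).
have Iq := chord_inner C nb nb' Ip Ir os2.
have Sq : S (nbr p v + nbr' p v - p).
  apply: (SS p v _ [:: v; v] Sp); split; [exact/asboolP|by []|by right].
have [v' [e D]] := dart_exists C2 (proj1 Ir) os2.
have [_ [t C'] _ _] := D; have Et := chord_apex C C' nb nb' Ip.
apply: (IH _ _ _ _ D); first by rewrite ori_real_toR ltrz0.
by exists t; rewrite ?Et //; have [_ _ _ + _] := C'; rewrite Et.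
Qed.

End Nonparallel.

Lemma pencil2_collinear p0 : pencil G 2 -> inn p0 ->
  exists2 q, q <> p0 & forall r, inn r -> ori p0 q r = 0.
Proof. by move=> [s [_ HK]]; exact: inner_collinear HK p0. Qed.

(** * Curves with at most one interior lattice point *)

Section FewInterior.
Variable v0 : V.
Hypothesis root_inner : forall p, inn p -> M (pos v0) p.
Hypothesis one_inner : forall p q, inn p -> inn q -> p = q.

(* v is the end of e on the side away from the root v0, or e joins v to the
   next vertex around the interior lattice point. *)
Definition owner e v := exists v' p q, [/\ dart v v' e p q, ~ inn p &
  inn q \/ (~ inn q /\ forall t, M (pos v0) t -> ori p q t <= 0)].

Lemma owner_ex e : exists v, owner e v.
Proof.
have [p [q D]] := dart_edge e; have [[r C] [r' C'] _ _] := D; have [pq _ _] := cell_neq C.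
case: (pselect (inn p)) => Ip.
  exists (ends e).2, (ends e).1, q, p; split; [exact: dart_sym| |by left].
  by move=> Iq; apply: pq; exact: one_inner.
case: (pselect (inn q)) => Iq; first by exists (ends e).1, (ends e).2, p, q; split=> //; left.
case: (chord_side v0 (cell_rot (cell_rot C)) Ip Iq) => H.
  exists (ends e).2, (ends e).1, q, p; split=> //; first exact: dart_sym.
  by right; split=> // t /H; rewrite ori_swap; lia.
by exists (ends e).1, (ends e).2, p, q; split=> //; right.
Qed.

(** A supporting functional at [q], expanded in the corner at [q], is both nonnegative and
    nonpositive on the root triangle. Since that triangle does not lie on a line, the functional
    vanishes on both sides of the corner. *)
Lemma owner_corner v p q r : cell (pos v) p q r -> ~ inn q ->
  (forall t, M (pos v0) t -> ori p q t <= 0) -> (forall t, M (pos v0) t -> ori q r t <= 0) -> False.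
Proof.
move=> C nq h1 h2; have [op1 Mp Mq Mr _] := C; have [u u0 Hu] := boundary_supp (proj1 Mq) nq.
have [a [b [d C0]]] := vertex_cell v0; have [op0 Ma Mb Md _] := C0; have [n1 n2 _] := cell_neq C.
pose Pu := pairing p u - pairing q u; pose Ru := pairing r u - pairing q u.
have P0 : 0 <= Pu by rewrite subr_ge0; apply: Hu; case: Mp.
have R0 : 0 <= Ru by rewrite subr_ge0; apply: Hu; case: Mr.
have H t : M (pos v0) t -> (ori q r t)%:~R * Pu = 0 /\ (ori p q t)%:~R * Ru = 0.
  move=> Mt; have [Ex Ey] := ori_bary p q r t; have S := ori_sum p q r t.
  rewrite op1 in Ex Ey S; have A := pairing_affine u Ex Ey; rewrite mul1r in A.
  have {}S : (ori p q t)%:~R + (ori q r t)%:~R + (ori r p t)%:~R = 1 :> R by rewrite -!intrD S.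
  have x1 : (ori q r t)%:~R * Pu <= 0 by rewrite mulr_le0_ge0 // lerz0 h2.
  have x2 : (ori p q t)%:~R * Ru <= 0 by rewrite mulr_le0_ge0 // lerz0 h1.
  have : 0 <= pairing t u - pairing q u by rewrite subr_ge0; apply: Hu; case: Mt.
  have -> : pairing t u - pairing q u = (ori q r t)%:~R * Pu + (ori p q t)%:~R * Ru.
    rewrite -A /Pu /Ru -[X in _ - X]mul1r -[in X in _ - X]S; ring.
  by move=> x3; split; lra.
have Z (x : R) (y : pt -> int) : (forall t, M (pos v0) t -> (y t)%:~R * x = 0) -> x != 0 -> forall t, M (pos v0) t -> y t = 0.
  by move=> h x0 t /h/eqP; rewrite mulf_eq0 (negbTE x0) orbF intr_eq0 => /eqP.
have Pz : Pu = 0.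
  apply/eqP/negPn/negP => /(Z _ (fun t => ori q r t) (fun t Mt => proj1 (H t Mt))) z.
  by have := collinear_ori n2 (z _ Ma) (z _ Mb) (z _ Md); rewrite op0.
have Rz : Ru = 0.
  apply/eqP/negPn/negP => /(Z _ (fun t => ori p q t) (fun t Mt => proj2 (H t Mt))) z.
  by have := collinear_ori n1 (z _ Ma) (z _ Mb) (z _ Md); rewrite op0.
apply: u0; have [|||e1 e2] := @kernel2 (cx r - cx q)%:~R (cy r - cy q)%:~R (cx p - cx q)%:~R (cy p - cy q)%:~R (cx u) (cy u).
- by rewrite -[RHS]Rz /Ru !pairingE !(intrD, intrN); ring.
- by rewrite -[RHS]Pz /Pu !pairingE !(intrD, intrN); ring.
- rewrite -!intrM -intrN -intrD (_ : _ + _ = ori p q r); last by rewrite /ori; ring.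
  by rewrite op1 oner_neq0.
by apply: col2P; rewrite ?e1 ?e2 /cx /cy mxE.
Qed.

(** Two chords with the root beyond both are excluded by [owner_corner]; a chord and an edge of the
    cycle, because the interior point belongs to the root triangle; two edges of the cycle, because
    a vertex has one successor. *)
Lemma owner_inj e e' v : owner e v -> owner e' v -> e = e'.
Proof.
move=> [v1 [p [q [D np H]]]] [v2 [p' [q' [D' np' H']]]].
have inner_case f x a b g y a' b' : dart v x f a b -> dart v y g a' b' -> inn b -> ~ inn a' -> ~ inn b' ->
    (forall t, M (pos v0) t -> ori a' b' t <= 0) -> False.
  move=> Da [[r [op1 _ _ _ Hr]] _ _ _] Ib na nb h; have [[s [_ _ Mb _ _]] _ _ _] := Da.
  have := h _ (root_inner Ib); have [e1|e1|->] := Hr _ Mb; [by case: na; rewrite -e1|by case: nb; rewrite -e1|].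
  by rewrite op1.
case: H H' => [Iq|[nq h]] [Iq'|[nq' h']].
- have Eq := one_inner Iq Iq'; subst q'.
  have [_ E1 _] := dart_next D Iq; have [_ E2 _] := dart_next D' Iq'.
  by rewrite -E2 E1 in D'; have [_ _] := dart_same D D'.
- by case: (inner_case _ _ _ _ _ _ _ _ D D' Iq np' nq' h').
- by case: (inner_case _ _ _ _ _ _ _ _ D' D Iq' np nq h).
have [[r C] _ _ _] := D; have [[r' C'] _ _ _] := D'.
have [op1 _ _ _ Hr] := C; have [_ Mp' _ _ _] := C'.
have [e1|e1|e1] := Hr _ Mp'; subst p'.
- by have [E1 _] := cell_inj3 C C'; subst q'; have [_ _] := dart_same D D'.
- have [E1 _] := cell_inj3 (cell_rot C) C'; subst q'.
  by case: (owner_corner C nq h h').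
have [E1 _] := cell_inj3 (cell_rot (cell_rot C)) C'; subst q'.
by case: (owner_corner (cell_rot (cell_rot C)) np h' h).
Qed.

Lemma few_edges : (#|edge G| <= #|vert G|)%N.
Proof.
have [f Hf] := choice owner_ex; apply: (@leq_card _ _ f) => e e' E.
by apply: (owner_inj (Hf e)); rewrite E.
Qed.

Lemma fewer_edges : (forall p, ~ inn p) -> (#|edge G| < #|vert G|)%N.
Proof.
move=> N; have [f Hf] := choice owner_ex.
have inj : injective f by move=> e e' E; apply: (owner_inj (Hf e)); rewrite E.
rewrite -(fintype.card_codom inj); apply: proper_card; apply/properP; split; first exact/fintype.subsetP.
(* The root owns no edge: it would lie beyond a side of its own triangle. *)
exists v0 => //; apply/negP => /codomP[e Ee]; have := Hf e; rewrite -Ee.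
move=> [v' [p [q [[[r C] _ _ _] _ [/N//|[_ h]]]]]].
by have [op1 _ _ Mr _] := C; have := h _ Mr; rewrite op1.
Qed.

End FewInterior.

(** * Collinear interior points: the strip and its parallel lines *)

Lemma height_le p q : inn p -> inn q -> (exists a b : int, a * (cx q - cx p) + b * (cy q - cy p) = 1) ->
  (forall r, inn r -> ori p q r = 0) -> forall t, L t -> ori p q t <= 1.
Proof.
move=> Ip Iq [a [b ab]] line t Lt; rewrite leNgt; apply/negP => y1.
pose x := a * (cx t - cx p) + b * (cy t - cy p).
(* [n] is [x / y] rounded up. It selects a lattice point [z] of height 1 in the triangle [p q t]
   with positive weight on [p] or [q]; so [z] is interior, yet off the line. *)
set y := ori p q t in y1; pose n := ((x + y - 1) %/ y)%Z.
have ny : x <= n * y <= x + y - 1.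
  have := divz_eq (x + y - 1) y; rewrite -/n.
  have := modz_ge0 (x + y - 1) (lt0r_neq0 (lt_trans ltr01 y1)).
  have := ltz_pmod (x + y - 1) (lt_trans ltr01 y1); lia.
pose z : pt := mkcol (cx p + n * (cx q - cx p) - b) (cy p + n * (cy q - cy p) + a).
have zz : ori p q z = 1 by rewrite -ab /ori /z cx_mk cy_mk; ring.
have tx : cx t - cx p = x * (cx q - cx p) - y * b.
  transitivity ((a * (cx q - cx p) + b * (cy q - cy p)) * (cx t - cx p)); first by rewrite ab mul1r.
  by rewrite /x /y /ori; ring.
have ty : cy t - cy p = x * (cy q - cy p) + y * a.
  transitivity ((a * (cx q - cx p) + b * (cy q - cy p)) * (cy t - cy p)); first by rewrite ab mul1r.
  by rewrite /x /y /ori; ring.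
suff Iz : inn z by have := line _ Iz; rewrite zz.
have Ex : (n * y - x) * cx q + (y - 1 - (n * y - x)) * cx p + 1 * cx t = y * cx z.
  have -> : cx t = cx p + (x * (cx q - cx p) - y * b) by rewrite -tx; ring.
  by rewrite /z cx_mk; ring.
have Ey : (n * y - x) * cy q + (y - 1 - (n * y - x)) * cy p + 1 * cy t = y * cy z.
  have -> : cy t = cy p + (x * (cy q - cy p) + y * a) by rewrite -ty; ring.
  by rewrite /z cy_mk; ring.
have kb : 0 <= n * y - x <= y - 1 by lia.
move: (n * y - x) kb Ex Ey => k kb Ex Ey.
clearbody y z; clear -HP Ip Iq Lt kb Ex Ey y1.
have S1 : k + (y - 1 - k) + 1 = y by ring.
have j0 : 0 <= y - 1 - k by lia.
have [k0|k0] := ltP 0 k.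
  by rewrite -[in RHS]S1 in Ex; rewrite -[in RHS]S1 in Ey; exact: (inn_conv3 HP Iq (proj1 Ip) Lt k0 j0 ler01 Ex Ey).
have k1 : 0 <= k by lia.
have j1 : 0 < y - 1 - k by lia.
have S2 : (y - 1 - k) + k + 1 = y by ring.
rewrite -[in RHS]S2 [X in X + _]addrC in Ex; rewrite -[in RHS]S2 [X in X + _]addrC in Ey.
exact: (inn_conv3 HP Ip (proj1 Iq) Lt j1 k1 ler01 Ex Ey).
Qed.

Lemma strip_ex p0 q1 : inn p0 -> inn q1 -> q1 <> p0 -> (forall r, inn r -> ori p0 q1 r = 0) ->
  exists p q, p <> q /\ forall t, L t -> -1 <= ori p q t <= 1.
Proof.
move=> I0 I1 n1 line; pose g := gcdz (cx q1 - cx p0) (cy q1 - cy p0).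
have gd1 : (g %| cx q1 - cx p0)%Z by exact: dvdz_gcdl.
have gd2 : (g %| cy q1 - cy p0)%Z by exact: dvdz_gcdr.
have [a [b ab]] := Bezoutz (cx q1 - cx p0) (cy q1 - cy p0); rewrite -/g in ab.
have g0 : 0 < g.
  have gg : 0 <= g by [].
  rewrite lt_neqAle eq_sym gg andbT; apply/negP => /eqP gz; apply: n1.
  move: gd1 gd2; rewrite gz !dvd0z !subr_eq0 => /eqP e1 /eqP e2.
  exact: col2P.
move/dvdzP: gd1 => [x Ex]; move/dvdzP: gd2 => [y Ey].
(* The first lattice point after [p0] towards [q1]: dividing by the gcd makes the direction
   primitive, as [height_le] requires. *)
pose q : pt := mkcol (cx p0 + x) (cy p0 + y).
have Bz : a * x + b * y = 1.
  apply: (mulIf (lt0r_neq0 g0)); rewrite mul1r -[RHS]ab Ex Ey; ring.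
have Iq : inn q.
  apply: (@inn_conv3 _ _ HP q q1 p0 p0 1 (g - 1) 0 I1 (proj1 I0) (proj1 I0)) => //; first lia.
    rewrite /q cx_mk; have -> : cx q1 = cx p0 + x * g by rewrite -Ex; ring.
    ring.
  rewrite /q cy_mk; have -> : cy q1 = cy p0 + y * g by rewrite -Ey; ring.
  ring.
have lineq r : inn r -> ori p0 q r = 0.
  move=> /line h; apply: (mulfI (lt0r_neq0 g0)); rewrite mulr0 -[RHS]h /ori Ex Ey /q cx_mk cy_mk; ring.
have lineq' r : inn r -> ori q p0 r = 0 by move=> /lineq h; rewrite (ori_swap p0) h oppr0.
exists p0, q; split.
  move=> e; have Ez : cx q = cx p0 by rewrite -e.
  have Ez' : cy q = cy p0 by rewrite -e.
  by move: Ez Ez' Bz; rewrite /q cx_mk cy_mk; lia.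
move=> t Lt; have h1 : ori p0 q t <= 1.
  by apply: height_le => //; exists a, b; rewrite /q cx_mk cy_mk -[RHS]Bz; ring.
have h2 : ori q p0 t <= 1.
  by apply: height_le => //; exists (- a), (- b); rewrite /q cx_mk cy_mk -[RHS]Bz; ring.
by rewrite ori_swap in h2; lia.
Qed.

(** A finite check for a triangle in the strip: [x], [y], [z] are its heights, [b1], [b2], [b3] tell
    which sides have a neighbour, [d1] and [d2] record descending rays by unit strip. The three
    slopes cancel around the triangle, so the sum over open sides is controlled by the missing
    ones. *)
Lemma descending_sides_bound (b1 b2 b3 d1 d2 : bool) (x y z : int) :
  -1 <= x <= 1 -> -1 <= y <= 1 -> -1 <= z <= 1 -> ~ (x = y /\ y = z) ->
  (~~ b1 -> (x <= -1 -> 0 <= y -> d1) /\ (x <= 0 -> 1 <= y -> d2)) ->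
  (~~ b2 -> (y <= -1 -> 0 <= z -> d1) /\ (y <= 0 -> 1 <= z -> d2)) ->
  (~~ b3 -> (z <= -1 -> 0 <= x -> d1) /\ (z <= 0 -> 1 <= x -> d2)) ->
  (if b1 then x - y else 0) + (if b2 then y - z else 0) + (if b3 then z - x else 0) <= (d1 + d2)%N /\
  (if b1 then Num.min (x - y) 0 else 0) + (if b2 then Num.min (y - z) 0 else 0) +
    (if b3 then Num.min (z - x) 0 else 0) < (d1 + d2)%N.
Proof.
move=> hx hy hz ne.
have [ex|[ex|ex]] : x = -1 \/ x = 0 \/ x = 1 by lia.
all: have [ey|[ey|ey]] : y = -1 \/ y = 0 \/ y = 1 by lia.
all: have [ez|[ez|ez]] : z = -1 \/ z = 0 \/ z = 1 by lia.
all: subst x y z; try (by case: ne).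
all: case: b1; case: b2; case: b3 => r1 r2 r3.
all: try (have [r1a r1b] := r1 isT); try (have [r2a r2b] := r2 isT); try (have [r3a r3b] := r3 isT).
all: try (have {}r1a := r1a isT isT; rewrite r1a); try (have {}r1b := r1b isT isT; rewrite r1b);
  try (have {}r2a := r2a isT isT; rewrite r2a); try (have {}r2b := r2b isT isT; rewrite r2b);
  try (have {}r3a := r3a isT isT; rewrite r3a); try (have {}r3b := r3b isT isT; rewrite r3b).
all: by clear -d1 d2; case: d1; case: d2.
Qed.

Section Strip.
Variables p0 q0 : pt.
Hypothesis pq0 : p0 <> q0.
Hypothesis strip : forall t, L t -> -1 <= ori p0 q0 t <= 1.
Local Notation phi := (ori p0 q0).

(** Its level sets are the lines of the pencil. Its slope along an edge is the difference of [phi]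
    between the ends of the dual side. *)
Definition height v : R := pairing q0 (pos v) - pairing p0 (pos v).

Lemma dart_height v v' e p q : dart v v' e p q ->
  height v' = height v + (phi p - phi q)%:~R * len e.
Proof.
move=> [_ _ _ Ev]; rewrite /height Ev.
have L1 x : pairing x (pos v + len e *: rotv q p) = pairing x (pos v) + len e * pairing x (rotv q p).
  by rewrite !pairingE !cE !cZE; ring.
rewrite !L1; have -> : phi p - phi q = ori p q q0 - ori p q p0 by rewrite /ori; ring.
by rewrite intrD intrN -!pairing_rotv; ring.
Qed.

Lemma slope_ex : exists m : edge G -> int,
  (forall e, height (ends e).2 = height (ends e).1 + (m e)%:~R * len e) /\
  forall v v' e p q, dart v v' e p q ->
    [/\ (ends e).1 = v, (ends e).2 = v' & m e = phi p - phi q] \/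
    [/\ (ends e).1 = v', (ends e).2 = v & m e = phi q - phi p].
Proof.
have /choice[m Hm] : forall e, exists k : int, exists p q, dart (ends e).1 (ends e).2 e p q /\ k = phi p - phi q.
  by move=> e; have [p [q D]] := dart_edge e; exists (phi p - phi q), p, q.
exists m; split=> [e|v v' e p q D].
  by have [p [q [D ->]]] := Hm e; exact: dart_height D.
have [a [b [D' ->]]] := Hm e.
by have [[<- <- -> ->]|[<- <- -> ->]] := dart_dual D' D; [left|right].
Qed.

(* The unbounded rays along which the height decreases, cut into unit strips. *)
Definition down (j : int) v := exists p q r, [/\ cell (pos v) p q r,
  (forall s, L s -> 0 <= ori p q s), phi p <= j & j + 1 <= phi q].

(** [z] is a multiple of [d]; the half-plane of [e] makes the factor nonpositive and that of [f]
    makes it nonnegative. *)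
Lemma no_shift (dx dy ex ey fx fy zx zy : int) : dx * zy - dy * zx = 0 ->
  0 < dx * ey - dy * ex -> 0 < dx * fy - dy * fx -> 0 <= ex * zy - ey * zx -> fx * zy - fy * zx <= 0 ->
  zx = 0 /\ zy = 0.
Proof.
move=> h1 h2 h3 h4 h5.
have I : (dx * ey - dy * ex) * (fx * zy - fy * zx) = (ex * zy - ey * zx) * (dx * fy - dy * fx) + (dx * zy - dy * zx) * (fx * ey - fy * ex).
  by ring.
have E : ex * zy - ey * zx = 0.
  have := mulr_ge0 h4 (ltW h3); have := mulr_ge0_le0 (ltW h2) h5; rewrite I h1 mul0r addr0 => g1 g2.
  have : (ex * zy - ey * zx) * (dx * fy - dy * fx) = 0 by lia.
  by move/eqP; rewrite mulf_eq0 (negbTE (lt0r_neq0 h3)) orbF => /eqP.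
have Ix : (dx * ey - dy * ex) * zx = (dx * zy - dy * zx) * ex - (ex * zy - ey * zx) * dx by ring.
have Iy : (dx * ey - dy * ex) * zy = (dx * zy - dy * zx) * ey - (ex * zy - ey * zx) * dy by ring.
by split; apply: (mulfI (lt0r_neq0 h2)); rewrite ?Ix ?Iy h1 E; ring.
Qed.

Lemma conv_ge0 (a b k l : int) : 0 < a -> 0 < b -> 0 <= k -> 0 <= l -> 0 <= a * k + b * l.
Proof. by move=> a0 b0 k0 l0; rewrite addr_ge0 // mulr_ge0 // ltW. Qed.

(** The boundary side of such a triangle has a point at height [j + 1/2], unique by [no_shift];
    [cross3] then identifies the sides. The integers [l] and [m] are the weights of that point,
    doubled to avoid the half. *)
Lemma down_unique j v u : down j v -> down j u -> v = u.
Proof.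
move=> [p [q [r [C ray pj qj]]]] [p' [q' [r' [C' ray' pj' qj']]]].
have [op1 Mp Mq Mr H] := C; have [op1' Mp' Mq' Mr' H'] := C'.
pose l := 2 * phi q - 2 * j - 1; pose m := 2 * j + 1 - 2 * phi p.
pose l' := 2 * phi q' - 2 * j - 1; pose m' := 2 * j + 1 - 2 * phi p'.
have [l0 m0 l0' m0'] : [/\ 0 < l, 0 < m, 0 < l' & 0 < m'] by rewrite /l /m /l' /m'; split; lia.
have zz : [/\ True, (l + m) * (l' * cx p' + m' * cx q') - (l' + m') * (l * cx p + m * cx q) = 0 &
   (l + m) * (l' * cy p' + m' * cy q') - (l' + m') * (l * cy p + m * cy q) = 0].
  have [] := @no_shift (cx q0 - cx p0) (cy q0 - cy p0) (cx q - cx p) (cy q - cy p) (cx q' - cx p') (cy q' - cy p')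
    ((l + m) * (l' * cx p' + m' * cx q') - (l' + m') * (l * cx p + m * cx q))
    ((l + m) * (l' * cy p' + m' * cy q') - (l' + m') * (l * cy p + m * cy q)); last by split.
  - by rewrite /l /m /l' /m' /ori; ring.
  - have -> : (cx q0 - cx p0) * (cy q - cy p) - (cy q0 - cy p0) * (cx q - cx p) = phi q - phi p by rewrite /ori; ring.
    lia.
  - have -> : (cx q0 - cx p0) * (cy q' - cy p') - (cy q0 - cy p0) * (cx q' - cx p') = phi q' - phi p' by rewrite /ori; ring.
    lia.
  - have -> : (cx q - cx p) * ((l + m) * (l' * cy p' + m' * cy q') - (l' + m') * (l * cy p + m * cy q)) -
      (cy q - cy p) * ((l + m) * (l' * cx p' + m' * cx q') - (l' + m') * (l * cx p + m * cx q)) =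
      (l + m) * (l' * ori p q p' + m' * ori p q q') by rewrite /ori; ring.
    have [a1 a2] : 0 <= ori p q p' /\ 0 <= ori p q q' by split; apply: ray; [case: Mp'|case: Mq'].
    by rewrite mulr_ge0 ?conv_ge0 // addr_ge0 // ltW.
  - have -> : (cx q' - cx p') * ((l + m) * (l' * cy p' + m' * cy q') - (l' + m') * (l * cy p + m * cy q)) -
      (cy q' - cy p') * ((l + m) * (l' * cx p' + m' * cx q') - (l' + m') * (l * cx p + m * cx q)) =
      - ((l' + m') * (l * ori p' q' p + m * ori p' q' q)) by rewrite /ori; ring.
    have [a1 a2] : 0 <= ori p' q' p /\ 0 <= ori p' q' q by split; apply: ray'; [case: Mp|case: Mq].
    by rewrite oppr_le0 mulr_ge0 ?conv_ge0 // addr_ge0 // ltW.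
have [_ zx zy] := zz; clearbody l m l' m'.
have [|||||||||Mvp' Mvq' _] := @cross3 (pos v) (pos u) p q q p' q' q'
   ((l' + m') * l)%:~R ((l' + m') * m)%:~R 0 ((l + m) * l')%:~R ((l + m) * m')%:~R 0 Mp Mq Mq Mp' Mq' Mq';
  rewrite ?ler0z ?lexx //; try by rewrite mulr_ge0 ?addr_ge0 ?ltW.
- by rewrite !addr0 -!intrD; congr (_%:~R); ring.
- by rewrite !mul0r !addr0 -!intrM -!intrD; congr (_%:~R); lia.
- by rewrite !mul0r !addr0 -!intrM -!intrD; congr (_%:~R); lia.
have lm : 0 < l + m by rewrite addr_gt0.
have {}Mvp' : M (pos v) p' by apply: Mvp'; rewrite ltr0z mulr_gt0.
have {}Mvq' : M (pos v) q' by apply: Mvq'; rewrite ltr0z mulr_gt0.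
have S0 : (l + m) * (l' * ori p q p' + m' * ori p q q') = 0.
  transitivity ((cx q - cx p) * ((l + m) * (l' * cy p' + m' * cy q') - (l' + m') * (l * cy p + m * cy q)) -
      (cy q - cy p) * ((l + m) * (l' * cx p' + m' * cx q') - (l' + m') * (l * cx p + m * cx q))).
    by rewrite /ori; ring.
  by rewrite zx zy; ring.
have [a1 a2] : 0 <= ori p q p' /\ 0 <= ori p q q' by split; apply: ray; [case: Mp'|case: Mq'].
move/eqP: S0; rewrite mulf_eq0 (negbTE (lt0r_neq0 lm)) /= paddr_eq0 ?mulr_ge0 ?(ltW l0') ?(ltW m0') //.
rewrite !mulf_eq0 (negbTE (lt0r_neq0 l0')) (negbTE (lt0r_neq0 m0')) /= => /andP[/eqP b1 /eqP b2].
have [n1 _ _] := cell_neq C'.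
have [e1|e1|e1] := H _ Mvp'; have [e2|e2|e2] := H _ Mvq';
  try (by rewrite e1 op1 in b1); try (by rewrite e2 op1 in b2); try (by case: n1; rewrite e1 e2).
- by rewrite e1 e2 in C'; have [/pos_inj] := side_unique C C'.
- by move: pj qj pj' qj'; rewrite e1 e2; lia.
Qed.

Variable m : edge G -> int.
Hypothesis height_edge : forall e, height (ends e).2 = height (ends e).1 + (m e)%:~R * len e.
Hypothesis slope_dart : forall v v' e p q, dart v v' e p q ->
    [/\ (ends e).1 = v, (ends e).2 = v' & m e = phi p - phi q] \/
    [/\ (ends e).1 = v', (ends e).2 = v & m e = phi q - phi p].

Definition open_side v p q : bool := `[< exists v' e, dart v v' e p q >].

(** Edges at a vertex correspond to the sides of its triangle that have a neighbour. *)
Lemma star_sum v p q r (g : int -> int) : cell (pos v) p q r ->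
  \sum_(e | (ends e).1 == v) g (m e) + \sum_(e | (ends e).2 == v) g (- m e) =
  (if open_side v p q then g (phi p - phi q) else 0) + (if open_side v q r then g (phi q - phi r) else 0) +
  (if open_side v r p then g (phi r - phi p) else 0).
Proof.
move=> C; pose d e a b := `[< exists v', dart v v' e a b >].
have side a b : \sum_e (if d e a b then g (phi a - phi b) else 0) = if open_side v a b then g (phi a - phi b) else 0.
  case: (boolP (open_side v a b)) => [/asboolP[v' [e D]]|N].
    rewrite (bigD1 e) //= big1 ?addr0; first by rewrite /d asboolT //; exists v'.
    move=> e' ne; rewrite /d asboolF // => -[v2 D2]; have [_ _ E] := dart_same D D2.
    by rewrite E eqxx in ne.
  rewrite big1 // => e _; rewrite /d asboolF // => -[v' D].
  by move/asboolP: N; apply; exists v', e.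
rewrite (big_mkcond (fun e => (ends e).1 == v)) (big_mkcond (fun e => (ends e).2 == v)) -!side -!big_split /=.
apply: eq_bigr => e _.
have [n1 n2 n3] := cell_neq C.
have dE v' a b : dart v v' e a b -> forall a' b', d e a' b' = (a' == a) && (b' == b).
  move=> D a' b'; apply/asboolP/andP => [[v2 D2]|[/eqP-> /eqP->]]; last by exists v'.
  have [[_ _ -> ->]//|[E _ _ _]] := dart_dual D D2; by case: (dart_neq D).
have three v' a b (k : int) : dart v v' e a b -> k = g (phi a - phi b) ->
    k = (if d e p q then g (phi p - phi q) else 0) + (if d e q r then g (phi q - phi r) else 0) +
        (if d e r p then g (phi r - phi p) else 0).
  move=> D ->; rewrite !(dE _ _ _ D); have [[t C'] _ _ _] := D.
  have [_ _ _ _ H] := C; have [_ Ma _ _ _] := C'.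
  have e1 : (p == q) = false by apply/eqP.
  have e2 : (q == r) = false by apply/eqP.
  have e3 : (p == r) = false by apply/eqP.
  have [Ea|Ea|Ea] := H _ Ma; subst a.
  - have [<- _] := cell_inj3 C C'; by rewrite !eqxx (eq_sym q) e1 (eq_sym r p) e3 /= !addr0.
  - have [<- _] := cell_inj3 (cell_rot C) C'; by rewrite !eqxx e1 (eq_sym r q) e2 /= addr0 add0r.
  - have [<- _] := cell_inj3 (cell_rot (cell_rot C)) C'; by rewrite !eqxx e2 e3 /= !add0r.
have [a [b D]] := dart_edge e; have nn := dart_neq D.
case: (eqVneq (ends e).1 v) => [E1|N1].
  have E2 : ((ends e).2 == v) = false by apply/eqP => h; apply: nn; rewrite h.
  rewrite E2 addr0; rewrite E1 in D; apply: three (D) _; congr g.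
  by have [[_ _ //]|[h _ _]] := slope_dart D; case: nn; rewrite E1 -h.
rewrite add0r; case: (eqVneq (ends e).2 v) => [E2|N2].
  rewrite E2 in D; apply: three (dart_sym D) _; congr g.
  by have [[_ _ ->]|[h _ _]] := slope_dart D; [rewrite opprB|case: nn; rewrite E2].
have no x y : d e x y = false.
  apply/asboolP => -[v' D']; have := dart_ends D'.
  by case=> -[e1 e2]; [move: N1; rewrite e1 eqxx|move: N2; rewrite e2 eqxx].
by rewrite !no !addr0.
Qed.

(** Its divisor compares the fixed divisor [base] with the intersection of the curve and the line of
    height [a]. *)
Definition cap (a : R) e (t : R) : R := Num.min (height (ends e).1 + (m e)%:~R * t) a.

Lemma cap_rational a : rational_function (fun v => Num.min (height v) a) (cap a).
Proof.
move=> e; split; rewrite /cap ?mulr0 ?addr0 // -?height_edge //.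
by apply/iplP; [exact: len_gt0|apply: ipl_min_cst; exact: len_gt0].
Qed.

Definition drop_slope (a h : R) (k : int) : int :=
  if h < a then k else if h == a then Num.min k 0 else 0.

Lemma cap_vertex a v p q r : cell (pos v) p q r -> principal_divisor (cap a) (inl v) =
  (if open_side v p q then drop_slope a (height v) (phi p - phi q) else 0) +
  (if open_side v q r then drop_slope a (height v) (phi q - phi r) else 0) +
  (if open_side v r p then drop_slope a (height v) (phi r - phi p) else 0).
Proof.
move=> C; rewrite -(star_sum (drop_slope a (height v)) C) /=; congr (_ + _); apply: eq_bigr => e /eqP Ev.
  by rewrite slope_right_min mulr0 addr0 Ev.
by rewrite slope_left_min -height_edge Ev.
Qed.

Lemma cap_interior a (et : {et : edge G * R | 0 < et.2 < len et.1}) :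
  principal_divisor (cap a) (inr et) =
  if height (ends (val et).1).1 + (m (val et).1)%:~R * (val et).2 == a then - `|m (val et).1| else 0.
Proof.
case: et => -[e t] h /=; rewrite slope_right_min slope_left_min.
case: ltgtP => _; rewrite ?addr0 ?subrr //.
by rewrite /Order.min; case: ifP => h1; case: ifP => h2; lia.
Qed.

(** A line of very small height meets only the descending rays; this is its intersection with the
    curve, retracted along them. *)
Definition base v : nat := `[< down (-1) v >] + `[< down 0 v >].

Lemma base_vertex a v : principal_divisor (cap a) (inl v) <= base v /\
  (height v = a -> principal_divisor (cap a) (inl v) < base v).
Proof.
have [p [q [r C]]] := vertex_cell v; rewrite (cap_vertex a C) /base.
have ray x y z : cell (pos v) x y z -> ~~ open_side v x y ->
   (phi x <= -1 -> 0 <= phi y -> `[< down (-1) v >]) /\ (phi x <= 0 -> 1 <= phi y -> `[< down 0 v >]).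
  move=> Cx N; have R1 s : L s -> 0 <= ori x y s.
    move=> Lss; rewrite leNgt; apply/negP => h; move/asboolP: N; apply.
    exact: dart_exists Cx Lss h.
  by split=> h1 h2; apply/asboolP; exists x, y, z; split.
have [op1 Mp Mq Mr _] := C.
have ne : ~ (phi p = phi q /\ phi q = phi r).
  by move=> [e1 e2]; have := parallel_ori pq0 e1 (etrans e1 e2); rewrite op1.
have := strip (proj1 Mp); have := strip (proj1 Mq); have := strip (proj1 Mr).
have := ray _ _ _ C; have := ray _ _ _ (cell_rot C); have := ray _ _ _ (cell_rot (cell_rot C)).
move=> r3 r2 r1 s3 s2 s1; have [B1 B2] := descending_sides_bound s1 s2 s3 ne r1 r2 r3.
rewrite /drop_slope; split; last by move=> ->; rewrite ltxx eqxx.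
case: ltgtP => _ //; last exact: ltW.
by case: ifP => _; case: ifP => _; case: ifP.
Qed.

Lemma down_seq j : exists l : seq V, (size l <= 1)%N /\ forall v, count_mem v l = `[< down j v >].
Proof.
case: (pselect (exists v, down j v)) => [[u Du]|N]; last first.
  by exists [::]; split=> // v; rewrite asboolF // => D; apply: N; exists v.
exists [:: u]; split=> // v; rewrite /= addn0; case: eqP => [<-|ne]; first by rewrite asboolT.
by rewrite asboolF // => D; apply: ne; exact: down_unique Du D.
Qed.

Lemma strip_moves : exists s : seq V, (size s <= 2)%N /\ forall a, exists s' : seq (gpoint G),
  moves (map inl s) s' /\ (forall v, height v = a -> inl v \in s') /\
  forall (et : {et : edge G * R | 0 < et.2 < len et.1}), m (val et).1 != 0 ->
    height (ends (val et).1).1 + (m (val et).1)%:~R * (val et).2 = a -> inr et \in s'.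
Proof.
have [l1 [sz1 c1]] := down_seq (-1); have [l2 [sz2 c2]] := down_seq 0.
exists (l1 ++ l2); split; first by rewrite size_cat; lia.
have cl v : count_mem (inl v) (map inl (l1 ++ l2) : seq (gpoint G)) = base v.
  rewrite count_map /base -c1 -c2 -count_cat; apply: eq_count => u /=.
  by apply/eqP/eqP => [[]|->].
have cr et : count_mem (inr et) (map inl (l1 ++ l2) : seq (gpoint G)) = 0%N.
  by rewrite count_map -(count_pred0 (l1 ++ l2)); apply: eq_count => u /=.
move=> a; have [rat pd] := rational_opp (cap_rational a).
(* The member of the pencil for the level [a]: effective by [base_vertex], and positive on the
   line. *)
pose D (x : gpoint G) : int := (count_mem x (map inl (l1 ++ l2)))%:Z - principal_divisor (cap a) x.
have De : effective D.
  move=> [v|et]; rewrite /D subr_ge0; first by rewrite cl; case: (base_vertex a v).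
  by rewrite cap_interior cr; case: ifP => // _; rewrite oppr_le0.
have Df : is_divisor D.
  have [X [_ HX]] := principal_divisor_finite (cap_rational a).
  apply: (@sub_finite_set _ _ [set` X ++ map inl (l1 ++ l2)]); last exact: finite_seq.
  move=> x /= Dx; rewrite mem_cat; apply/orP; case: (eqVneq (principal_divisor (cap a) x) 0) => [E|/HX]; [right|by left].
  by move: Dx; rewrite /D E subr0 -has_pred1 has_count eqz_nat lt0n.
have [s' Es'] := effective_count Df De.
have Es x : (count_mem x s')%:Z = D x by rewrite Es'.
exists s'; split; last split.
- by eexists; eexists; split; [exact: rat|move=> x; rewrite pd Es].
- move=> v hv; rewrite -has_pred1 has_count -ltz_nat Es /D subr_gt0 cl.
  by have [_ ->] := base_vertex a v.
move=> et m0 h; rewrite -has_pred1 has_count -ltz_nat Es /D cr cap_interior h eqxx sub0r opprK.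
by rewrite normr_gt0.
Qed.

End Strip.

(** The degree is merely bounded here; degrees 0 and 1 are excluded afterwards by [pencil0] and
    [no_pencil1]. *)
Lemma strip_pencil p q : p <> q -> (forall t, L t -> -1 <= ori p q t <= 1) ->
  exists n, (n <= 2)%N /\ pencil G n.
Proof.
move=> pq Hs; have [m [Hm Hd]] := slope_ex p q.
have [s0 [sz Hmv]] := strip_moves pq Hs Hm Hd.
exists (size s0); split=> //; exists (map inl s0); split; first by rewrite size_map.
have fin (x : gpoint G) (s' : seq (gpoint G)) : moves (map inl s0) s' -> x \in s' ->
    exists s' : seq (gpoint G), [/\ size s' = size s0, x \in s' & moves (map inl s0) s'].
  by move=> ms xs; exists s'; split=> //; rewrite (moves_sizeE ms) size_map.
case=> [v|et].
  have [s' [ms [Hv _]]] := Hmv (height p q v); exact: fin ms (Hv _ erefl).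
have [m0|m0] := eqVneq (m (val et).1) 0; last first.
  have [s' [ms [_ He]]] := Hmv (height p q (ends (val et).1).1 + (m (val et).1)%:~R * (val et).2).
  exact: fin ms (He _ m0 erefl).
(* A line does not meet an edge of constant height transversally. Both ends of the edge belong to
   the member, and they move inwards together. *)
have [s' [ms [Hv _]]] := Hmv (height p q (ends (val et).1).1).
have [p' [q' D]] := dart_edge (val et).1; have nn := dart_neq D.
have i1 := Hv _ erefl; have i2 : inl (ends (val et).1).2 \in s'.
  by apply: Hv; rewrite Hm m0 mul0r addr0.
have sz' : (size s' <= 2)%N by rewrite (moves_sizeE ms) size_map.
have [ms' _] : moves s' [:: inl (ends (val et).1).1; inl (ends (val et).1).2] /\ True.
  split=> //; have ne : (inl (ends (val et).1).1 : gpoint G) != inl (ends (val et).1).2 by apply/eqP => -[].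
  move: (inl (ends (val et).1).1 : gpoint G) (inl (ends (val et).1).2 : gpoint G) i1 i2 ne => x y.
  case: s' sz' {ms Hv} => [|a [|b []]] //= _.
    by rewrite !inE => /eqP-> /eqP->; rewrite eqxx.
  rewrite !inE => /orP[]/eqP-> /orP[]/eqP->; rewrite ?eqxx // => _; first exact: moves_refl.
  exact: moves_swap.
have tin : 0 < (val et).2 < len (val et).1 by exact: (valP et).
apply: (fin _ _ (moves_trans ms (moves_trans ms' (moves_edge_ends tin)))).
rewrite inE (point_on_in tin); apply/orP; left; apply/eqP; congr inr.
by apply: val_inj; rewrite /= -surjective_pairing.
Qed.

(** A single interior point counts as collinear with any [q]; there the edge count replaces the
    strip. Without interior points the same count yields a pencil of degree 1. *)
Theorem gonality_collinear (Gamma : mgraph R) : is_skeleton G Gamma ->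
  gonality Gamma = 2%N <-> exists2 p, inn p & exists2 q, q <> p & forall r, inn r -> ori p q r = 0.
Proof.
move=> sk; have [Hs _] := sk; have [v _] := some_vertex.
have [w] := simplifies_vertex Hs v; rewrite (gonality2P w) -!(pencil_simplifies _ Hs).
have [small2 small1] := skeleton_small sk v curve_connected; split.
  move=> [p2 np1]; have [[p Ip]|N] := pselect (exists p, inn p); last first.
    have no p : ~ inn p by move=> Ip; apply: N; exists p.
    case: np1; apply/(pencil_simplifies 1 Hs)/small1.
    by apply: (@fewer_edges v) => [p /no|p q /no|] //.
  by exists p => //; have [q qp H] := pencil2_collinear p2 Ip; exists q.
move=> [p Ip [q qp line]]; have np1 := no_pencil1 Ip; split=> //.
have [[q1 [Iq1 n1]]|N] := pselect (exists q1, inn q1 /\ q1 <> p).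
  have pq : p <> q by exact: nesym.
  have line1 r : inn r -> ori p q1 r = 0.
    move=> Ir; have lp : ori p q p = 0 by rewrite /ori; ring.
    exact: (collinear_ori pq lp (line _ Iq1) (line _ Ir)).
  have [p' [q' [n' H]]] := strip_ex Ip Iq1 n1 line1.
  have [n [n2 pn]] := strip_pencil n' H.
  by case: n n2 pn => [|[|[|//]]] // _ /(pencil0 v).
have one r : inn r -> r = p by move=> Ir; apply: contrapT => n1; apply: N; exists r.
have [v0 M0] := lattice_vertex (proj1 Ip).
apply/(pencil_simplifies 2 Hs)/small2; apply: (@few_edges v0) => [r /one ->//|r t /one -> /one ->//].
Qed.

End Curve.

(** * Lattice width and expected gonality *)

Section Width.
Variable R : realType.
Implicit Types (P : set 'cV[R]_2) (A : 'M[int]_2).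
Local Notation pt := 'cV[int]_2.

Definition aff A (b z : pt) : pt := A *m z + b.

Lemma cx_mul (T : pzRingType) (A : 'M[T]_2) (z : 'cV[T]_2) : cx (A *m z) = A 0 0 * cx z + A 0 1 * cy z.
Proof.
rewrite /cx /cy mxE 2!big_ord_recl big_ord0 addr0.
by congr (A _ _ * _ + A _ _ * z _ _); apply: val_inj.
Qed.

Lemma cy_mul (T : pzRingType) (A : 'M[T]_2) (z : 'cV[T]_2) : cy (A *m z) = A 1 0 * cx z + A 1 1 * cy z.
Proof.
rewrite /cx /cy mxE 2!big_ord_recl big_ord0 addr0.
by congr (A _ _ * _ + A _ _ * z _ _); apply: val_inj.
Qed.

Lemma det2 A : \det A = A 0 0 * A 1 1 - A 1 0 * A 0 1.
Proof.
have := det_row_mx (col 0 A) (col 1 A).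
have -> : row_mx (col 0 A) (col 1 A) = A.
  apply/matrixP => i j; rewrite mxE; case: splitP => k; rewrite (ord1 k) mxE => /= Ej; congr (A _ _); exact: val_inj.
by move=> ->; rewrite /cx /cy !mxE.
Qed.

Lemma affine_toR A b z : affine_map A b (toR R z) = toR R (aff A b z).
Proof. by rewrite /affine_map /aff /toR map_mxD map_mxM. Qed.

Lemma ori_aff A b x y z : ori (aff A b x) (aff A b y) (aff A b z) = \det A * ori x y z.
Proof. by rewrite det2 /ori /aff !cE !cx_mul !cy_mul; ring. Qed.

(** The default of [least] is 0 as well, so the value 0 is meaningful only for a nonempty set. *)
Lemma least0 (S : set nat) n : S n -> least S = 0%N <-> S 0%N.
Proof.
move=> Sn; have [m Sm] : exists m, S m /\ forall k, S k -> (m <= k)%N.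
  have [m /asboolP Sm Hm] := @ex_minnP (fun k => `[< S k >]) (ex_intro _ n (asboolT Sn)).
  by exists m; split=> // k /asboolP; exact: Hm.
rewrite /least; split=> [E|S0].
  suff [+ _] : [set n | S n /\ forall m, S m -> (n <= m)%N] (xget 0%N [set n | S n /\ forall m, S m -> (n <= m)%N]).
    by rewrite E.
  by apply: xgetPex; exists m.
by case: xgetP => // k _ [_ /(_ _ S0)]; rewrite leqn0 => /eqP.
Qed.

Lemma hull_empty (K : set 'cV[R]_2) : K = set0 -> convex_hull K = set0.
Proof.
by move=> ->; rewrite -subset0; apply: smallest_sub => //; apply/convexP.
Qed.

Section Polygon.
Variable P : set 'cV[R]_2.
Hypothesis HP : lattice_polygon P.
Local Notation L := (lattice_points P).
Local Notation I := (interior_lattice_points P).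
Local Notation K := (interior_polygon P).

Lemma sub_interior_polygon r : I r -> K (toR R r).
Proof. by move=> Ir; apply: sub_hull; exists r. Qed.

Lemma interior_polygon_bounds u (a b : R) : (forall r, I r -> a <= dot (toR R r) u <= b) ->
  forall x, K x -> a <= dot x u <= b.
Proof.
move=> H x Kx; apply/andP; split.
  by apply: (hull_halfspace _ Kx) => y [r Ir <-]; case/andP: (H r Ir).
rewrite -lerN2; have dN y : - dot y u = dot y (- u) by rewrite /dot !cE; ring.
rewrite dN; apply: (hull_halfspace _ Kx) => y [r Ir <-].
by rewrite -dN lerN2; case/andP: (H r Ir).
Qed.

Lemma affine_second A b (x : 'cV[R]_2) :
  affine_map A b x 1 0 = dot x (mkcol (A 1 0)%:~R (A 1 1)%:~R) + (cy b)%:~R.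
Proof.
rewrite -/(cy (affine_map A b x)) /affine_map cyD cy_mul cy_toR /dot cx_mk cy_mk /toR !mxE.
by rewrite mulrC [X in _ + X + _]mulrC.
Qed.

Lemma fits_some : exists s, fits_in_strip K s.
Proof.
have [Ls [HLs _]] := polygon_lattice_points HP.
pose N := (\sum_(s <- Ls) absz (cy s))%N.
have HN s : L s -> - N%:Z <= cy s <= N%:Z.
  move=> /HLs sL; have : (absz (cy s) <= N)%N by rewrite /N (big_rem s) //= leq_addr.
  by lia.
(* Translation by [N] brings all second coordinates between 0 and [2 * N]. *)
exists (2 * N)%N, 1, (mkcol 0 N%:Z); split; first exact: unitmx1.
move=> x Kx; rewrite affine_second cy_mk !mxE /=.
have := @interior_polygon_bounds (mkcol 0 1) (- N%:R) N%:R _ x Kx.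
rewrite /dot !cx_mk !cy_mk mulr0 mulr1 add0r natrM => H.
have {}H : (- N%:R : R) <= cy x <= N%:R.
  apply: H => r Ir; rewrite cx_toR cy_toR mulr0 add0r mulr1.
  have := HN r (interior_subset Ir).
  by move=> /andP[h1 h2]; rewrite -(ler_int R) intrN in h1; rewrite -(ler_int R) in h2; rewrite h1 h2.
lra.
Qed.

(** Width 0 says that the second row of [A] is constant on the interior lattice points. Conversely,
    Bezout coefficients complete a primitive direction of the line to a unimodular matrix. *)
Lemma fits_zero : (exists r, I r) -> fits_in_strip K 0 <->
  exists2 p, I p & exists2 q, q <> p & forall r, I r -> ori p q r = 0.
Proof.
move=> [p Ip]; split.
  move=> [A [b [uA H]]]; exists p => //.
  have dA : \det A != 0 by move: uA; rewrite unitmxE => /eqP; apply: contraTneq => ->; rewrite unitr0.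
  (* The displacement spans the kernel of the second row of [A]. *)
  exists (p + mkcol (- A 1 1) (A 1 0)).
    rewrite -[X in _ = X]addr0 => /addrI E; move/eqP: dA; apply; rewrite det2.
    have e1 : - A 1 1 = 0 by have := congr1 (@cx int) E; rewrite cx_mk /cx mxE.
    have e2 : A 1 0 = 0 by have := congr1 (@cy int) E; rewrite cy_mk /cy mxE.
    by rewrite e2 -(opprK (A 1 1)) e1; ring.
  have E0 r : I r -> A 1 0 * cx r + A 1 1 * cy r + cy b = 0.
    move=> Ir; have := H _ (sub_interior_polygon Ir).
    rewrite affine_toR -/(cy _) cy_toR ler0z lerz0 /aff cyD cy_mul andbC -eq_le => /eqP.
    by [].
  move=> r Ir.
  transitivity ((A 1 0 * cx p + A 1 1 * cy p + cy b) - (A 1 0 * cx r + A 1 1 * cy r + cy b)).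
    by rewrite /ori !cE cx_mk cy_mk; ring.
  by rewrite (E0 _ Ip) (E0 _ Ir) subrr.
move=> [p' Ip' [q qp line]].
pose g := gcdz (cx q - cx p') (cy q - cy p').
have [a [b ab]] := Bezoutz (cx q - cx p') (cy q - cy p'); rewrite -/g in ab.
have g0 : g != 0.
  apply/eqP => gz; apply: qp; have := dvdz_gcdl (cx q - cx p') (cy q - cy p').
  have := dvdz_gcdr (cx q - cx p') (cy q - cy p'); rewrite -/g gz !dvd0z !subr_eq0 => /eqP e2 /eqP e1.
  exact: col2P.
have /dvdzP[x Ex] := dvdz_gcdl (cx q - cx p') (cy q - cy p').
have /dvdzP[y Ey] := dvdz_gcdr (cx q - cx p') (cy q - cy p').
rewrite -/g in Ex Ey.
have Bz : a * x + b * y = 1.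
  by apply: (mulIf g0); rewrite mul1r -[RHS]ab Ex Ey; ring.
pose A : 'M[int]_2 := \matrix_(i, j) (if i == 0 then (if j == 0 then a else b) else (if j == 0 then - y else x)).
have [A00 A10 A01 A11] : [/\ A 0 0 = a, A 1 0 = - y, A 0 1 = b & A 1 1 = x] by split; rewrite mxE.
exists A, (mkcol 0 (y * cx p' - x * cy p')); split.
  by rewrite unitmxE det2 A00 A10 A01 A11 (_ : _ - _ = 1) ?unitr1 // -[RHS]Bz; ring.
move=> z Kz; rewrite affine_second A10 A11 cy_mk.
have H := @interior_polygon_bounds (mkcol (- y)%:~R x%:~R) (- (y * cx p' - x * cy p')%:~R) (- (y * cx p' - x * cy p')%:~R) _ z Kz.
suff : (- (y * cx p' - x * cy p')%:~R : R) <= dot z (mkcol (- y)%:~R x%:~R) <= - (y * cx p' - x * cy p')%:~R by lra.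
apply: H => r Ir; suff -> : dot (toR R r) (mkcol (- y)%:~R x%:~R) = (- (y * cx p' - x * cy p'))%:~R by rewrite intrN lexx.
rewrite /dot cx_mk cy_mk cx_toR cy_toR -!intrM -intrD; congr (_%:~R).
have E : x * (cy r - cy p') - y * (cx r - cx p') = 0.
  by apply: (mulIf g0); rewrite mul0r -[RHS](line _ Ir) /ori Ex Ey; ring.
by move: E; lia.
Qed.

Lemma lattice_width0 : lattice_width K = 0 <->
  exists2 p, I p & exists2 q, q <> p & forall r, I r -> ori p q r = 0.
Proof.
rewrite /lattice_width; case: asboolP => [K0|nK].
  by split=> // -[p Ip _]; have := sub_interior_polygon Ip; rewrite K0.
have Iex : exists r, I r.
  apply: contrapT => N; apply: nK; apply: hull_empty; apply/seteqP; split=> // x [r Ir _].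
  by apply: N; exists r.
have [s Fs] := fits_some; rewrite -(fits_zero Iex) -(least0 Fs).
by split=> [[]|->].
Qed.

(** A functional minimal at [x] is constant on the nondegenerate triangle, hence zero. *)
Lemma inner_conv (a b d x : pt) (i j k : int) : L a -> L b -> L d -> ori a b d <> 0 ->
  0 < i -> 0 < j -> 0 < k -> i * cx a + j * cx b + k * cx d = (i + j + k) * cx x ->
  i * cy a + j * cy b + k * cy d = (i + j + k) * cy x -> inner R L x.
Proof.
move=> La Lb Ld nz i0 j0 k0 Ex Ey; split.
  by apply: (lattice_conv3 HP La Lb Ld (ltW i0) (ltW j0) (ltW k0) _ Ex Ey); lia.
move=> u u0; apply: contrapT => /forall2NP N.
have H y : L y -> 0 <= pairing y u - pairing x u.
  by move=> Ly; rewrite subr_ge0 leNgt; apply/negP => h; case: (N y).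
have A := pairing_affine u Ex Ey.
have pos_ (l : int) : 0 < l -> 0 < l%:~R :> R by rewrite ltr0z.
have {}A : i%:~R * (pairing a u - pairing x u) + j%:~R * (pairing b u - pairing x u) + k%:~R * (pairing d u - pairing x u) = 0.
  by move: A; rewrite !intrD; lra.
have Z (l : int) (y : R) : 0 < l -> l%:~R * y = 0 -> y = 0.
  by move=> /pos_/lt0r_neq0 l0 /eqP; rewrite mulf_eq0 (negbTE l0) => /eqP.
have ha := mulr_ge0 (ltW (pos_ _ i0)) (H _ La).
have hb := mulr_ge0 (ltW (pos_ _ j0)) (H _ Lb).
have hd := mulr_ge0 (ltW (pos_ _ k0)) (H _ Ld).
have ea : pairing a u - pairing x u = 0 by apply: (Z i) => //; lra.
have eb : pairing b u - pairing x u = 0 by apply: (Z j) => //; lra.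
have ed : pairing d u - pairing x u = 0 by apply: (Z k) => //; lra.
apply: u0; have [|||e1 e2] := @kernel2 R (cx b - cx a)%:~R (cy b - cy a)%:~R (cx d - cx a)%:~R (cy d - cy a)%:~R (cx u) (cy u).
- rewrite (_ : _ + _ = pairing b u - pairing a u); last by rewrite !pairingE !(intrD, intrN); ring.
  by lra.
- rewrite (_ : _ + _ = pairing d u - pairing a u); last by rewrite !pairingE !(intrD, intrN); ring.
  by lra.
- by rewrite -!intrM -intrN -intrD intr_eq0; apply/eqP.
by apply: col2P; rewrite ?e1 ?e2 /cx /cy mxE.
Qed.

(** The exceptional triangle has the interior points (0,0), (1,0) and (0,1), which are not
    collinear; so its value 3 agrees with the collinearity criterion. *)
Lemma exceptional_noncollinear p q : q <> p -> (forall r, inner R L r -> ori p q r = 0) ->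
  ~ equivalent_polygons (@exceptional_triangle R) P.
Proof.
move=> qp line [A [b [uA PE]]].
pose e1 := zpoint (-2) (-2); pose e2 := zpoint 2 0; pose e3 := zpoint 0 2.
have Lv e : exceptional_triangle (toR R e) -> L (aff A b e).
  by move=> He; rewrite /lattice_points /= PE -affine_toR; exists (toR R e).
have L1 : L (aff A b e1) by apply: Lv; apply: sub_hull; left; left.
have L2 : L (aff A b e2) by apply: Lv; apply: sub_hull; left; right.
have L3 : L (aff A b e3) by apply: Lv; apply: sub_hull; right.
have dA : \det A != 0 by move: uA; rewrite unitmxE => /eqP; apply: contraTneq => ->; rewrite unitr0.
have zE (x y : int) : cx (zpoint x y) = x /\ cy (zpoint x y) = y by rewrite /cx /cy !mxE.
have nz : ori (aff A b e1) (aff A b e2) (aff A b e3) <> 0.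
  rewrite ori_aff => /eqP; rewrite mulf_eq0 (negbTE dA) /= /ori /e1 /e2 /e3.
  by rewrite !(zE _ _).1 !(zE _ _).2.
have cvx (x y i j k : int) : 0 < i -> 0 < j -> 0 < k -> i * -2 + j * 2 + k * 0 = (i + j + k) * x ->
    i * -2 + j * 0 + k * 2 = (i + j + k) * y -> inner R L (aff A b (zpoint x y)).
  move=> i0 j0 k0 Ex Ey; apply: (inner_conv L1 L2 L3 nz i0 j0 k0); rewrite /aff !cE ?cx_mul ?cy_mul.
    rewrite /e1 /e2 /e3 !(zE _ _).1 !(zE _ _).2.
    transitivity (A 0 0 * (i * -2 + j * 2 + k * 0) + A 0 1 * (i * -2 + j * 0 + k * 2) + (i + j + k) * cx b); first by ring.
    by rewrite Ex Ey; ring.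
  rewrite /e1 /e2 /e3 !(zE _ _).1 !(zE _ _).2.
  transitivity (A 1 0 * (i * -2 + j * 2 + k * 0) + A 1 1 * (i * -2 + j * 0 + k * 2) + (i + j + k) * cy b); first by ring.
  by rewrite Ex Ey; ring.
(* The origin is the barycentre; (1,0) and (0,1) have weights 1, 4, 1 and 1, 1, 4 over 6. *)
have c0 := line _ (cvx 0 0 1 1 1 isT isT isT erefl erefl).
have c1 := line _ (cvx 1 0 1 4 1 isT isT isT erefl erefl).
have c2 := line _ (cvx 0 1 1 1 4 isT isT isT erefl erefl).
have := collinear_ori (nesym qp) c0 c1 c2; rewrite ori_aff => /eqP.
by rewrite mulf_eq0 (negbTE dA) /= /ori !(zE _ _).1 !(zE _ _).2.
Qed.

Lemma egon2P : egon P = 2 <->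
  exists2 p, inner R L p & exists2 q, q <> p & forall r, inner R L r -> ori p q r = 0.
Proof.
have IE p : I p <-> inner R L p by exact: polygon_interior.
rewrite /egon; case: asboolP => [eqv|_]; last first.
  split=> [E|[p /IE Ip [q qp line]]].
    have /lattice_width0[p Ip [q qp line]] : lattice_width K = 0 by lia.
    by exists p; [exact/IE|exists q => // r /IE/line].
  suff -> : lattice_width K = 0 by [].
  by apply/lattice_width0; exists p => //; exists q => // r /IE/line.
split=> // -[p Ip [q qp line]].
by case: (exceptional_noncollinear qp line).
Qed.

(** Stated for one fixed polygon, so that in both inclusions of the theorem the same [P] is the
    witness. *)
Lemma gonality_egon Gamma : M_P P Gamma -> gonality Gamma = 2%N <-> egon P = 2.
Proof.
move=> [c [sm [G [[pos [pos_inj pos_range pos_edge pos_unique]] sk]]]].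
have [Ls [HLs _]] := polygon_lattice_points HP.
by rewrite (gonality_collinear HP sm HLs pos_inj pos_range pos_edge pos_unique sk) egon2P.
Qed.

End Polygon.
End Width.

Theorem theorem3p5 (R : realType) (g : nat) :
  forall Gamma : mgraph R, M_nd_gon g 2 Gamma <-> M_nd_egon g 2 Gamma.
Proof.
move=> Gamma; split=> [[[P [HP gP MP]] gon]|[P [HP gP eP MP]]].
  by exists P; split=> //; apply/(gonality_egon HP MP).
by split; [exists P|apply/(gonality_egon HP MP)].
Qed.
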